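(* Let $V\models\mathsf{ZFC}$, let $G_0\subseteq\mathbb P=\mathrm{Add}(\omega,\omega_1)$ be $V$-generic, and let $\mathcal N=\mathrm{HS}^{G_0}$ be the symmetric extension of $V$ determined by $\mathbb P$, the group $\mathcal G=\mathrm{Sym}(\omega_1)$, and the countable-support filter $\mathcal F$. Then $\mathcal N\models\mathsf{ZF}+\mathsf{DC}$.
   Context: $\mathbb P=\mathrm{Add}(\omega,\omega_1)=\mathrm{Fn}(\omega_1\times\omega,2,{<}\omega)$ is the set of finite partial functions from $\omega_1\times\omega$ to $2$, ordered by reverse inclusion, as defined in $V$. $\mathcal G=\mathrm{Sym}(\omega_1)$ is the group of all permutations of $\omega_1$; $\pi\in\mathcal G$ acts on $\mathbb P$ by $\mathrm{dom}(\pi p)=\{(\pi(\alpha),n):(\alpha,n)\in\mathrm{dom}(p)\}$, $(\pi p)(\pi(\alpha),n)=p(\alpha,n)$, and on $\mathbb P$-names by $\pi\dot x=\{\langle\pi\dot y,\pi p\rangle:\langle\dot y,p\rangle\in\dot x\}$. For $E\subseteq\omega_1$, $\mathrm{Fix}(E)=\{\pi\in\mathcal G:\pi\restriction E=\mathrm{id}_E\}$. $\mathcal F$ is the normal filter of subgroups of $\mathcal G$ (closed upward, under finite intersections, and under conjugation) generated by $\{\mathrm{Fix}(E):E\in[\omega_1]^{\le\omega}\}$, where countability is computed in $V$. A name $\dot x$ is symmetric if $\mathrm{Stab}(\dot x)=\{\pi\in\mathcal G:\pi\dot x=\dot x\}\in\mathcal F$; $\dot x\in\mathrm{HS}$ (hereditarily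 symmetric) if $\dot x$ is symmetric and every name appearing in $\dot x$ is in $\mathrm{HS}$. $\mathrm{HS}^{G_0}=\{\dot x^{G_0}:\dot x\in\mathrm{HS}\}$. $\mathsf{DC}$ means dependent choice for $\omega$-sequences. *)

(* Defs.v *)
From Stdlib Require Import FunctionalExtensionality PropExtensionality.
From Stdlib Require Import ProofIrrelevance Wellfounded Relation_Operators.

(** De Bruijn variables; the remaining connectives are classically definable. *)
Inductive formula : Type :=
| fmem (i j : nat)
| feq (i j : nat)
| fbot
| fimp (phi psi : formula)
| fall (phi : formula).

Definition scons {T : Type} (x : T) (e : nat -> T) (n : nat) : T :=
  match n with O => x | S m => e m end.

Section InStructure.

(** Every notion below is interpreted inside the structure [(T, mem)]: all
    quantifiers range over [T]. *)
Context {T : Type} (mem : T -> T -> Prop).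
Local Notation "x ∈ y" := (mem x y) (at level 70).

Fixpoint sat (phi : formula) (e : nat -> T) : Prop :=
  match phi with
  | fmem i j => e i ∈ e j
  | feq i j => e i = e j
  | fbot => False
  | fimp phi psi => sat phi e -> sat psi e
  | fall phi => forall x, sat phi (scons x e)
  end.

Definition subset (x y : T) := forall z, z ∈ x -> z ∈ y.
Definition is_empty (x : T) := forall z, ~ z ∈ x.
Definition is_upair (z x y : T) := forall w, w ∈ z <-> w = x \/ w = y.
Definition is_opair (z x y : T) :=
  exists a b, is_upair a x x /\ is_upair b x y /\ is_upair z a b.
Definition is_succ (s x : T) := forall w, w ∈ s <-> w ∈ x \/ w = x.

(** [⟨x, y⟩ ∈ r]; for a function [f], [app f x y] says [f(x) = y]. *)
Definition app (r x y : T) := exists z, is_opair z x y /\ z ∈ r.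

Definition is_fun (f : T) :=
  (forall z, z ∈ f -> exists x y, is_opair z x y) /\
  (forall x y y', app f x y -> app f x y' -> y = y').
Definition is_dom (d f : T) := forall x, x ∈ d <-> exists y, app f x y.
Definition maps (f a b : T) :=
  is_fun f /\ is_dom a f /\ forall x y, app f x y -> y ∈ b.
Definition inj (f : T) := forall x x' y, app f x y -> app f x' y -> x = x'.
Definition bij (f a b : T) :=
  maps f a b /\ inj f /\ forall y, y ∈ b -> exists x, app f x y.

Definition inductive (w : T) :=
  (exists z, is_empty z /\ z ∈ w) /\
  (forall x, x ∈ w -> exists s, is_succ s x /\ s ∈ w).
Definition is_omega (w : T) :=
  inductive w /\ forall w', inductive w' -> subset w w'.

Definition finite (a : T) :=
  exists w n f, is_omega w /\ n ∈ w /\ bij f a n.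
Definition countable (a : T) :=
  exists w f, is_omega w /\ maps f a w /\ inj f.

Definition transitive (x : T) := forall y, y ∈ x -> subset y x.
(** An ordinal, in the presence of the axiom of foundation. *)
Definition is_ord (x : T) :=
  transitive x /\
  forall y z, y ∈ x -> z ∈ x -> y ∈ z \/ y = z \/ z ∈ y.
Definition is_omega1 (o : T) :=
  is_ord o /\ ~ countable o /\ forall a, a ∈ o -> countable a.

Record ZF : Prop := {
  zf_extensionality : forall x y, (forall z, z ∈ x <-> z ∈ y) -> x = y;
  zf_foundation : forall x, (exists y, y ∈ x) ->
    exists y, y ∈ x /\ forall z, z ∈ y -> ~ z ∈ x;
  zf_pairing : forall x y, exists z, is_upair z x y;
  zf_union : forall x, exists u, forall z, z ∈ u <-> exists y, z ∈ y /\ y ∈ x;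
  zf_power : forall x, exists p, forall z, z ∈ p <-> subset z x;
  zf_infinity : exists w, inductive w;
  zf_separation : forall (phi : formula) (e : nat -> T) a,
    exists b, forall x, x ∈ b <-> x ∈ a /\ sat phi (scons x e);
  zf_replacement : forall (phi : formula) (e : nat -> T) a,
    (forall x y y', x ∈ a -> sat phi (scons x (scons y e)) ->
       sat phi (scons x (scons y' e)) -> y = y') ->
    exists b, forall y,
      y ∈ b <-> exists x, x ∈ a /\ sat phi (scons x (scons y e))
}.

Definition AC : Prop :=
  forall x, (forall y, y ∈ x -> exists z, z ∈ y) ->
  exists f, is_fun f /\ is_dom x f /\ forall y z, app f y z -> z ∈ y.

Definition ZFC : Prop := ZF /\ AC.

Definition DC : Prop :=
  forall A R, (exists x, x ∈ A) ->
  (forall x, x ∈ A -> exists y, y ∈ A /\ app R x y) ->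
  exists w f, is_omega w /\ maps f w A /\
    forall n m x y, n ∈ w -> is_succ m n -> app f n x -> app f m y -> app R x y.

(** [z = ⟨⟨a, n⟩, v⟩] *)
Definition is_entry (z a n v : T) :=
  exists x, is_opair x a n /\ is_opair z x v.

(** Elements of [Fn(ω₁ × ω, 2, <ω)]; [v ∈ 2] is spelled out as [v = 0] or
    [v = {0}]. *)
Definition cond (p : T) :=
  exists w o, is_omega w /\ is_omega1 o /\ is_fun p /\ finite p /\
  forall x v, app p x v ->
    (exists a n, a ∈ o /\ n ∈ w /\ is_opair x a n) /\
    (is_empty v \/ exists z, is_empty z /\ is_succ v z).

(** [q] is stronger than [p] *)
Definition stronger (q p : T) := subset p q.

Definition dense (D : T) :=
  (forall p, p ∈ D -> cond p) /\
  (forall p, cond p -> exists q, q ∈ D /\ stronger q p).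

(** The filter is a subset of the conditions that need not belong to the
    structure; only dense sets of the structure have to be met. *)
Record generic (G : T -> Prop) : Prop := {
  gen_cond : forall p, G p -> cond p;
  gen_nonempty : exists p, G p;
  gen_up : forall p q, G q -> cond p -> stronger q p -> G p;
  gen_dir : forall p q, G p -> G q ->
    exists r, G r /\ stronger r p /\ stronger r q;
  gen_dense : forall D, dense D -> exists p, G p /\ p ∈ D
}.

Definition perm (pi : T) := exists o, is_omega1 o /\ bij pi o o.

Definition is_comp (h f g : T) := forall z, z ∈ h <->
  exists a b c, app g a b /\ app f b c /\ is_opair z a c.
Definition is_inverse (h f : T) := forall z, z ∈ h <->
  exists a b, app f a b /\ is_opair z b a.
(** [t = π ∘ s ∘ π⁻¹] *)
Definition is_conj (t pi s : T) := forall z, z ∈ t <->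
  exists a b a' b', app s a b /\ app pi a a' /\ app pi b b' /\ is_opair z a' b'.

Definition is_subgroup (H : T) :=
  (forall f, f ∈ H -> perm f) /\ (exists f, f ∈ H) /\
  (forall f g h, f ∈ H -> g ∈ H -> is_comp h f g -> h ∈ H) /\
  (forall f h, f ∈ H -> is_inverse h f -> h ∈ H).

Definition is_Fix (H E : T) := forall pi, pi ∈ H <->
  perm pi /\ forall a, a ∈ E -> app pi a a.

(** The normal filter of subgroups generated by the [Fix(E)], [E] a countable
    subset of [ω₁]. *)
Inductive inF : T -> Prop :=
| inF_Fix o E H :
    is_omega1 o -> subset E o -> countable E -> is_Fix H E -> inF H
| inF_up H K : inF H -> is_subgroup K -> subset H K -> inF K
| inF_meet H K L :
    inF H -> inF K -> (forall pi, pi ∈ L <-> pi ∈ H /\ pi ∈ K) -> inF L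
| inF_conj H pi K :
    inF H -> perm pi ->
    (forall t, t ∈ K <-> exists s, s ∈ H /\ is_conj t pi s) -> inF K.

(** [q = πp] *)
Definition act_cond (pi p q : T) := forall z, z ∈ q <->
  exists a a' n v z0, app pi a a' /\ is_entry z0 a n v /\ z0 ∈ p /\
    is_entry z a' n v.

Inductive is_name (x : T) : Prop :=
| is_name_intro :
    (forall z, z ∈ x -> exists y p, is_opair z y p /\ cond p) ->
    (forall y p, app x y p -> is_name y) ->
    is_name x.

Definition subname (y x : T) := exists p, app x y p.

Context (mem_wf : well_founded mem).

Lemma subname_wf : well_founded subname.
Proof.
apply (@wf_incl T _ (clos_trans T mem)); [|apply wf_clos_trans; exact mem_wf].
intros y x (p & z & (a & b & Ha & _ & Hz) & Hzx).
apply (t_trans _ _ _ a); [apply t_step; apply Ha; now left|].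
apply (t_trans _ _ _ z); [apply t_step; apply Hz; now left|].
now apply t_step.
Qed.

(** [act_name pi x x'] says [x' = πx]; see [act_nameE]. *)
Definition act_name (pi : T) : T -> T -> Prop :=
  Fix subname_wf (fun _ => T -> Prop) (fun x act x' =>
    forall z, z ∈ x' <->
      exists y p y' p' (Hyp : app x y p),
        act y (ex_intro _ p Hyp) y' /\ act_cond pi p p' /\ is_opair z y' p').

Lemma act_nameE pi x x' :
  act_name pi x x' <->
  forall z, z ∈ x' <->
    exists y p y' p', app x y p /\
      act_name pi y y' /\ act_cond pi p p' /\ is_opair z y' p'.
Proof.
unfold act_name at 1; rewrite Fix_eq.
- fold (act_name pi).
  split; intros H z; rewrite (H z); split.
  + intros (y & p & y' & p' & Hyp & ?); now exists y, p, y', p'.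
  + intros (y & p & y' & p' & Hyp & ?); now exists y, p, y', p', Hyp.
  + intros (y & p & y' & p' & Hyp & ?); now exists y, p, y', p', Hyp.
  + intros (y & p & y' & p' & Hyp & ?); now exists y, p, y', p'.
- intros y f g Hfg.
  replace g with f; [reflexivity|].
  extensionality u; extensionality h; apply Hfg.
Qed.

Definition in_stab (x pi : T) := perm pi /\ act_name pi x x.

Definition symmetric (x : T) :=
  exists H, inF H /\ forall pi, pi ∈ H <-> in_stab x pi.

Inductive HS (x : T) : Prop :=
| HS_intro :
    is_name x -> symmetric x ->
    (forall y p, app x y p -> HS y) ->
    HS x.

End InStructure.

(** Aczel's sets: well-founded trees up to extensional equality. Values of
    names live here; no relation between this universe and the ground model is
    assumed beyond smallness of the latter. *)

Inductive tree : Type := sup (A : Type) (f : A -> tree).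

Fixpoint teq (s t : tree) : Prop :=
  match s, t with
  | sup A f, sup B g =>
      (forall a, exists b, teq (f a) (g b)) /\
      (forall b, exists a, teq (f a) (g b))
  end.

Definition tmem (s t : tree) : Prop :=
  match t with sup B g => exists b, teq s (g b) end.

Definition set : Type := {C : tree -> Prop | exists t, C = teq t}.

Definition mk (t : tree) : set :=
  exist (fun C => exists t, C = teq t) (teq t) (ex_intro _ t eq_refl).

Definition set_mem (x y : set) : Prop :=
  exists s t, proj1_sig x s /\ proj1_sig y t /\ tmem s t.

Lemma teq_refl s : teq s s.
Proof. induction s as [A f IH]; simpl; split; intros a; now exists a. Qed.

Lemma teq_sym s t : teq s t -> teq t s.
Proof.
revert t; induction s as [A f IH]; intros [B g] [H1 H2]; simpl; split.
- intros b; destruct (H2 b) as [a Ha]; exists a; auto.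
- intros a; destruct (H1 a) as [b Hb]; exists b; auto.
Qed.

Lemma teq_trans s t u : teq s t -> teq t u -> teq s u.
Proof.
revert t u; induction s as [A f IH]; intros [B g] [C h] [H1 H2] [K1 K2].
simpl; split.
- intros a; destruct (H1 a) as [b Hb]; destruct (K1 b) as [c Hc].
  exists c; eauto.
- intros c; destruct (K2 c) as [b Hb]; destruct (H2 b) as [a Ha].
  exists a; eauto.
Qed.

Lemma mk_eq s t : mk s = mk t <-> teq s t.
Proof.
split; intros H.
- change (proj1_sig (mk s) t); rewrite H; apply teq_refl.
- apply eq_sig_hprop; [intros; apply proof_irrelevance|simpl].
  extensionality u; apply propositional_extensionality.
  split; intros K; [|now apply teq_trans with t].
  now apply teq_trans with s; [apply teq_sym|].
Qed.

Lemma mk_surj (x : set) : exists t, x = mk t.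
Proof.
destruct x as [C [t ->]]; exists t.
apply eq_sig_hprop; [intros; apply proof_irrelevance|reflexivity].
Qed.

Lemma set_mem_sup (x : set) A (f : A -> tree) :
  set_mem x (mk (sup A f)) <-> exists a, x = mk (f a).
Proof.
destruct (mk_surj x) as [s ->]; split.
- intros (s' & [B g] & Hs & [H1 H2] & [b Hb]); simpl in *.
  destruct (H2 b) as [a Ha]; exists a; apply mk_eq.
  apply teq_trans with s'; [assumption|].
  apply teq_trans with (g b); [assumption|now apply teq_sym].
- intros [a Ha]; apply mk_eq in Ha.
  exists s, (sup A f); split; [apply teq_refl|split; [apply teq_refl|]].
  now exists a.
Qed.

Lemma set_ext (x y : set) :
  (forall z, set_mem z x <-> set_mem z y) -> x = y.
Proof.
destruct (mk_surj x) as [[A f] ->]; destruct (mk_surj y) as [[B g] ->].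
intros H; apply mk_eq; simpl; split.
- intros a; destruct (proj1 (set_mem_sup (mk (f a)) B g)) as [b Hb].
  + apply H, set_mem_sup; now exists a.
  + exists b; now apply mk_eq.
- intros b; destruct (proj1 (set_mem_sup (mk (g b)) A f)) as [a Ha].
  + apply H, set_mem_sup; now exists b.
  + exists a; now apply mk_eq.
Qed.

Lemma set_mem_wf : well_founded set_mem.
Proof.
intros x; destruct (mk_surj x) as [t ->].
induction t as [A f IH]; constructor; intros y Hy.
apply set_mem_sup in Hy; destruct Hy as [a ->]; apply IH.
Qed.

Section Extension.

Context {V : Type} {mem : V -> V -> Prop} (mem_wf : well_founded mem).
Variable G : V -> Prop.

Definition tree_value : V -> tree :=
  Fix (subname_wf mem mem_wf) (fun _ => tree) (fun x val =>
    sup {y : V | exists p, app mem x y p /\ G p}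
      (fun y => val (proj1_sig y)
         (match proj2_sig y with
          | ex_intro _ p Hp => ex_intro _ p (proj1 Hp)
          end))).

Definition value (x : V) : set := mk (tree_value x).

Lemma valueE (x : V) (s : set) :
  set_mem s (value x) <->
  exists y p, app mem x y p /\ G p /\ s = value y.
Proof.
unfold value at 1, tree_value; rewrite Fix_eq.
- rewrite set_mem_sup; fold tree_value; split.
  + intros [[y (p & Hyp & Gp)] ->]; now exists y, p.
  + intros (y & p & Hyp & Gp & ->).
    now exists (exist _ y (ex_intro _ p (conj Hyp Gp))).
- intros y f g Hfg.
  replace g with f; [reflexivity|].
  extensionality u; extensionality h; apply Hfg.
Qed.

Definition sym_ext : Type :=
  {s : set | exists x, HS mem mem_wf x /\ s = value x}.

Definition sym_ext_mem (s t : sym_ext) : Prop :=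
  set_mem (proj1_sig s) (proj1_sig t).

End Extension.

(* Main.v *)
(** Work by well-founded induction outside the model: only definability of each
    notion has to be checked inside. Forcing for hereditarily symmetric names
    is definable and invariant under permutations, so a name cut out of a
    symmetric set of names by the forcing relation has the common support of
    the names involved. This gives separation; for the other existence axioms
    it suffices to find symmetric sets of names that are large enough, in the
    case of replacement by collection in [V] and closure under permutations.

    For dependent choice along [R] on [A], let [E₀] be a countable support of
    [A] and [R] containing the domain of a suitable condition [p₀], and let
    [E₀ ⊆ E₁ ⊆ ...] be countable with all differences infinite. Let [X]
    consist of the names in the domain of [A] supported by some [E_m]. If [x]
    is supported by [E_m] and [q] forces [x R y], then a permutation fixing
    [E_m] pointwise moves [q] and [y] into [E_(m+1)]; hence below [p₀] every
    element of [X] densely has a successor in [X]. All names in [X] are fixed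
    by [Fix(⋃ E_m)], so a well-ordering of [X] in [V] belongs to the extension,
    where the sequence is defined by taking least successors. No chain
    condition is needed. *)

From Stdlib Require Import Classical ClassicalEpsilon FunctionalExtensionality ProofIrrelevance PeanoNat Lia.
Require Import Defs.

(** Separation and replacement hold in [V] for formulas only, while names, permutations and forcing
    are given as Rocq predicates and functions. Hence each of these notions is accompanied by a
    proof that it is definable with parameters, and class terms are total functions, so that they
    compose freely. The basic set theory is developed for an arbitrary well-founded model because it
    is used twice: in [V], and in the extension, where the sequence for dependent choice is finally
    built. The names in the domain of [A] have in general no common countable support, so a
    well-ordering of all of them need not be symmetric. Passing to [X] keeps successors for two
    reasons. A witness together with its condition involves countably many coordinates, which fit
    into the infinite gap between two stages; and a condition is finite, so it meets the union of
    the stages inside a single one, which makes the moved condition compatible with it. The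
    well-ordering is indexed by levels of the von Neumann hierarchy instead of ordinals: they are
    linearly ordered by membership, and so are the values of their canonical names. *)

Class struct (T : Type) := mem : T -> T -> Prop.
Notation "x ∈ y" := (mem x y) (at level 70).
Notation "x ∉ y" := (~ mem x y) (at level 70).
Notation "x ⊆ y" := (subset mem x y) (at level 70).

Fixpoint rename (r : nat -> nat) (phi : formula) : formula :=
  match phi with
  | fmem i j => fmem (r i) (r j)
  | feq i j => feq (r i) (r j)
  | fbot => fbot
  | fimp phi psi => fimp (rename r phi) (rename r psi)
  | fall phi => fall (rename (scons 0 (fun n => S (r n))) phi)
  end.

(** * Definability with parameters *)

Section Definability.
Context {T : Type} {M : struct T}.
Local Notation env := (nat -> T).

Lemma sat_ext phi (e e' : env) :
  (forall n, e n = e' n) -> sat mem phi e <-> sat mem phi e'.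
Proof. intros H; replace e' with e; [tauto | now extensionality n]. Qed.

Lemma sat_rename r phi (e : env) :
  sat mem (rename r phi) e <-> sat mem phi (fun n => e (r n)).
Proof.
revert r e; induction phi as [| | |phi IH1 psi IH2|phi IH]; intros r e; simpl; try tauto.
- now rewrite IH1, IH2.
- split; intros H x; specialize (H x).
  + apply IH in H; revert H; apply sat_ext; now intros [|n].
  + apply IH; revert H; apply sat_ext; now intros [|n].
Qed.

Definition place (e : env) (s : nat + T) : T :=
  match s with inl k => e k | inr c => c end.

(** [DP P]: the predicate [P] of environments is defined by a formula each of
    whose free variables is read from the environment or set to a parameter.
    [DF t] is the same for the graph of [t], the value coming first. *)
Definition DP (P : env -> Prop) : Prop :=
  exists phi f, forall e, P e <-> sat mem phi (fun n => place e (f n)).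

Definition DF (t : env -> T) : Prop :=
  DP (fun e => e 0 = t (fun n => e (S n))).

Lemma DP_ext P Q : DP P -> (forall e, Q e <-> P e) -> DP Q.
Proof. intros (phi & f & H) HQ; exists phi, f; intros e; rewrite HQ; apply H. Qed.

Lemma DP_sub P (s : nat -> nat + T) :
  DP P -> DP (fun e => P (fun n => place e (s n))).
Proof.
intros (phi & f & H).
exists phi, (fun n => match f n with inl k => s k | inr c => inr c end).
intros e; rewrite H; apply sat_ext; intros n; now destruct (f n).
Qed.

Lemma DP_ren P (r : nat -> nat) : DP P -> DP (fun e => P (fun n => e (r n))).
Proof. exact (DP_sub P (fun n => inl (r n))). Qed.

Lemma DP_sat phi : DP (sat mem phi).
Proof. now exists phi, inl. Qed.

Lemma DP_bot : DP (fun _ => False).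
Proof. now exists fbot, inl. Qed.

Lemma DP_memv i j : DP (fun e => e i ∈ e j).
Proof. now exists (fmem i j), inl. Qed.

Lemma DP_eqv i j : DP (fun e => e i = e j).
Proof. now exists (feq i j), inl. Qed.

(** The two formulas come with unrelated assignments of parameters. Moving the variables of one to
    even and of the other to odd numbers lets a single assignment serve both. *)
Lemma DP_imp P Q : DP P -> DP Q -> DP (fun e => P e -> Q e).
Proof.
intros (phi & f & H) (psi & g & K).
exists (fimp (rename (fun n => 2 * n) phi) (rename (fun n => S (2 * n)) psi)),
  (fun n => if Nat.even n then f (Nat.div2 n) else g (Nat.div2 n)).
intros e; rewrite H, K; cbn [sat]; rewrite !sat_rename.
assert (A : forall n, Nat.even (2 * n) = true) by (intros n; now rewrite Nat.even_mul).
assert (B : forall n, Nat.even (S (2 * n)) = false).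
{ intros n; now rewrite Nat.even_succ, <- Nat.negb_even, A. }
assert (C : forall n, Nat.div2 (2 * n) = n) by (intros n; apply Nat.div2_double).
assert (D : forall n, Nat.div2 (S (2 * n)) = n) by (intros n; apply Nat.div2_succ_double).
split; intros X Y.
- eapply sat_ext; [|apply X; eapply sat_ext; [|exact Y]]; intros n; cbv beta; now rewrite ?A, ?B, ?C, ?D.
- eapply sat_ext; [|apply X; eapply sat_ext; [|exact Y]]; intros n; cbv beta; now rewrite ?A, ?B, ?C, ?D.
Qed.

(** The axiom schemas want the distinguished variable at index 0, whereas [f] may read it at many
    indices. All of these are renamed to 0 and the others shifted, so the value left in the new
    assignment for the former is never read. *)
Lemma DP_peel P : DP P -> exists phi f, forall x e,
  P (scons x e) <-> sat mem phi (scons x (fun n => place e (f n))).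
Proof.
intros (phi & f & H).
exists (rename (fun n => match f n with inl 0 => 0 | _ => S n end) phi),
  (fun n => match f n with inl (S k) => inl k | s => s end).
intros x e; rewrite H, sat_rename; apply sat_ext; intros n.
destruct (f n) as [[|k]|c] eqn:E; simpl; now rewrite ?E.
Qed.

Lemma DP_peel2 P : DP P -> exists phi f, forall x y e,
  P (scons x (scons y e)) <->
  sat mem phi (scons x (scons y (fun n => place e (f n)))).
Proof.
intros (phi & f & H).
exists (rename (fun n => match f n with inl 0 => 0 | inl 1 => 1 | _ => S (S n) end) phi),
  (fun n => match f n with inl (S (S k)) => inl k | s => s end).
intros x y e; rewrite H, sat_rename; apply sat_ext; intros n.
destruct (f n) as [[|[|k]]|c] eqn:E; simpl; now rewrite ?E.
Qed.

Lemma DP_all (P : T -> env -> Prop) :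
  DP (fun e => P (e 0) (fun n => e (S n))) -> DP (fun e => forall x, P x e).
Proof.
intros H; destruct (DP_peel _ H) as (phi & f & K).
exists (fall phi), f; intros e; split; intros X x.
- apply (K x e), X.
- apply (K x e), X.
Qed.

Lemma DP_not P : DP P -> DP (fun e => ~ P e).
Proof. intros H; exact (DP_imp _ _ H DP_bot). Qed.

Lemma DP_ex (P : T -> env -> Prop) :
  DP (fun e => P (e 0) (fun n => e (S n))) -> DP (fun e => exists x, P x e).
Proof.
intros H; eapply DP_ext; [exact (DP_not _ (DP_all (fun x e => ~ P x e) (DP_not _ H)))|].
intros e; split; [intros [x Hx] K; exact (K x Hx)|intros K].
now apply not_all_not_ex in K.
Qed.

Lemma DP_and P Q : DP P -> DP Q -> DP (fun e => P e /\ Q e).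
Proof.
intros H K; eapply DP_ext; [exact (DP_not _ (DP_imp _ _ H (DP_not _ K)))|].
intros e; cbv beta; tauto.
Qed.

Lemma DP_or P Q : DP P -> DP Q -> DP (fun e => P e \/ Q e).
Proof.
intros H K; eapply DP_ext; [exact (DP_imp _ _ (DP_not _ H) K)|].
intros e; cbv beta; tauto.
Qed.

Lemma DP_iff P Q : DP P -> DP Q -> DP (fun e => P e <-> Q e).
Proof. intros H K; exact (DP_and _ _ (DP_imp _ _ H K) (DP_imp _ _ K H)). Qed.

(** Decided classically, a proposition independent of the environment is truth or falsity. Thus
    statements from outside the model may occur inside definable predicates. *)
Lemma DP_prop (P : Prop) : DP (fun _ => P).
Proof.
destruct (classic P).
- eapply DP_ext; [exact (DP_not _ DP_bot)|tauto].
- eapply DP_ext; [exact DP_bot|tauto].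
Qed.

Lemma DF_var k : DF (fun e => e k).
Proof. exact (DP_eqv 0 (S k)). Qed.

Lemma DF_const c : DF (fun _ => c).
Proof. exact (DP_sub _ (fun n => match n with 0 => inl 0 | _ => inr c end) (DP_eqv 0 1)). Qed.

Lemma DF_ren t (r : nat -> nat) : DF t -> DF (fun e => t (fun n => e (r n))).
Proof. intros H; exact (DP_ren _ (fun n => match n with 0 => 0 | S n => S (r n) end) H). Qed.

(** Substitution of a term [t] is expressed as ∃x (x = t ∧ P x), which keeps the formulas free of
    terms. *)
Lemma DP_let (P : T -> env -> Prop) t :
  DP (fun e => P (e 0) (fun n => e (S n))) -> DF t -> DP (fun e => P (t e) e).
Proof.
intros H K; eapply DP_ext; [exact (DP_ex (fun x e => x = t e /\ P x e) (DP_and _ _ K H))|].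
intros e; cbv beta; split; [now exists (t e)|now intros (x & -> & Hx)].
Qed.

Lemma DP_eq t s : DF t -> DF s -> DP (fun e => t e = s e).
Proof. intros H K; exact (DP_let (fun x e => x = s e) t K H). Qed.

Lemma DP_mem t s : DF t -> DF s -> DP (fun e => t e ∈ s e).
Proof.
intros H K; refine (DP_let (fun x e => x ∈ s e) t _ H).
exact (DP_let (fun y e => e 0 ∈ y) _ (DP_memv 1 0) (DF_ren s S K)).
Qed.

(** Arguments are arbitrary definable terms and not just variables, so that a definability proof can
    follow the syntax of nested applications. *)
Definition D1 (P : T -> Prop) := forall t, DF t -> DP (fun e => P (t e)).
Definition D2 (P : T -> T -> Prop) :=
  forall t s, DF t -> DF s -> DP (fun e => P (t e) (s e)).
Definition D3 (P : T -> T -> T -> Prop) :=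
  forall t s u, DF t -> DF s -> DF u -> DP (fun e => P (t e) (s e) (u e)).
Definition F1 (f : T -> T) := forall t, DF t -> DF (fun e => f (t e)).
Definition F2 (f : T -> T -> T) :=
  forall t s, DF t -> DF s -> DF (fun e => f (t e) (s e)).
Definition F3 (f : T -> T -> T -> T) :=
  forall t s u, DF t -> DF s -> DF u -> DF (fun e => f (t e) (s e) (u e)).

Lemma D1_intro P : DP (fun e => P (e 0)) -> D1 P.
Proof. intros H t Ht; exact (DP_let (fun x _ => P x) t H Ht). Qed.

End Definability.

(* Automation of definability proofs *)
Create HintDb dp discriminated.
#[export] Hint Constants Opaque : dp.

(** Redefined below for terms that bind a variable, such as [iota] or [sep]: their argument is a
    predicate on the model, which [F1], [F2] and [F3] do not cover. *)
Ltac dp_hook := fail.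

Ltac dp_step :=
  cbv beta;
  match goal with
  | |- DP (fun _ => ?P) => exact (DP_prop P)
  | |- DP (fun e => @?A e /\ @?B e) => apply (DP_and A B)
  | |- DP (fun e => @?A e \/ @?B e) => apply (DP_or A B)
  | |- DP (fun e => @?A e <-> @?B e) => apply (DP_iff A B)
  | |- DP (fun e => ~ @?A e) => apply (DP_not A)
  | |- DP (fun e => ex (fun x => @?A x e)) => apply (DP_ex (fun x e => A x e))
  | |- DP (fun e => ex (fun x => @?A e x)) => apply (DP_ex (fun x e => A e x))
  | |- DP (fun e => @?A e -> @?B e) => apply (DP_imp A B)
  | |- DP (fun e => forall x, @?A e x) => apply (DP_all (fun x e => A e x))
  | |- DP (fun e => @?A e = @?B e) => apply (DP_eq A B)
  | |- DP (fun e => mem (@?A e) (@?B e)) => apply (DP_mem A B)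
  | |- DF (fun e => e ?k) => exact (DF_var k)
  | |- DF (fun _ => ?c) => exact (DF_const c)
  | H : DF ?t |- DF ?t => exact H
  | H : DF ?t |- DF (fun e => ?t e) => exact H
  | H : DF ?t |- DF (fun e => ?t (fun n => e (@?r n))) => exact (DF_ren t r H)
  | _ => dp_hook
  | |- DP (fun e => ?P (@?A e) (@?B e) (@?C e)) =>
      let H := fresh in assert (H : D3 P) by (solve [auto 2 with dp nocore]);
      apply (H A B C); clear H
  | |- DP (fun e => ?P (@?A e) (@?B e)) =>
      let H := fresh in assert (H : D2 P) by (solve [auto 2 with dp nocore]);
      apply (H A B); clear H
  | |- DP (fun e => ?P (@?A e)) =>
      let H := fresh in assert (H : D1 P) by (solve [auto 2 with dp nocore]);
      apply (H A); clear H
  | |- DF (fun e => ?P (@?A e) (@?B e) (@?C e)) =>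
      let H := fresh in assert (H : F3 P) by (solve [auto 2 with dp nocore]);
      apply (H A B C); clear H
  | |- DF (fun e => ?P (@?A e) (@?B e)) =>
      let H := fresh in assert (H : F2 P) by (solve [auto 2 with dp nocore]);
      apply (H A B); clear H
  | |- DF (fun e => ?P (@?A e)) =>
      let H := fresh in assert (H : F1 P) by (solve [auto 2 with dp nocore]);
      apply (H A); clear H
  end.
Ltac dp_intro :=
  match goal with
  | |- D1 ?P => first [ apply D1_intro | unfold D1; intros ]
  | |- D2 ?P => unfold D2; intros
  | |- D3 ?P => unfold D3; intros
  | |- F1 ?P => unfold F1; intros
  | |- F2 ?P => unfold F2; intros
  | |- F3 ?P => unfold F3; intros
  end.
Ltac dp := try dp_intro; repeat dp_step.
Ltac dpu f := dp_intro; unfold f; repeat dp_step.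

Class model (T : Type) (St : struct T) := {
  mem_wf : well_founded (@mem T St);
  zf : ZF (@mem T St)
}.

(** * Separation, replacement and definite descriptions *)

Section Basics.
Context {T : Type} {St : struct T} {M : model T St}.

Lemma D2_subset : D2 (subset mem). Proof. dpu @subset. Qed.
Lemma D1_is_empty : D1 (is_empty mem). Proof. dpu @is_empty. Qed.
Lemma D3_is_upair : D3 (is_upair mem). Proof. dpu @is_upair. Qed.
#[local] Hint Resolve D2_subset D1_is_empty D3_is_upair : dp.
Lemma D3_is_opair : D3 (is_opair mem). Proof. dpu @is_opair. Qed.
Lemma D2_is_succ : D2 (is_succ mem). Proof. dpu @is_succ. Qed.
#[local] Hint Resolve D3_is_opair D2_is_succ : dp.
Lemma D3_app : D3 (app mem). Proof. dpu @app. Qed.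
Lemma D1_inductive : D1 (inductive mem). Proof. dpu @inductive. Qed.
#[local] Hint Resolve D3_app D1_inductive : dp.
Lemma D1_is_omega : D1 (is_omega mem). Proof. dpu @is_omega. Qed.

Lemma ext x y : (forall z, z ∈ x <-> z ∈ y) -> x = y.
Proof. apply zf_extensionality, zf. Qed.

Lemma inh : inhabited T.
Proof. destruct (zf_infinity _ zf) as [w _]; exact (inhabits w). Qed.

Lemma separation P : D1 P -> forall a, exists b, forall x, x ∈ b <-> x ∈ a /\ P x.
Proof.
intros H a; destruct (DP_peel _ (H _ (DF_var 0))) as (phi & f & K).
destruct (zf_separation _ zf phi (fun n => place (fun _ => a) (f n)) a) as [b Hb].
exists b; intros x; rewrite Hb; now rewrite <- (K x (fun _ => a)).
Qed.

Lemma replacement F : F1 F -> forall a, exists b, forall y, y ∈ b <-> exists x, x ∈ a /\ y = F x.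
Proof.
intros H a.
assert (L : DP (fun e : nat -> T => e 1 = F (e 0))).
{ apply DP_eq; [apply DF_var|apply H, DF_var]. }
destruct (DP_peel2 _ L) as (phi & f & K).
destruct (zf_replacement _ zf phi (fun n => place (fun _ => a) (f n)) a) as [b Hb].
{ intros x y y' _ H1 H2; apply K in H1; apply K in H2; simpl in *; congruence. }
exists b; intros y; rewrite Hb; split; intros (x & Hx & Hy); exists x; split; trivial.
- now apply K in Hy.
- now apply K.
Qed.

(** The unique [x] with [P x], and the empty set if there is none. *)
Definition iota (P : T -> Prop) : T :=
  epsilon inh (fun x => (P x /\ forall y, P y -> y = x) \/
    (~ (exists x, P x /\ forall y, P y -> y = x) /\ is_empty mem x)).

Lemma empty_exists : exists z, is_empty mem z.
Proof.
destruct inh as [a].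
destruct (separation (fun _ => False) ltac:(dp) a) as [b Hb].
exists b; intros z Hz; now apply Hb in Hz.
Qed.

Lemma iota_spec P :
  (P (iota P) /\ forall y, P y -> y = iota P) \/
  (~ (exists x, P x /\ forall y, P y -> y = x) /\ is_empty mem (iota P)).
Proof.
unfold iota; apply epsilon_spec.
destruct (classic (exists x, P x /\ forall y, P y -> y = x)) as [[x Hx]|H].
- now exists x; left.
- destruct empty_exists as [z Hz]; exists z; now right.
Qed.

Lemma iota_eq (P : T -> Prop) x : P x -> (forall y, P y -> y = x) -> iota P = x.
Proof.
intros Hx U; destruct (iota_spec P) as [[H _]|[H _]]; [now apply U|].
destruct H; now exists x.
Qed.

Lemma iota_P (P : T -> Prop) : (exists x, P x) -> (forall x y, P x -> P y -> x = y) -> P (iota P).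
Proof. intros [x Hx] U; rewrite (iota_eq P x); auto. Qed.

(** Here the default value of [iota] matters: although [iota] is taken from [epsilon], its graph is
    definable because the value is also determined when no unique solution exists. *)
Lemma DF_iota (P : (nat -> T) -> T -> Prop) :
  DP (fun e => P (fun n => e (S n)) (e 0)) -> DF (fun e => iota (P e)).
Proof.
intros H; unfold DF.
set (Q := fun (x : T) (e : nat -> T) => P (fun n => e (S n)) x).
assert (K : DP (fun e => Q (e 0) (fun n => e (S n)))).
{ exact (DP_ren _ (fun n => match n with 0 => 0 | S n => S (S n) end) H). }
eapply DP_ext with (P := fun e => (Q (e 0) e /\ forall y, Q y e -> y = e 0) \/
  (~ (exists x, Q x e /\ forall y, Q y e -> y = x) /\ is_empty mem (e 0))).
- assert (K2 : DP (fun e => Q (e 0) e)) by exact (DP_let Q (fun e => e 0) K (DF_var 0)).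
  assert (K3 : DP (fun e => Q (e 0) (fun n => e (S (S n))))).
  { exact (DP_ren _ (fun n => match n with 0 => 0 | S n => S (S n) end) K). }
  repeat first [assumption | dp_step].
- intros e; fold (Q (e 0) e); change (P (fun n => e (S n))) with (fun x => Q x e).
  destruct (iota_spec (fun x => Q x e)) as [[H1 H2]|[H1 H2]]; split.
  + intros ->; left; auto.
  + intros [[H3 H4]|[H3 _]]; [now apply H2|destruct H3; eauto].
  + intros ->; now right.
  + intros [H3|[_ H3]]; [destruct H1; eauto|].
    apply ext; intros z; split; intros Hz; [now apply H3 in Hz|now apply H2 in Hz].
Qed.

End Basics.

Ltac dp_hook ::=
  match goal with
  | |- DF (fun e => iota (@?P e)) => apply (DF_iota P)
  end.

#[export] Hint Resolve D2_subset D1_is_empty D3_is_upair D3_is_opair D2_is_succ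
  D3_app D1_inductive D1_is_omega : dp.

(** * Class terms *)

Section Terms.
Context {T : Type} {St : struct T} {M : model T St}.

Definition sep (a : T) (P : T -> Prop) := iota (fun b => forall x, x ∈ b <-> x ∈ a /\ P x).
Definition rep (a : T) (F : T -> T) :=
  iota (fun b => forall y, y ∈ b <-> exists x, x ∈ a /\ y = F x).
Definition pair (x y : T) := iota (fun z => is_upair mem z x y).
Definition opair (x y : T) := pair (pair x x) (pair x y).
Definition union (x : T) := iota (fun u => forall z, z ∈ u <-> exists y, z ∈ y /\ y ∈ x).
Definition power (x : T) := iota (fun p => forall z, z ∈ p <-> z ⊆ x).
Definition empty := iota (is_empty mem).
Definition cup (x y : T) := union (pair x y).
Definition succ (x : T) := cup x (pair x x).
Definition ite (P : Prop) (x y : T) := iota (fun z => (P /\ z = x) \/ (~ P /\ z = y)).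
Definition fst (z : T) := iota (fun x => exists y, z = opair x y).
Definition snd (z : T) := iota (fun y => exists x, z = opair x y).
Definition prod (a b : T) := union (rep a (fun x => rep b (fun y => opair x y))).
Definition ap (f x : T) := iota (fun y => opair x y ∈ f).
Definition lam (a : T) (F : T -> T) := rep a (fun x => opair x (F x)).
Definition omega := iota (is_omega mem).
Definition least (P : T -> Prop) := iota (fun k => k ∈ omega /\ P k /\ forall j, j ∈ k -> ~ P j).

Lemma DF_sep t (P : (nat -> T) -> T -> Prop) :
  DF t -> DP (fun e => P (fun n => e (S n)) (e 0)) -> DF (fun e => sep (t e) (P e)).
Proof.
intros Ht HP; unfold sep; dp_step; repeat dp_step.
exact (DP_ren _ (fun n => match n with 0 => 0 | S n => S (S n) end) HP).
Qed.

Lemma DF_rep t (F : (nat -> T) -> T -> T) :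
  DF t -> DF (fun e => F (fun n => e (S n)) (e 0)) -> DF (fun e => rep (t e) (F e)).
Proof.
intros Ht HP; unfold rep; dp_step; repeat dp_step.
exact (DF_ren _ (fun n => match n with 0 => 0 | S n => S (S (S n)) end) HP).
Qed.

Lemma DF_ite (P : (nat -> T) -> Prop) t s :
  DP P -> DF t -> DF s -> DF (fun e => ite (P e) (t e) (s e)).
Proof.
intros HP Ht Hs; unfold ite; repeat dp_step; exact (DP_ren _ S HP).
Qed.

Lemma DF_least (P : (nat -> T) -> T -> Prop) :
  DP (fun e => P (fun n => e (S n)) (e 0)) -> DF (fun e => least (P e)).
Proof.
intros H; unfold least; repeat dp_step.
- exact H.
- exact (DP_ren _ (fun n => match n with 0 => 0 | S n => S (S n) end) H).
Qed.

Lemma F2_pair : F2 pair. Proof. dpu pair. Qed.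
Lemma F1_union : F1 union. Proof. dpu union. Qed.
Lemma F1_power : F1 power. Proof. dpu power. Qed.
#[local] Hint Resolve F2_pair F1_union F1_power : dp.
Lemma F2_opair : F2 opair. Proof. dpu opair. Qed.
Lemma F2_cup : F2 cup. Proof. dpu cup. Qed.
#[local] Hint Resolve F2_opair F2_cup : dp.
Lemma DF_lam t (F : (nat -> T) -> T -> T) :
  DF t -> DF (fun e => F (fun n => e (S n)) (e 0)) -> DF (fun e => lam (t e) (F e)).
Proof.
intros Ht HF; apply (DF_rep t (fun e x => opair x (F e x)) Ht); repeat first [exact HF | dp_step].
Qed.
Lemma F1_succ : F1 succ. Proof. dpu succ. Qed.
Lemma F1_fst : F1 fst. Proof. dpu fst. Qed.
Lemma F1_snd : F1 snd. Proof. dpu snd. Qed.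
Lemma F2_ap : F2 ap. Proof. dpu ap. Qed.

Lemma in_sep a P : D1 P -> forall x, x ∈ sep a P <-> x ∈ a /\ P x.
Proof.
intros H; unfold sep; apply iota_P with (P := fun b => forall x, x ∈ b <-> x ∈ a /\ P x).
- now apply separation.
- intros b c Hb Hc; apply ext; intros x; now rewrite Hb, Hc.
Qed.

Lemma in_rep a F : F1 F -> forall y, y ∈ rep a F <-> exists x, x ∈ a /\ y = F x.
Proof.
intros H; unfold rep.
apply iota_P with (P := fun b => forall y, y ∈ b <-> exists x, x ∈ a /\ y = F x).
- now apply replacement.
- intros b c Hb Hc; apply ext; intros x; now rewrite Hb, Hc.
Qed.

Lemma is_upair_pair x y : is_upair mem (pair x y) x y.
Proof.
unfold pair; apply iota_P with (P := fun z => is_upair mem z x y).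
- apply zf_pairing, zf.
- intros b c Hb Hc; apply ext; intros z; now rewrite (Hb z), (Hc z).
Qed.

Lemma in_pair z x y : z ∈ pair x y <-> z = x \/ z = y.
Proof. apply is_upair_pair. Qed.

Lemma in_union z x : z ∈ union x <-> exists y, z ∈ y /\ y ∈ x.
Proof.
revert z; unfold union.
apply iota_P with (P := fun u => forall z, z ∈ u <-> exists y, z ∈ y /\ y ∈ x).
- apply zf_union, zf.
- intros b c Hb Hc; apply ext; intros z; now rewrite (Hb z), (Hc z).
Qed.

Lemma in_power z x : z ∈ power x <-> z ⊆ x.
Proof.
revert z; unfold power; apply iota_P with (P := fun u => forall z, z ∈ u <-> z ⊆ x).
- apply zf_power, zf.
- intros b c Hb Hc; apply ext; intros z; now rewrite (Hb z), (Hc z).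
Qed.

Lemma in_empty x : x ∉ empty.
Proof.
revert x; unfold empty; apply iota_P with (P := is_empty mem); [apply empty_exists|].
intros b c Hb Hc; apply ext; intros z; split; intros Hz; [now apply Hb in Hz|now apply Hc in Hz].
Qed.

Lemma empty_or x : x = empty \/ exists y, y ∈ x.
Proof.
destruct (classic (exists y, y ∈ x)) as [H|H]; [now right|left].
apply ext; intros z; split; intros Hz; [destruct H; eauto|now apply in_empty in Hz].
Qed.

Lemma is_emptyE x : is_empty mem x <-> x = empty.
Proof.
split; [|intros ->; exact in_empty].
intros H; destruct (empty_or x) as [E|[y Hy]]; [exact E|now apply H in Hy].
Qed.

Lemma in_cup z x y : z ∈ cup x y <-> z ∈ x \/ z ∈ y.
Proof.
unfold cup; rewrite in_union; split.
- intros (w & Hw & H); apply in_pair in H; destruct H as [->| ->]; auto.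
- intros [H|H]; [exists x|exists y]; split; trivial; apply in_pair; auto.
Qed.

Lemma in_succ z x : z ∈ succ x <-> z ∈ x \/ z = x.
Proof. unfold succ; rewrite in_cup, in_pair; tauto. Qed.

Lemma is_succE s x : is_succ mem s x <-> s = succ x.
Proof.
split; [|intros ->; intros z; apply in_succ].
intros H; apply ext; intros z; now rewrite (H z), in_succ.
Qed.

Lemma is_upairE z x y : is_upair mem z x y <-> z = pair x y.
Proof.
split; [|intros ->; apply is_upair_pair].
intros H; apply ext; intros w; now rewrite (H w), in_pair.
Qed.

Lemma is_opairE z x y : is_opair mem z x y <-> z = opair x y.
Proof.
split.
- intros (a & b & Ha & Hb & Hz); apply is_upairE in Ha, Hb, Hz; now subst.
- intros ->; exists (pair x x), (pair x y); now rewrite !is_upairE.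
Qed.

Lemma opair_inj x y x' y' : opair x y = opair x' y' -> x = x' /\ y = y'.
Proof.
intros H.
assert (Hx : x = x').
{ assert (K : pair x x ∈ opair x' y') by (rewrite <- H; apply in_pair; auto).
  apply in_pair in K; destruct K as [K|K].
  - assert (L : x ∈ pair x' x') by (rewrite <- K; apply in_pair; auto).
    apply in_pair in L; tauto.
  - assert (L : x' ∈ pair x x) by (rewrite K; apply in_pair; auto).
    apply in_pair in L; intuition congruence. }
split; [exact Hx|subst x'].
assert (L : forall u v, opair x u = opair x v -> u = v \/ u = x).
{ intros u v E.
  assert (K : pair x u ∈ opair x v) by (rewrite <- E; apply in_pair; auto).
  assert (L : u ∈ pair x u) by (apply in_pair; auto).
  apply in_pair in K; destruct K as [K|K]; rewrite K in L; apply in_pair in L; tauto. }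
destruct (L _ _ H) as [|E1]; [trivial|].
destruct (L _ _ (eq_sym H)) as [|E2]; congruence.
Qed.

Lemma appE r x y : app mem r x y <-> opair x y ∈ r.
Proof.
split.
- intros (z & Hz & H); apply is_opairE in Hz; now subst.
- intros H; exists (opair x y); now rewrite is_opairE.
Qed.

Lemma fst_opair x y : fst (opair x y) = x.
Proof.
apply iota_eq; [now exists y|intros z (w & H); now apply opair_inj in H as [-> _]].
Qed.

Lemma snd_opair x y : snd (opair x y) = y.
Proof.
apply iota_eq; [now exists x|intros z (w & H); now apply opair_inj in H as [_ ->]].
Qed.

Lemma in_prod z a b : z ∈ prod a b <-> exists x y, x ∈ a /\ y ∈ b /\ z = opair x y.
Proof.
unfold prod; rewrite in_union; split.
- intros (w & Hz & Hw); apply in_rep in Hw; [|dp; apply DF_rep; dp].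
  destruct Hw as (x & Hx & ->); apply in_rep in Hz; [|dp].
  destruct Hz as (y & Hy & ->); eauto.
- intros (x & y & Hx & Hy & ->); exists (rep b (fun y => opair x y)); split.
  + apply in_rep; [dp|eauto].
  + apply in_rep; [dp; apply DF_rep; dp|eauto].
Qed.

Lemma opair_in_prod x y a b : opair x y ∈ prod a b <-> x ∈ a /\ y ∈ b.
Proof.
rewrite in_prod; split; [|intros [Hx Hy]; eauto 6].
intros (x' & y' & Hx & Hy & H); now apply opair_inj in H as [-> ->].
Qed.

Lemma ite_true (P : Prop) x y : P -> ite P x y = x.
Proof. intros H; apply iota_eq; [auto|intros z [[_ ->]|[K _]]; tauto]. Qed.

Lemma ite_false (P : Prop) x y : ~ P -> ite P x y = y.
Proof. intros H; apply iota_eq; [auto|intros z [[K _]|[_ ->]]; tauto]. Qed.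

Lemma in_lam z a F : F1 F -> z ∈ lam a F <-> exists x, x ∈ a /\ z = opair x (F x).
Proof. intros H; unfold lam; rewrite in_rep; [tauto|dp]. Qed.

Lemma opair_in_lam x y a F : F1 F -> opair x y ∈ lam a F <-> x ∈ a /\ y = F x.
Proof.
intros H; rewrite in_lam by exact H; split.
- intros (x' & Hx & K); apply opair_inj in K as [-> ->]; auto.
- intros [Hx ->]; eauto.
Qed.

Lemma ap_lam a F x : F1 F -> x ∈ a -> ap (lam a F) x = F x.
Proof.
intros H Hx; apply iota_eq; [now apply opair_in_lam|].
intros y Hy; now apply opair_in_lam in Hy.
Qed.

Lemma is_fun_lam a F : F1 F -> is_fun mem (lam a F).
Proof.
intros H; split.
- intros z Hz; apply in_lam in Hz as (x & _ & ->); trivial; exists x, (F x); now apply is_opairE.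
- intros x y y' K L; apply appE, opair_in_lam in K, L; trivial; intuition congruence.
Qed.

Lemma maps_lam a b F : F1 F -> (forall x, x ∈ a -> F x ∈ b) -> maps mem (lam a F) a b.
Proof.
intros H K; split; [now apply is_fun_lam|split].
- intros x; split.
  + intros Hx; exists (F x); now apply appE, opair_in_lam.
  + intros [y Hy]; apply appE, opair_in_lam in Hy; tauto.
- intros x y Hy; apply appE, opair_in_lam in Hy; trivial; destruct Hy as [Hx ->]; auto.
Qed.

Lemma maps_ap f a b x : maps mem f a b -> x ∈ a -> opair x (ap f x) ∈ f /\ ap f x ∈ b.
Proof.
intros ((_ & Hf) & Hd & Hb) Hx.
apply Hd in Hx; destruct Hx as [y Hy].
assert (K : opair x (ap f x) ∈ f).
{ unfold ap; apply iota_P with (P := fun y => opair x y ∈ f).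
  - exists y; now apply appE.
  - intros u v Hu Hv; now apply (Hf x); apply appE. }
split; [trivial|now apply (Hb x), appE].
Qed.

Lemma maps_apE f a b x y : maps mem f a b -> app mem f x y <-> x ∈ a /\ y = ap f x.
Proof.
intros H; split.
- intros K; assert (Hx : x ∈ a) by (apply H; eauto).
  split; [trivial|]. apply (proj2 (proj1 H) x); [trivial|].
  apply appE; now apply (maps_ap f a b).
- intros [Hx ->]; apply appE; now apply (maps_ap f a b).
Qed.

Lemma mem_irrefl x : x ∉ x.
Proof.
induction (mem_wf x) as [x _ IH]; intros H; exact (IH x H H).
Qed.

Lemma mem_asym x y : x ∈ y -> y ∉ x.
Proof.
revert y; induction (mem_wf x) as [x _ IH]; intros y H K; exact (IH y K x K H).
Qed.

Lemma subset_antisym x y : x ⊆ y -> y ⊆ x -> x = y.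
Proof. intros H K; apply ext; split; auto. Qed.

Lemma minimal (P : T -> Prop) : (exists x, P x) -> exists x, P x /\ forall y, y ∈ x -> ~ P y.
Proof.
intros [x Hx]; induction (mem_wf x) as [x _ IH].
destruct (classic (exists y, y ∈ x /\ P y)) as [(y & Hy & K)|H]; [eauto|].
exists x; split; [trivial|]; intros y Hy K; eauto.
Qed.

Lemma is_omega_unique w w' : is_omega mem w -> is_omega mem w' -> w = w'.
Proof. intros [H1 H2] [K1 K2]; apply subset_antisym; auto. Qed.

Lemma is_omega_omega : is_omega mem omega.
Proof.
unfold omega; apply iota_P; [|exact is_omega_unique].
destruct (zf_infinity _ zf) as [w Hw].
exists (sep w (fun n => forall w', inductive mem w' -> n ∈ w')).
assert (K := in_sep w (fun n => forall w', inductive mem w' -> n ∈ w') ltac:(dp)).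
split; [split|].
- destruct Hw as [(z & Hz & Hzw) _]; exists z; split; [trivial|].
  apply K; split; [trivial|]; intros w' [(z' & Hz' & Hzw') _].
  apply is_emptyE in Hz, Hz'; congruence.
- intros x Hx; apply K in Hx as [Hx Hx'].
  exists (succ x); split; [now apply is_succE|].
  apply K; split.
  + destruct Hw as [_ Hw]; destruct (Hw x Hx) as (s & Hs & Hsw); apply is_succE in Hs; now subst.
  + intros w' Hw'; destruct (proj2 Hw' x (Hx' w' Hw')) as (s & Hs & Hsw); apply is_succE in Hs; now subst.
- intros w' Hw' x Hx; apply K in Hx; now apply Hx.
Qed.

Lemma is_omegaE w : is_omega mem w <-> w = omega.
Proof.
split; [intros H; exact (is_omega_unique _ _ H is_omega_omega)|intros ->; exact is_omega_omega].
Qed.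

Lemma omega_0 : empty ∈ omega.
Proof.
destruct is_omega_omega as [[(z & Hz & H) _] _]; apply is_emptyE in Hz; now subst.
Qed.

Lemma omega_succ n : n ∈ omega -> succ n ∈ omega.
Proof.
intros Hn; destruct is_omega_omega as [[_ K] _].
destruct (K n Hn) as (s & Hs & H); apply is_succE in Hs; now subst.
Qed.

#[local] Hint Resolve F1_succ : dp.

(** The model being well-founded, induction on its natural numbers holds for
    all predicates, definable or not. *)
Lemma omega_ind (Q : T -> Prop) :
  Q empty -> (forall n, n ∈ omega -> Q n -> Q (succ n)) -> forall n, n ∈ omega -> Q n.
Proof.
intros H0 HS.
set (P := fun n => n = empty \/ exists m, m ∈ omega /\ n = succ m).
assert (K := in_sep omega P ltac:(unfold P; dp)).
assert (C : forall n, n ∈ omega -> P n).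
(* Induction inside the model is used only for this definable case distinction; the possibly
   undefinable [Q] is then reached by well-founded induction on membership. *)
{ assert (I : omega ⊆ sep omega P); [|intros n Hn; now apply K, I].
  apply (proj2 is_omega_omega); split.
  - exists empty; split; [now apply is_emptyE|apply K; split; [apply omega_0|now left]].
  - intros x Hx; apply K in Hx as [Hx _]; exists (succ x); split; [now apply is_succE|].
    apply K; split; [now apply omega_succ|right; eauto]. }
intros n; induction (mem_wf n) as [n _ IH]; intros Hn.
destruct (C n Hn) as [->|(m & Hm & ->)]; [trivial|].
apply HS; [trivial|apply IH; [apply in_succ; auto|trivial]].
Qed.

End Terms.

#[export] Hint Resolve F2_pair F1_union F1_power F2_opair F2_cup F1_succ F1_fst F1_snd F2_ap : dp.
Ltac dp_hook ::=
  match goal with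
  | |- DF (fun e => iota (@?P e)) => apply (DF_iota P)
  | |- DF (fun e => least (@?P e)) => apply (DF_least P)
  | |- DF (fun e => sep (@?t e) (@?P e)) => apply (DF_sep t P)
  | |- DF (fun e => rep (@?t e) (@?P e)) => apply (DF_rep t P)
  | |- DF (fun e => lam (@?t e) (@?P e)) => apply (DF_lam t P)
  | |- DF (fun e => ite (@?P e) (@?t e) (@?s e)) => apply (DF_ite P t s)
  end.

Ltac omega_induction n Hn :=
  pattern n; revert n Hn; refine (omega_ind _ _ _); cbv beta.

(** * Order and successor on the natural numbers *)

Section Omega.
Context {T : Type} {St : struct T} {M : model T St}.

Lemma F2_prod : F2 prod.
Proof. dp_intro; unfold prod; repeat dp_step. Qed.

Lemma omega_trans n m : n ∈ omega -> m ∈ n -> m ∈ omega.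
Proof.
intros Hn; revert m; omega_induction n Hn.
- intros m Hm; now apply in_empty in Hm.
- intros n Hn IH m Hm; apply in_succ in Hm as [Hm| ->]; auto.
Qed.

Lemma nat_trans n m k : n ∈ omega -> m ∈ n -> k ∈ m -> k ∈ n.
Proof.
intros Hn; revert m k; omega_induction n Hn.
- intros m k Hm; now apply in_empty in Hm.
- intros n Hn IH m k Hm Hk; apply in_succ; apply in_succ in Hm as [Hm| ->]; [left; eauto|now left].
Qed.

Lemma nat_succ_mem n m : n ∈ omega -> m ∈ n -> succ m ∈ succ n.
Proof.
intros Hn; revert m; omega_induction n Hn.
- intros m Hm; now apply in_empty in Hm.
- intros n Hn IH m Hm; apply in_succ in Hm; apply in_succ; destruct Hm as [Hm| ->]; [left; auto|now right].
Qed.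

Lemma omega_total n m : n ∈ omega -> m ∈ omega -> n ∈ m \/ n = m \/ m ∈ n.
Proof.
intros Hn; revert m; omega_induction n Hn.
- intros m Hm; omega_induction m Hm; [now right; left|].
  intros m _ [H|[<- |H]]; [left; apply in_succ; auto|left; apply in_succ; auto|now apply in_empty in H].
- intros n Hn IH m Hm; destruct (IH m Hm) as [K|[<- |K]].
  + assert (H : succ n ∈ succ m) by now apply nat_succ_mem.
    apply in_succ in H; tauto.
  + right; right; apply in_succ; auto.
  + right; right; apply in_succ; auto.
Qed.

Lemma succ_inj n m : succ n = succ m -> n = m.
Proof.
intros H.
assert (K : n ∈ succ m) by (rewrite <- H; apply in_succ; auto).
assert (L : m ∈ succ n) by (rewrite H; apply in_succ; auto).
apply in_succ in K, L; destruct K as [K|K]; [|trivial]; destruct L as [L|L]; [|easy].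
now apply mem_asym in L.
Qed.

Lemma succ_not_empty n : succ n <> empty.
Proof. intros H; apply (in_empty n); rewrite <- H; apply in_succ; auto. Qed.

Lemma union_succ n : n ∈ omega -> union (succ n) = n.
Proof.
intros Hn; apply ext; intros z; rewrite in_union; split.
- intros (y & Hz & Hy); apply in_succ in Hy as [Hy| ->]; [eapply nat_trans; eauto|trivial].
- intros Hz; exists n; split; [trivial|apply in_succ; auto].
Qed.

End Omega.
#[export] Hint Resolve F2_prod : dp.

(** * Recursion and the cumulative hierarchy *)

Section Recursion.
Context {T : Type} {St : struct T} {M : model T St}.

Lemma D1_transitive : D1 (transitive mem). Proof. dpu @transitive. Qed.
#[local] Hint Resolve D1_transitive : dp.

Definition is_tc (x t : T) :=
  transitive mem t /\ x ⊆ t /\ forall t', transitive mem t' -> x ⊆ t' -> t ⊆ t'.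
Definition tc (x : T) := iota (is_tc x).

Lemma F1_tc : F1 tc. Proof. dpu tc; unfold is_tc; dp. Qed.
#[local] Hint Resolve F1_tc : dp.

(** By induction on membership, the closure being x ∪ ⋃ {tc y | y ∈ x}. Replacement applies to [tc]
    before existence is known in general, since [iota] is total. *)
Lemma is_tc_tc x : is_tc x (tc x).
Proof.
induction (mem_wf x) as [x _ IH]; unfold tc; apply iota_P.
- exists (cup x (union (rep x tc))).
  assert (K : forall z, z ∈ cup x (union (rep x tc)) <-> z ∈ x \/ exists y, y ∈ x /\ z ∈ tc y).
  { intros z; rewrite in_cup, in_union; split; intros [H|H]; auto; right.
    - destruct H as (y & Hz & Hy); apply in_rep in Hy as (u & Hu & ->); [eauto|dp].
    - destruct H as (y & Hy & Hz); exists (tc y); split; [trivial|]; apply in_rep; [dp|eauto]. }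
  split; [|split].
  + intros y Hy z Hz; apply K; right; apply K in Hy as [Hy|(u & Hu & Hy)].
    * exists y; split; [trivial|]; now apply (proj1 (proj2 (IH y Hy))).
    * exists u; split; [trivial|]; now apply (proj1 (IH u Hu) y).
  + intros z Hz; apply K; now left.
  + intros t' H1 H2 z Hz; apply K in Hz as [Hz|(u & Hu & Hz)]; [auto|].
    refine (proj2 (proj2 (IH u Hu)) t' H1 _ z Hz).
    intros w Hw; apply (H1 u); auto.
- intros t t' (H1 & H2 & H3) (K1 & K2 & K3); apply subset_antisym; auto.
Qed.

Lemma tc_transitive x : transitive mem (tc x).
Proof. apply is_tc_tc. Qed.

Lemma sub_tc x : x ⊆ tc x.
Proof. apply is_tc_tc. Qed.

Lemma tc_sub x u : u ∈ tc x -> tc u ⊆ tc x.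
Proof. intros H; apply (is_tc_tc u); [apply tc_transitive|now apply tc_transitive]. Qed.

Lemma tc_least x t : transitive mem t -> x ⊆ t -> tc x ⊆ t.
Proof. apply is_tc_tc. Qed.

(** The claim is proved for [x] and all of [tc x] at once. A member of [tc x] is a member of [x] or
    of the closure of one, because the set of all such elements is transitive and contains [x]. *)
Lemma tc_ind (Q : T -> Prop) :
  (forall x, (forall u, u ∈ tc x -> Q u) -> Q x) -> forall x, Q x.
Proof.
intros H.
assert (K : forall x u, u = x \/ u ∈ tc x -> Q u); [|intros x; apply (K x); auto].
intros x; induction (mem_wf x) as [x _ IH].
assert (L : forall u, u ∈ tc x -> Q u).
{ intros u Hu.
  assert (E : exists y, y ∈ x /\ (u = y \/ u ∈ tc y)).
  { assert (D : D1 (fun u => exists y, y ∈ x /\ (u = y \/ u ∈ tc y))) by dp.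
    refine (proj2 (proj1 (in_sep (tc x) _ D u) _)); revert u Hu; apply tc_least.
    - intros y Hy z Hz; apply in_sep in Hy as (Hy1 & v & Hv & Hy2); [|trivial].
      apply in_sep; [trivial|]; split; [now apply (tc_transitive x y)|].
      exists v; split; [trivial|right]; destruct Hy2 as [->|Hy2]; [now apply sub_tc|].
      now apply (tc_transitive v y).
    - intros z Hz; apply in_sep; [trivial|]; split; [now apply sub_tc|eauto]. }
  destruct E as (y & Hy & E); eauto. }
intros u [->|Hu]; auto.
Qed.

Definition restr (g a : T) := sep g (fun z => exists u v, u ∈ a /\ z = opair u v).

Lemma F2_restr : F2 restr. Proof. dpu restr. Qed.
#[local] Hint Resolve F2_restr : dp.

Lemma in_restr z g a : z ∈ restr g a <-> z ∈ g /\ exists u v, u ∈ a /\ z = opair u v.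
Proof. unfold restr; now rewrite in_sep by dp. Qed.

Section Rec.
Variable H : T -> T -> T -> T.
Hypothesis DH : F3 H.

(** Recursion uses the values on the whole transitive closure, since a name [y] enters [x] through a
    pair ⟨y, p⟩ and is thus found in [tc x]. On [t] the last clause determines the values, which
    makes [g] functional there; outside [t] it may be anything. The parameter [c] stays fixed along
    the recursion. *)
Definition attempt (c t g : T) :=
  transitive mem t /\ (forall u, u ∈ t -> exists v, opair u v ∈ g) /\
  (forall u v, u ∈ t -> opair u v ∈ g -> v = H c u (restr g (tc u))).
Definition rec_graph (c x y : T) := exists t g, attempt c t g /\ x ∈ t /\ opair x y ∈ g.
Definition rec (c x : T) := iota (rec_graph c x).

Lemma D3_rec_graph : D3 rec_graph. Proof. dpu rec_graph; unfold attempt; dp. Qed.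
#[local] Hint Resolve D3_rec_graph : dp.
Lemma F2_rec : F2 rec. Proof. dpu rec. Qed.

Lemma attempt_tc c t g u w : attempt c t g -> u ∈ t -> w ∈ tc u -> w ∈ t.
Proof. intros (Ht & _) Hu Hw; revert w Hw; now apply tc_least, Ht. Qed.

Lemma attempt_unique c t g t' g' : attempt c t g -> attempt c t' g' ->
  forall x y y', x ∈ t -> x ∈ t' -> opair x y ∈ g -> opair x y' ∈ g' -> y = y'.
Proof.
intros A A' x; induction x as [x IH] using tc_ind; intros y y' Ht Ht' Hg Hg'.
rewrite (proj2 (proj2 A) x y Ht Hg), (proj2 (proj2 A') x y' Ht' Hg'); f_equal.
apply ext; intros z; rewrite !in_restr; split; intros (Hz & u & v & Hu & ->).
- destruct (proj1 (proj2 A') u) as [v' Hv']; [eapply attempt_tc; eauto|].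
  rewrite (IH u Hu v v') in *; eauto using attempt_tc.
- destruct (proj1 (proj2 A) u) as [v' Hv']; [eapply attempt_tc; eauto|].
  rewrite <- (IH u Hu v' v) in *; eauto using attempt_tc.
Qed.

Lemma rec_graph_unique c x y y' : rec_graph c x y -> rec_graph c x y' -> y = y'.
Proof.
intros (t & g & A & Ht & Hg) (t' & g' & A' & Ht' & Hg').
exact (attempt_unique _ _ _ _ _ A A' _ _ _ Ht Ht' Hg Hg').
Qed.

(** As [rec] is already a class term, its values on [tc x] form a set by replacement and no attempts
    have to be chosen. Adding one pair for [x] gives an attempt that reaches [x]. *)
Lemma rec_graph_step c x : (forall u, u ∈ tc x -> rec_graph c u (rec c u)) ->
  rec_graph c x (H c x (lam (tc x) (rec c))).
Proof.
intros IH.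
assert (F : F1 (rec c)) by (intros s Hs; apply F2_rec; [apply DF_const|trivial]).
set (g := lam (tc x) (rec c)); set (g' := cup g (pair (opair x (H c x g)) (opair x (H c x g)))).
assert (Nx : x ∉ tc x).
{ clear; revert x; intros x; induction x as [x IH] using tc_ind.
  intros K; exact (IH x K K). }
assert (Kg : forall u v, u ∈ tc x -> opair u v ∈ g' <-> v = rec c u).
{ intros u v Hu; unfold g'; rewrite in_cup, in_pair; unfold g; rewrite opair_in_lam by trivial.
  split; [|auto]; intros [[_ K]|[K|K]]; trivial; apply opair_inj in K as [-> _]; easy. }
assert (Rg : forall u, u ∈ tc x -> restr g' (tc u) = lam (tc u) (rec c)).
{ intros u Hu; apply ext; intros z; rewrite in_restr, in_lam by trivial; split.
  - intros (Hz & w & v & Hw & ->); exists w; split; [trivial|f_equal].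
    apply Kg in Hz; [trivial|]; eapply tc_sub; eauto.
  - intros (w & Hw & ->); split; [|eauto].
    apply Kg; [|trivial]; eapply tc_sub; eauto. }
assert (Rx : restr g' (tc x) = g).
{ apply ext; intros z; unfold g; rewrite in_restr, in_lam by trivial; split.
  - intros (Hz & w & v & Hw & ->); exists w; split; [trivial|f_equal].
    apply Kg in Hz; trivial.
  - intros (w & Hw & ->); split; [|eauto]. now apply Kg. }
exists (cup (tc x) (pair x x)), g'; split; [split; [|split]|split].
- intros y Hy z Hz; apply in_cup in Hy as [Hy|Hy]; apply in_cup; left.
  + now apply (tc_transitive x y).
  + apply in_pair in Hy; assert (y = x) as -> by tauto; now apply sub_tc.
- intros u Hu; apply in_cup in Hu as [Hu|Hu]; [exists (rec c u); now apply Kg|].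
  exists (H c x g); apply in_pair in Hu; apply in_cup; right; apply in_pair.
  assert (u = x) as -> by tauto; auto.
- intros u v Hu Hv; apply in_cup in Hu as [Hu|Hu].
  + apply Kg in Hv; [subst v|trivial]; rewrite Rg by trivial.
    destruct (IH u Hu) as (t1 & g1 & A1 & Ht1 & Hg1).
    rewrite (proj2 (proj2 A1) u _ Ht1 Hg1) at 1; f_equal.
    apply ext; intros z; rewrite in_restr, in_lam by trivial; split.
    * intros (Hz & w & v & Hw & ->); exists w; split; [trivial|f_equal].
      apply (rec_graph_unique c w); [|apply IH; eapply tc_sub; eauto].
      exists t1, g1; split; [trivial|]; split; [eapply attempt_tc; eauto|trivial].
    * intros (w & Hw & ->).
      destruct (proj1 (proj2 A1) w) as [v Hv]; [eapply attempt_tc; eauto|].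
      assert (v = rec c w) as <-; [|split; eauto].
      apply (rec_graph_unique c w); [|apply IH; eapply tc_sub; eauto].
      exists t1, g1; split; [trivial|]; split; [eapply attempt_tc; eauto|trivial].
  + apply in_pair in Hu; assert (u = x) as -> by tauto; rewrite Rx.
    unfold g' in Hv; apply in_cup in Hv as [Hv|Hv].
    * unfold g in Hv; apply opair_in_lam in Hv as [Hv _]; easy.
    * apply in_pair in Hv; assert (K : opair x v = opair x (H c x g)) by tauto.
      now apply opair_inj in K.
- apply in_cup; right; apply in_pair; auto.
- unfold g'; apply in_cup; right; apply in_pair; auto.
Qed.

Lemma rec_graph_rec c x : rec_graph c x (rec c x).
Proof.
induction x as [x IH] using tc_ind; apply rec_graph_step in IH.
unfold rec; apply iota_P; [eauto|apply rec_graph_unique].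
Qed.

Lemma rec_eq c x : rec c x = H c x (lam (tc x) (rec c)).
Proof.
apply (rec_graph_unique c x); [apply rec_graph_rec|].
apply rec_graph_step; intros u _; apply rec_graph_rec.
Qed.

Lemma F1_rec c : F1 (rec c).
Proof. intros s Hs; apply F2_rec; [apply DF_const|trivial]. Qed.

Lemma ap_rec c x u : u ∈ tc x -> ap (lam (tc x) (rec c)) u = rec c u.
Proof. intros Hu; apply ap_lam; [apply F1_rec|trivial]. Qed.

End Rec.
End Recursion.
#[export] Hint Resolve D1_transitive F1_tc F2_restr : dp.

(** * Von Neumann levels, Scott's trick and collection *)

Section Levels.
Context {T : Type} {St : struct T} {M : model T St}.

Definition level_step (_ x g : T) := union (rep x (fun u => power (ap g u))).
Lemma F3_level_step : F3 level_step. Proof. dpu level_step. Qed.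

(** The von Neumann hierarchy: [level x] is [V_α] for [α] the rank of [x]. *)
Definition level (x : T) := rec level_step empty x.
Lemma F1_level : F1 level. Proof. apply F1_rec, F3_level_step. Qed.
#[local] Hint Resolve F1_level : dp.

Lemma in_level z x : z ∈ level x <-> exists y, y ∈ x /\ z ⊆ level y.
Proof.
unfold level at 1; rewrite rec_eq by apply F3_level_step.
unfold level_step at 1; rewrite in_union; split.
- intros (w & Hz & Hw); apply in_rep in Hw as (y & Hy & ->); [|dp].
  rewrite ap_rec in Hz by (try apply F3_level_step; now apply sub_tc).
  apply in_power in Hz; eauto.
- intros (y & Hy & Hz); exists (power (level y)); split; [now apply in_power|].
  apply in_rep; [dp|]; exists y; split; [trivial|].
  rewrite ap_rec; [trivial|apply F3_level_step|now apply sub_tc].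
Qed.

Lemma level_transitive x : transitive mem (level x).
Proof.
induction (mem_wf x) as [x _ IH]; intros y Hy z Hz.
apply in_level in Hy as (u & Hu & Hy); apply in_level; exists u; split; [trivial|].
apply (IH u Hu), Hy, Hz.
Qed.

Lemma sub_level x : x ⊆ level x.
Proof.
induction (mem_wf x) as [x _ IH]; intros y Hy; apply in_level; eauto.
Qed.

(** The levels take over the role of the ordinals; this dichotomy orders them linearly by
    membership. *)
Lemma level_compare x y : level x ⊆ level y \/ level y ∈ level x.
Proof.
revert y; induction (mem_wf x) as [x _ IH]; intros y.
destruct (classic (exists u, u ∈ x /\ level y ⊆ level u)) as [(u & Hu & K)|K].
- right; apply in_level; eauto.
- left; intros z Hz; apply in_level in Hz as (u & Hu & Hz).
  destruct (IH u Hu y) as [L|L].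
  + destruct (IH u Hu y) as [_|L']; [|destruct K; exists u; split; [trivial|now apply level_transitive]].
    destruct (classic (level y ⊆ level u)) as [L'|L']; [destruct K; eauto|].
    assert (E : exists w, w ∈ level y /\ w ∉ level u).
    { apply NNPP; intros E; apply L'; intros w Hw; apply NNPP; intros Hw'; eauto. }
    (* Some [v ∈ y] has [w ⊆ level v]. If [level v] belonged to [level u], so would [w]; hence
       [level u ⊆ level v], and [z] lies in [level y]. *)
    destruct E as (w & Hw & Hw'); apply in_level in Hw as (v & Hv & Hw).
    apply in_level; exists v; split; [trivial|].
    intros z' Hz'; apply Hz in Hz'.
    destruct (IH u Hu v) as [L2|L2]; [auto|].
    destruct Hw'; apply in_level in L2 as (s & Hs & L2); apply in_level; exists s; split; [trivial|].
    intros q Hq; auto.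
  + destruct K; exists u; split; [trivial|now apply level_transitive].
Qed.

Lemma level_total x y : level x ∈ level y \/ level x = level y \/ level y ∈ level x.
Proof.
destruct (level_compare x y) as [H|H]; [|auto].
destruct (level_compare y x) as [K|K]; [|auto].
right; left; now apply subset_antisym.
Qed.

(** Scott's trick: the least level of the form [level (pair y y)], which contains [y],
    with [P y]. *)
Definition scott (P : T -> Prop) : T :=
  iota (fun l => (exists y, P y /\ l = level (pair y y)) /\ forall y, P y -> ~ level (pair y y) ∈ l).

Lemma DF_scott (P : (nat -> T) -> T -> Prop) :
  DP (fun e => P (fun n => e (S n)) (e 0)) -> DF (fun e => scott (P e)).
Proof.
intros H; unfold scott; repeat dp_step;
  exact (DP_ren _ (fun n => match n with 0 => 0 | S n => S (S n) end) H).
Qed.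

Lemma scott_spec P : (exists y, P y) -> exists y, P y /\ y ∈ scott P.
Proof.
intros [y0 H0].
set (R := fun l => (exists y, P y /\ l = level (pair y y)) /\ forall y, P y -> ~ level (pair y y) ∈ l).
assert (K : R (scott P)).
{ unfold scott; apply (iota_P R).
  - destruct (minimal (fun l => exists y, P y /\ l = level (pair y y))) as (l & Hl & ml); [eauto|].
    exists l; split; [trivial|]; intros y Hy K; exact (ml _ K (ex_intro _ y (conj Hy eq_refl))).
  - intros l l' [(y & Hy & ->) Kl] [(y' & Hy' & ->) Kl'].
    destruct (level_total (pair y y) (pair y' y')) as [C|[C|C]]; [|trivial|].
    + now apply Kl' in C.
    + now apply Kl in C. }
destruct K as [(y & Hy & E) _]; exists y; split; [trivial|].
rewrite E; apply sub_level, in_pair; auto.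
Qed.

Lemma collection (P : T -> T -> Prop) a : D2 P -> (forall x, x ∈ a -> exists y, P x y) ->
  exists b, forall x, x ∈ a -> exists y, y ∈ b /\ P x y.
Proof.
intros D H.
assert (F : F1 (fun x => scott (P x))).
{ intros t Ht; apply (DF_scott (fun e y => P (t e) y)); dp. }
exists (union (rep a (fun x => scott (P x)))); intros x Hx.
destruct (scott_spec _ (H x Hx)) as (y & Hy & K); exists y; split; [|trivial].
apply in_union; exists (scott (P x)); split; [trivial|].
apply in_rep; eauto.
Qed.

End Levels.
#[export] Hint Resolve F1_level : dp.

(** * Natural numbers, cardinality and choice *)

Section Naturals.
Context {T : Type} {St : struct T} {M : model T St}.

Lemma least_spec P : (exists k, k ∈ omega /\ P k) -> least P ∈ omega /\ P (least P).
Proof.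
intros H.
set (R := fun k => k ∈ omega /\ P k /\ forall j, j ∈ k -> ~ P j).
assert (K : R (least P)); [|destruct K as (? & ? & _); auto].
apply (iota_P R).
- destruct (minimal _ H) as (k & (Hk & Pk) & mk); exists k; split; [trivial|split; [trivial|]].
  intros j Hj Pj; apply (mk j Hj); split; [eapply omega_trans; eauto|trivial].
- intros k l (Hk & Pk & mk) (Hl & Pl & ml).
  destruct (omega_total k l Hk Hl) as [C|[C|C]]; [|trivial|]; [now apply ml in C|now apply mk in C].
Qed.

(** On a successor [n], [union n] is the predecessor. The starting value [a] occupies the place of
    the fixed parameter of the recursion. *)
Definition nrec_step (h : T -> T) (a n g : T) := ite (n = empty) a (h (ap g (union n))).
Definition nrec (h : T -> T) (a n : T) := rec (nrec_step h) a n.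

Lemma F3_nrec_step h : F1 h -> F3 (nrec_step h).
Proof. intros H; dpu nrec_step. Qed.

Lemma F2_nrec h : F1 h -> F2 (nrec h).
Proof. intros H; apply F2_rec; now apply F3_nrec_step. Qed.

Lemma nrec_0 h a : F1 h -> nrec h a empty = a.
Proof.
intros H; unfold nrec; rewrite rec_eq by now apply F3_nrec_step.
now apply ite_true.
Qed.

Lemma nrec_succ h a n : F1 h -> n ∈ omega -> nrec h a (succ n) = h (nrec h a n).
Proof.
intros H Hn; unfold nrec; rewrite rec_eq by now apply F3_nrec_step.
unfold nrec_step at 1; rewrite ite_false by apply succ_not_empty.
rewrite union_succ by trivial; rewrite ap_rec; [trivial|now apply F3_nrec_step|].
apply sub_tc, in_succ; auto.
Qed.

Definition dbl := nrec (fun x => succ (succ x)) empty.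
Lemma F1_dbl : F1 dbl.
Proof. intros t Ht; apply F2_nrec; [dp|apply DF_const|trivial]. Qed.
#[local] Hint Resolve F1_dbl : dp.

Lemma dbl_0 : dbl empty = empty.
Proof. apply nrec_0; dp. Qed.
Lemma dbl_succ n : n ∈ omega -> dbl (succ n) = succ (succ (dbl n)).
Proof. apply (nrec_succ (fun x => succ (succ x))); dp. Qed.

Lemma dbl_omega n : n ∈ omega -> dbl n ∈ omega.
Proof.
intros Hn; omega_induction n Hn.
- rewrite dbl_0; apply omega_0.
- intros n Hn IH; rewrite dbl_succ by trivial; auto using omega_succ.
Qed.

Lemma omega_case n : n ∈ omega -> n = empty \/ exists m, m ∈ omega /\ n = succ m.
Proof. intros Hn; omega_induction n Hn; eauto. Qed.

Lemma dbl_inj n m : n ∈ omega -> m ∈ omega -> dbl n = dbl m -> n = m.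
Proof.
intros Hn; revert m; omega_induction n Hn.
- intros m Hm; destruct (omega_case m Hm) as [->|(k & Hk & ->)]; [trivial|].
  rewrite dbl_0, dbl_succ by trivial; intros H; symmetry in H; now apply succ_not_empty in H.
- intros n Hn IH m Hm; rewrite dbl_succ by trivial.
  destruct (omega_case m Hm) as [->|(k & Hk & ->)].
  + rewrite dbl_0; intros H; now apply succ_not_empty in H.
  + rewrite dbl_succ by trivial; intros H; f_equal; apply IH; trivial; now do 2 apply succ_inj.
Qed.

Lemma dbl_odd n m : n ∈ omega -> m ∈ omega -> dbl n <> succ (dbl m).
Proof.
intros Hn; revert m; omega_induction n Hn.
- intros m Hm; rewrite dbl_0; intros H; symmetry in H; now apply succ_not_empty in H.
- intros n Hn IH m Hm; rewrite dbl_succ by trivial.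
  destruct (omega_case m Hm) as [->|(k & Hk & ->)].
  + rewrite dbl_0; intros H; apply succ_inj in H; now apply succ_not_empty in H.
  + rewrite dbl_succ by trivial; intros H; apply (IH k Hk); now do 2 apply succ_inj.
Qed.

(** [cantor k i] is 2ᵏ(2i + 1). *)
Definition cantor (k i : T) := nrec dbl (succ (dbl i)) k.
Lemma F2_cantor : F2 cantor.
Proof. intros t s Ht Hs; apply F2_nrec; trivial; dp. Qed.

Lemma cantor_omega k i : k ∈ omega -> i ∈ omega -> cantor k i ∈ omega.
Proof.
intros Hk Hi; unfold cantor; omega_induction k Hk.
- rewrite nrec_0 by dp; now apply omega_succ, dbl_omega.
- intros n Hn IH; rewrite nrec_succ by dp || trivial; now apply dbl_omega.
Qed.

(** Parities are compared: [cantor k i] is odd for k = 0 and even otherwise, and in the even case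
    both sides can be halved. *)
Lemma cantor_inj k k' i i' : k ∈ omega -> k' ∈ omega -> i ∈ omega -> i' ∈ omega ->
  cantor k i = cantor k' i' -> k = k' /\ i = i'.
Proof.
intros Hk; revert k'; omega_induction k Hk; unfold cantor.
- intros k' Hk' Hi Hi'; rewrite nrec_0 by dp.
  destruct (omega_case k' Hk') as [->|(m & Hm & ->)].
  + rewrite nrec_0 by dp; intros H; split; [trivial|]; now apply dbl_inj, succ_inj.
  + rewrite nrec_succ by dp || trivial; intros H; symmetry in H; apply dbl_odd in H; trivial; try easy.
    now apply (cantor_omega m).
- intros n Hn IH k' Hk' Hi Hi'; rewrite nrec_succ by dp || trivial.
  destruct (omega_case k' Hk') as [->|(m & Hm & ->)].
  + rewrite nrec_0 by dp; intros H; apply dbl_odd in H; trivial; try easy.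
    now apply (cantor_omega n).
  + rewrite nrec_succ by dp || trivial; intros H; apply dbl_inj in H; [|now apply (cantor_omega n)|now apply (cantor_omega m)].
    destruct (IH m Hm Hi Hi' H) as [-> ->]; auto.
Qed.

End Naturals.
#[export] Hint Resolve F1_dbl F2_cantor : dp.

(** * Countable and finite sets *)

Section Cardinality.
Context {T : Type} {St : struct T} {M : model T St}.
Local Notation countable := (countable mem).
Local Notation finite := (finite mem).

Lemma D1_is_fun : D1 (is_fun mem). Proof. dpu @is_fun. Qed.
Lemma D2_is_dom : D2 (is_dom mem). Proof. dpu @is_dom. Qed.
Lemma D1_inj : D1 (inj mem). Proof. dpu @inj. Qed.
#[local] Hint Resolve D1_is_fun D2_is_dom D1_inj : dp.
Lemma D3_maps : D3 (maps mem). Proof. dpu @maps. Qed.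
#[local] Hint Resolve D3_maps : dp.
Lemma D3_bij : D3 (bij mem). Proof. dpu @bij. Qed.
#[local] Hint Resolve D3_bij : dp.
Lemma D1_countable : D1 countable. Proof. dpu @Defs.countable. Qed.
Lemma D1_finite : D1 finite. Proof. dpu @Defs.finite. Qed.

(** Injections become class functions, so that later ones can be written down as terms and checked
    for definability by their syntax. *)
Lemma countableE a : countable a <-> exists F, F1 F /\ (forall x, x ∈ a -> F x ∈ omega) /\
  (forall x y, x ∈ a -> y ∈ a -> F x = F y -> x = y).
Proof.
split.
- intros (w & f & Hw & Hf & Hi); apply is_omegaE in Hw; subst w.
  exists (ap f); split; [dp|split].
  + intros x Hx; now apply (maps_ap _ _ _ x Hf).
  + intros x y Hx Hy E; apply (Hi x y (ap f x)); apply (maps_apE _ _ _ _ _ Hf); auto.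
- intros (F & DF & Hw & Hi); exists omega, (lam a F); split; [now apply is_omegaE|split].
  + now apply maps_lam.
  + intros x x' y H K; apply appE, opair_in_lam in H, K; trivial.
    destruct H as [H ->], K as [K E]; auto.
Qed.

Lemma countable_sub a b : a ⊆ b -> countable b -> countable a.
Proof.
rewrite !countableE; intros H (F & DF & Hw & Hi); exists F; split; [trivial|]; split; auto.
Qed.

(** A point of the image is coded by the least code of a preimage, which takes no choice. *)
Lemma countable_image a F : F1 F -> countable a -> countable (rep a F).
Proof.
rewrite !countableE; intros DF (G & DG & Hw & Hi).
set (P := fun y k => exists x, x ∈ a /\ G x = k /\ F x = y).
exists (fun y => least (P y)); split; [unfold P; dp|].
assert (K : forall y, y ∈ rep a F -> least (P y) ∈ omega /\ P y (least (P y))).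
{ intros y Hy; apply least_spec; apply in_rep in Hy as (x & Hx & ->); [|trivial].
  exists (G x); split; [auto|exists x; auto]. }
split; [intros y Hy; now apply K|].
intros y z Hy Hz E; destruct (K y Hy) as [_ (x & Hx & Gx & <-)].
destruct (K z Hz) as [_ (x' & Hx' & Gx' & <-)].
f_equal; apply Hi; trivial; congruence.
Qed.

Lemma countable_cup a b : countable a -> countable b -> countable (cup a b).
Proof.
rewrite !countableE; intros (F & DF & Fw & Fi) (G & DG & Gw & Gi).
exists (fun x => ite (x ∈ a) (dbl (F x)) (succ (dbl (G x)))); split; [dp|split].
- intros x Hx; destruct (classic (x ∈ a)) as [K|K].
  + rewrite ite_true by trivial; apply dbl_omega; auto.
  + rewrite ite_false by trivial; apply omega_succ, dbl_omega.
    apply in_cup in Hx; destruct Hx; [easy|auto].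
- intros x y Hx Hy; apply in_cup in Hx, Hy.
  destruct (classic (x ∈ a)) as [K|K], (classic (y ∈ a)) as [L|L];
    rewrite ?(ite_true _ _ _ K), ?(ite_false _ _ _ K), ?(ite_true _ _ _ L), ?(ite_false _ _ _ L).
  + intros E; apply dbl_inj in E; auto.
  + intros E; destruct Hy as [|Hy]; [easy|].
    apply dbl_odd in E; [easy|auto|auto].
  + intros E; destruct Hx as [|Hx]; [easy|].
    symmetry in E; apply dbl_odd in E; [easy|auto|auto].
  + intros E; destruct Hx as [|Hx]; [easy|]; destruct Hy as [|Hy]; [easy|].
    apply succ_inj, dbl_inj in E; auto.
Qed.

Lemma countable_omega : countable omega.
Proof. apply countableE; exists (fun x => x); split; [dp|auto]. Qed.

Lemma countable_nat n : n ∈ omega -> countable n.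
Proof.
intros Hn; apply (countable_sub n omega); [|apply countable_omega].
intros m; now apply omega_trans.
Qed.

Definition bijF (a n : T) := exists F, F1 F /\ (forall x, x ∈ a -> F x ∈ n) /\
  (forall x y, x ∈ a -> y ∈ a -> F x = F y -> x = y) /\
  (forall k, k ∈ n -> exists x, x ∈ a /\ F x = k).

Lemma finiteE a : finite a <-> exists n, n ∈ omega /\ bijF a n.
Proof.
split.
- intros (w & n & f & Hw & Hn & Hf & Hi & Hs); apply is_omegaE in Hw; subst w.
  exists n; split; [trivial|]; exists (ap f); split; [dp|split; [|split]].
  + intros x Hx; now apply (maps_ap _ _ _ x Hf).
  + intros x y Hx Hy E; apply (Hi x y (ap f x)); apply (maps_apE _ _ _ _ _ Hf); auto.
  + intros k Hk; destruct (Hs k Hk) as [x Hx]; apply (maps_apE _ _ _ _ _ Hf) in Hx as [Hx ->]; eauto.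
- intros (n & Hn & F & DF & Hw & Hi & Hs); exists omega, n, (lam a F).
  split; [now apply is_omegaE|split; [trivial|split; [now apply maps_lam|split]]].
  + intros x x' y H K; apply appE, opair_in_lam in H, K; trivial.
    destruct H as [H ->], K as [K E]; auto.
  + intros k Hk; destruct (Hs k Hk) as (x & Hx & E); exists x; apply appE, opair_in_lam; auto.
Qed.

Lemma finite_empty : finite empty.
Proof.
apply finiteE; exists empty; split; [apply omega_0|].
exists (fun x => x); split; [dp|split; [trivial|split; [trivial|]]].
intros k Hk; now apply in_empty in Hk.
Qed.

Lemma finite_insert a x : finite a -> finite (cup a (pair x x)).
Proof.
intros H; destruct (classic (x ∈ a)) as [Hx|Hx].
{ replace (cup a (pair x x)) with a; [trivial|].
  apply ext; intros z; rewrite in_cup, in_pair; split; [auto|].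
  intros [|[-> | ->]]; trivial. }
rewrite !finiteE in *; destruct H as (n & Hn & F & DF & Hw & Hi & Hs).
exists (succ n); split; [now apply omega_succ|].
assert (A : forall y, y ∈ a -> ite (y = x) n (F y) = F y).
{ intros y Hy; apply ite_false; now intros ->. }
assert (B : ite (x = x) n (F x) = n) by now apply ite_true.
exists (fun y => ite (y = x) n (F y)); split; [dp|split; [|split]].
- intros y Hy; apply in_cup in Hy; rewrite in_pair in Hy; apply in_succ; destruct Hy as [Hy|Hy].
  + rewrite A by trivial; auto.
  + assert (y = x) as -> by tauto; rewrite B; auto.
- intros y z Hy Hz; apply in_cup in Hy, Hz; rewrite in_pair in Hy, Hz.
  destruct Hy as [Hy|Hy], Hz as [Hz|Hz].
  + rewrite !A by trivial; auto.
  + assert (z = x) as -> by tauto; rewrite (A y), B by trivial; intros E.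
    specialize (Hw _ Hy); rewrite E in Hw; now apply mem_irrefl in Hw.
  + assert (y = x) as -> by tauto; rewrite (A z), B by trivial; intros E.
    specialize (Hw _ Hz); rewrite <- E in Hw; now apply mem_irrefl in Hw.
  + intros _; transitivity x; [tauto|symmetry; tauto].
- intros k Hk; apply in_succ in Hk as [Hk| ->].
  + destruct (Hs k Hk) as (y & Hy & <-); exists y; split; [apply in_cup; auto|auto].
  + exists x; split; [apply in_cup; right; apply in_pair; auto|trivial].
Qed.

Lemma finite_ind (Q : T -> Prop) : Q empty ->
  (forall a x, finite a -> Q a -> Q (cup a (pair x x))) -> forall a, finite a -> Q a.
Proof.
intros Q0 QS a H; apply finiteE in H as (n & Hn & H); revert a H; omega_induction n Hn.
- intros a (F & _ & Hw & _); destruct (empty_or a) as [->|[x Hx]]; [trivial|].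
  apply Hw in Hx; now apply in_empty in Hx.
- intros n Hn IH a (F & DF & Hw & Hi & Hs).
  destruct (Hs n) as (x & Hx & E); [apply in_succ; auto|].
  assert (K : forall y, y ∈ sep a (fun y => y <> x) <-> y ∈ a /\ y <> x) by (intros y; now rewrite in_sep by dp).
  assert (B : bijF (sep a (fun y => y <> x)) n).
  { exists F; split; [trivial|split; [|split]].
    - intros y Hy; apply K in Hy as [Hy Ny]; specialize (Hw y Hy); apply in_succ in Hw as [Hw|Hw]; [trivial|].
      destruct Ny; apply Hi; congruence.
    - intros y z Hy Hz; apply K in Hy, Hz; now apply Hi.
    - intros k Hk; destruct (Hs k) as (y & Hy & Ek); [apply in_succ; auto|].
      exists y; split; [apply K; split; [trivial|]|trivial].
      intros ->; rewrite E in Ek; subst k; now apply mem_irrefl in Hk. }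
  replace a with (cup (sep a (fun y => y <> x)) (pair x x)).
  + apply QS; [apply finiteE; eauto|now apply IH].
  + apply ext; intros z; rewrite in_cup, K, in_pair; split.
    * intros [[? _]|[-> | ->]]; trivial.
    * intros Hz; destruct (classic (z = x)); auto.
Qed.

Lemma finite_cup a b : finite a -> finite b -> finite (cup a b).
Proof.
intros Ha; revert b; apply finite_ind.
- replace (cup a empty) with a; [trivial|].
  apply ext; intros z; rewrite in_cup; split; [auto|]; intros [|H]; [trivial|now apply in_empty in H].
- intros b x Hb IH; replace (cup a (cup b (pair x x))) with (cup (cup a b) (pair x x)).
  + now apply finite_insert.
  + apply ext; intros z; rewrite !in_cup; tauto.
Qed.

Lemma finite_sub a b : a ⊆ b -> finite b -> finite a.
Proof.
intros H Hb; revert a H; pattern b; apply finite_ind; [| |trivial].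
- intros a H; destruct (empty_or a) as [->|[x Hx]]; [apply finite_empty|apply H in Hx; now apply in_empty in Hx].
- intros c x Hc IH a H.
  assert (K : finite (sep a (fun y => y ∈ c))) by (apply IH; intros z Hz; apply in_sep in Hz; [tauto|dp]).
  destruct (classic (x ∈ a)) as [Hx|Hx].
  + replace a with (cup (sep a (fun y => y ∈ c)) (pair x x)); [now apply finite_insert|].
    apply ext; intros z; rewrite in_cup, in_pair, in_sep by dp; split.
    * intros [[? _]|[-> | ->]]; trivial.
    * intros Hz; specialize (H z Hz); rewrite in_cup, in_pair in H; tauto.
  + replace a with (sep a (fun y => y ∈ c)); [trivial|].
    apply ext; intros z; rewrite in_sep by dp; split; [tauto|].
    intros Hz; split; [trivial|]; specialize (H z Hz); rewrite in_cup, in_pair in H.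
    destruct H as [H|[-> | ->]]; easy.
Qed.

Lemma finite_image a F : F1 F -> finite a -> finite (rep a F).
Proof.
intros DF; revert a; apply finite_ind.
- replace (rep empty F) with empty; [apply finite_empty|].
  apply ext; intros z; rewrite in_rep by trivial; split; [intros H; now apply in_empty in H|].
  intros (x & Hx & _); now apply in_empty in Hx.
- intros a x Ha IH; replace (rep (cup a (pair x x)) F) with (cup (rep a F) (pair (F x) (F x))).
  + now apply finite_insert.
  + apply ext; intros z; rewrite in_cup, in_pair, !in_rep by trivial; split.
    * intros [(y & Hy & ->)|H]; [exists y; split; [apply in_cup; auto|trivial]|].
      exists x; split; [apply in_cup; right; apply in_pair; auto|tauto].
    * intros (y & Hy & ->); apply in_cup in Hy as [Hy|Hy]; [eauto|].
      apply in_pair in Hy; assert (y = x) as -> by tauto; auto.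
Qed.

Lemma finite_countable a : finite a -> countable a.
Proof.
intros H; apply finiteE in H as (n & Hn & F & DF & Hw & Hi & _).
apply countableE; exists F; split; [trivial|split; [|trivial]].
intros x Hx; eapply omega_trans; eauto.
Qed.

End Cardinality.
#[export] Hint Resolve D1_is_fun D2_is_dom D1_inj D3_maps D3_bij D1_countable D1_finite : dp.

(** * Enumerations obtained from the axiom of choice *)

Section Choice.
Context {T : Type} {St : struct T} {M : model T St}.
Hypothesis ac : AC mem.

Definition diff (a b : T) := sep a (fun x => x ∉ b).
Lemma F2_diff : F2 diff. Proof. dpu diff. Qed.
#[local] Hint Resolve F2_diff : dp.
Lemma in_diff x a b : x ∈ diff a b <-> x ∈ a /\ x ∉ b.
Proof. unfold diff; now rewrite in_sep by dp. Qed.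

Lemma choice_function B : exists ch, F1 ch /\ forall b, b ⊆ B -> (exists x, x ∈ b) -> ch b ∈ b.
Proof.
destruct (ac (sep (power B) (fun b => exists x, x ∈ b))) as (f & Hf & Hd & Hc).
{ intros y Hy; apply in_sep in Hy; [tauto|dp]. }
exists (ap f); split; [dp|]; intros b Hb Hx.
apply (Hc b); apply appE.
unfold ap; apply iota_P with (P := fun y => opair b y ∈ f).
- destruct (proj1 (Hd b)) as [y Hy]; [apply in_sep; [dp|]; now rewrite in_power|].
  exists y; now apply appE.
- intros u v Hu Hv; apply (proj2 Hf b); now apply appE.
Qed.

Section Enumeration.
Variables (B : T) (ch : T -> T) (Q : T -> Prop).
Hypothesis Dch : F1 ch.
Hypothesis ch_in : forall b, b ⊆ B -> (exists x, x ∈ b) -> ch b ∈ b.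
Hypothesis DQ : D1 Q.

(** [Q] will be trivial for enumerations along ω and the class of levels for transfinite ones. *)
Definition enum_step (_ x g : T) := ch (diff B (rep (sep x Q) (ap g))).
Lemma F3_enum_step : F3 enum_step.
Proof. dpu enum_step. Qed.

(** Enumerates [B] without repetition along any class [Q] linearly ordered by
    membership, as long as there are elements left. *)
Definition enum (x : T) := rec enum_step empty x.
Lemma F1_enum : F1 enum. Proof. apply F1_rec, F3_enum_step. Qed.
#[local] Hint Resolve F1_enum : dp.

Definition unused (x : T) := diff B (rep (sep x Q) enum).

Lemma enum_unused x : (exists b, b ∈ unused x) -> enum x ∈ unused x.
Proof.
intros H; replace (enum x) with (ch (unused x)).
- apply ch_in; [|trivial]; intros z Hz; now apply in_diff in Hz.
- unfold enum at 1; rewrite rec_eq by apply F3_enum_step; unfold enum_step at 1; f_equal.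
  unfold unused; f_equal; apply ext; intros z; rewrite !in_rep by dp.
  split; intros (y & Hy & ->); exists y; (split; [trivial|]); apply in_sep in Hy as [Hy _]; trivial;
    [|symmetry]; (rewrite ap_rec; [trivial|apply F3_enum_step|now apply sub_tc]).
Qed.

Lemma enum_neq x y : Q x -> x ∈ y -> (exists b, b ∈ unused y) -> enum x <> enum y.
Proof.
intros Hx Hxy Hb E; apply enum_unused in Hb; apply in_diff in Hb as [_ Hb]; apply Hb.
apply in_rep; [dp|]; exists x; split; [now apply in_sep|auto].
Qed.

End Enumeration.

(** The enumeration along ω cannot stop: a stage [n] with nothing left would present [B] as part of
    an image of the countable set [n]. *)
Lemma uncountable_injection B : ~ countable mem B ->
  exists d, F1 d /\ (forall n, n ∈ omega -> d n ∈ B) /\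
    forall n m, n ∈ omega -> m ∈ omega -> d n = d m -> n = m.
Proof.
intros HB; destruct (choice_function B) as (ch & Dch & Hch).
set (Q := fun x : T => True).
assert (DQ : D1 Q) by (unfold Q; dp).
set (d := enum B ch Q); assert (Fd : F1 d) by now apply F1_enum.
assert (U : forall n, n ∈ omega -> exists b, b ∈ unused B ch Q n).
{ intros n Hn; apply NNPP; intros K; apply HB.
  apply (countable_sub _ (rep (sep n Q) d)).
  - intros b Hb; apply NNPP; intros Hb'; apply K; exists b; now apply in_diff.
  - apply countable_image; [trivial|]; apply (countable_sub _ n); [|now apply countable_nat].
    intros z Hz; now apply in_sep in Hz. }
assert (N : forall n m, n ∈ m -> m ∈ omega -> d n <> d m).
{ intros n m Hn Hm; apply enum_neq; unfold Q; auto. }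
exists d; split; [trivial|split].
- intros n Hn; apply U, enum_unused, in_diff in Hn; tauto.
- intros n m Hn Hm E; destruct (omega_total n m Hn Hm) as [C|[C|C]]; [|trivial|].
  + now apply N in E.
  + now apply eq_sym, N in E.
Qed.

(** Zermelo's argument with levels for ordinals. If elements were always left, [d] would be
    injective on levels, so its inverse [inv] would map [X] onto a set containing every level. *)
Lemma level_wellorder X : exists W,
  (forall z, z ∈ W -> exists u x, x ∈ X /\ z = opair (level u) x) /\
  (forall l x x', opair l x ∈ W -> opair l x' ∈ W -> x = x') /\
  (forall x, x ∈ X -> exists l, opair l x ∈ W).
Proof.
destruct (choice_function X) as (ch & Dch & Hch).
set (Q := fun x : T => exists u, x = level u).
assert (DQ : D1 Q) by (unfold Q; dp).
set (d := enum X ch Q); assert (Fd : F1 d) by now apply F1_enum.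
assert (E : exists l, Q l /\ ~ exists b, b ∈ unused X ch Q l).
{ apply NNPP; intros K.
  assert (U : forall l, Q l -> exists b, b ∈ unused X ch Q l).
  { intros l Hl; apply NNPP; intros L; apply K; eauto. }
  set (inv := fun x => iota (fun l => Q l /\ d l = x)).
  assert (Finv : F1 inv) by (unfold inv; dp).
  assert (I : forall l, Q l -> l ∈ rep X inv).
  { intros l Hl; apply in_rep; [trivial|]; exists (d l); split.
    - specialize (U l Hl); apply enum_unused, in_diff in U; tauto.
    - symmetry; apply iota_eq; [auto|]; intros m [Hm Em].
      destruct Hl as [u ->], Hm as [v ->].
      destruct (level_total u v) as [C|[C|C]]; [|auto|].
      + apply (enum_neq X ch Q) in C; trivial; [now symmetry in Em|now exists u|apply U; now exists v].
      + apply (enum_neq X ch Q) in C; trivial; [easy|now exists v|apply U; now exists u]. }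
  set (Z := union (rep X inv)).
  (* The union of all levels would contain everything, in particular a pair with the member [Z],
     giving [Z ∈ Z]. *)
  assert (A : forall x, x ⊆ Z).
  { intros x y Hy; apply in_union; exists (level x); split; [now apply sub_level|apply I; now exists x]. }
  apply (mem_irrefl Z), (A (pair Z Z)), in_pair; auto. }
destruct E as (l & _ & Hl).
(* The stage [l] need not be the first at which [X] is exhausted, and [ch] is unconstrained on the
   empty set; hence the restriction to values in [X]. An element may occur at several levels, but
   each level carries at most one. *)
assert (K : forall m x, opair m x ∈ sep (rep (sep l Q) (fun m => opair m (d m))) (fun z => snd z ∈ X) <->
  m ∈ l /\ Q m /\ x = d m /\ x ∈ X).
{ intros m x; rewrite in_sep by dp; rewrite in_rep by dp; rewrite snd_opair; split.
  - intros [(m' & Hm & E) Hx]; apply opair_inj in E as [-> ->]; apply in_sep in Hm; tauto.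
  - intros (Hm & Qm & -> & Hx); split; [|trivial]; exists m; split; [now apply in_sep|trivial]. }
exists (sep (rep (sep l Q) (fun m => opair m (d m))) (fun z => snd z ∈ X)); split; [|split].
- intros z Hz; assert (Hz' := Hz); apply in_sep in Hz' as [Hz' _]; [|dp].
  apply in_rep in Hz' as (m & _ & ->); [|dp].
  apply K in Hz as (_ & [u ->] & _ & Hx); eauto.
- intros m x x' H H'; apply K in H, H'; intuition congruence.
- intros x Hx; apply NNPP; intros N; apply Hl; exists x; apply in_diff; split; [trivial|].
  intros H; apply in_rep in H as (m & Hm & ->); [|trivial]; apply N; exists m; apply K.
  apply in_sep in Hm; tauto.
Qed.

End Choice.
#[export] Hint Resolve F2_diff : dp.

(** The existence of ω₁ will be read off from an element of the generic filter, as [cond] itself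
    asserts it. *)
Class ground (T : Type) (St : struct T) (M : model T St) := {
  ground_ac : AC (@mem T St);
  ground_omega1 : exists o, is_omega1 (@mem T St) o
}.

(** * Permutations and conditions *)

Section Permutations.
Context {T : Type} {St : struct T} {M : model T St} {Gr : ground T St M}.

Lemma D1_is_ord : D1 (is_ord mem). Proof. dpu @is_ord. Qed.
#[local] Hint Resolve D1_is_ord : dp.
Lemma D1_is_omega1 : D1 (is_omega1 mem). Proof. dpu @is_omega1. Qed.
#[local] Hint Resolve D1_is_omega1 : dp.

(** The intersection is an initial segment of [x]; if it is proper, it equals the least element of
    [x] that it misses. Comparability of ordinals follows, and with it the uniqueness of ω₁. *)
Lemma ord_inter x y : is_ord mem x -> is_ord mem y ->
  let c := sep x (fun z => z ∈ y) in c = x \/ c ∈ x.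
Proof.
intros Hx Hy c.
assert (K : forall z, z ∈ c <-> z ∈ x /\ z ∈ y) by (intros z; unfold c; now rewrite in_sep by dp).
destruct (classic (exists z, z ∈ x /\ z ∉ c)) as [E|E].
- right; destruct (minimal _ E) as (z & [Hz Nz] & mz).
  replace c with z; [trivial|]; apply ext; intros w; split.
  + intros Hw; apply NNPP; intros Nw; apply (mz w Hw); split; [now apply (proj1 Hx z)|trivial].
  + intros Hw; apply K in Hw as [Hw Hw']; destruct (proj2 Hx w z Hw Hz) as [C|[C|C]]; [trivial| |].
    * subst w; destruct Nz; now apply K.
    * destruct Nz; apply K; split; [trivial|now apply (proj1 Hy w)].
- left; apply ext; intros z; split; [intros H; now apply K in H|].
  intros Hz; apply NNPP; intros Nz; eauto.
Qed.

Lemma ord_total x y : is_ord mem x -> is_ord mem y -> x ∈ y \/ x = y \/ y ∈ x.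
Proof.
intros Hx Hy.
pose proof (ord_inter x y Hx Hy) as H; pose proof (ord_inter y x Hy Hx) as K; cbv zeta in *.
assert (E : sep y (fun z => z ∈ x) = sep x (fun z => z ∈ y)).
{ apply ext; intros z; rewrite !in_sep by dp; tauto. }
rewrite E in K; destruct H as [H|H], K as [K|K].
- right; left; congruence.
- left; congruence.
- right; right; congruence.
- destruct (mem_irrefl (sep x (fun z => z ∈ y))); rewrite in_sep at 1 by dp; auto.
Qed.

Lemma is_omega1_unique o o' : is_omega1 mem o -> is_omega1 mem o' -> o = o'.
Proof.
intros (H1 & H2 & H3) (K1 & K2 & K3); destruct (ord_total o o' H1 K1) as [C|[C|C]]; [|trivial|].
- now apply K3 in C.
- now apply H3 in C.
Qed.

Definition omega1 : T := iota (is_omega1 mem).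

Lemma is_omega1_omega1 : is_omega1 mem omega1.
Proof. unfold omega1; apply (iota_P (is_omega1 mem)); [apply ground_omega1|exact is_omega1_unique]. Qed.

Lemma is_omega1E o : is_omega1 mem o <-> o = omega1.
Proof.
split; [intros H; exact (is_omega1_unique _ _ H is_omega1_omega1)|intros ->; exact is_omega1_omega1].
Qed.

Lemma omega1_uncountable : ~ countable mem omega1.
Proof. apply is_omega1_omega1. Qed.

Lemma D1_perm : D1 (perm mem). Proof. dpu @perm. Qed.
#[local] Hint Resolve D1_perm : dp.

Lemma permE pi : perm mem pi <-> bij mem pi omega1 omega1.
Proof.
split; [intros (o & Ho & H); apply is_omega1E in Ho; now subst|].
intros H; exists omega1; now rewrite is_omega1E.
Qed.

Lemma perm_app pi a b : perm mem pi -> app mem pi a b <-> a ∈ omega1 /\ b = ap pi a.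
Proof. rewrite permE; intros (H & _); now apply (maps_apE _ _ omega1). Qed.

Lemma perm_in pi a : perm mem pi -> a ∈ omega1 -> ap pi a ∈ omega1.
Proof. rewrite permE; intros (H & _) Ha; now apply (maps_ap _ omega1 _ a). Qed.

Lemma perm_inj pi a b : perm mem pi -> a ∈ omega1 -> b ∈ omega1 -> ap pi a = ap pi b -> a = b.
Proof.
intros H Ha Hb E; pose proof H as H'; apply permE in H' as (_ & Hi & _).
apply (Hi a b (ap pi a)); apply perm_app; auto.
Qed.

Lemma perm_surj pi b : perm mem pi -> b ∈ omega1 -> exists a, a ∈ omega1 /\ ap pi a = b.
Proof.
intros H Hb; pose proof H as H'; apply permE in H' as (_ & _ & Hs).
destruct (Hs b Hb) as [a Ha]; apply perm_app in Ha as [Ha ->]; eauto.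
Qed.

Lemma perm_lam h : F1 h -> (forall a, a ∈ omega1 -> h a ∈ omega1) ->
  (forall a b, a ∈ omega1 -> b ∈ omega1 -> h a = h b -> a = b) ->
  (forall b, b ∈ omega1 -> exists a, a ∈ omega1 /\ h a = b) -> perm mem (lam omega1 h).
Proof.
intros Dh H Hi Hs; apply permE; split; [now apply maps_lam|split].
- intros x x' y K L; apply appE, opair_in_lam in K, L; trivial.
  destruct K as [K ->], L as [L E]; auto.
- intros b Hb; destruct (Hs b Hb) as (a & Ha & E); exists a; apply appE, opair_in_lam; auto.
Qed.

Lemma perm_ext pi sigma : perm mem pi -> perm mem sigma ->
  (forall a, a ∈ omega1 -> ap pi a = ap sigma a) -> pi = sigma.
Proof.
assert (K : forall pi sigma, perm mem pi -> perm mem sigma ->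
  (forall a, a ∈ omega1 -> ap pi a = ap sigma a) -> pi ⊆ sigma).
{ intros f g H K E z Hz.
  pose proof H as H'; apply permE in H' as (((Hf & _) & _) & _).
  destruct (Hf z Hz) as (x & y & Exy); apply is_opairE in Exy; subst z.
  apply appE in Hz; apply perm_app in Hz as [Hx ->]; trivial.
  apply appE, perm_app; auto. }
intros H1 H2 E; apply subset_antisym; apply K; trivial; intros a Ha; symmetry; auto.
Qed.

Definition pinv (pi : T) : T := lam omega1 (fun b => iota (fun a => a ∈ omega1 /\ ap pi a = b)).
Definition pcomp (pi sigma : T) : T := lam omega1 (fun a => ap pi (ap sigma a)).
Definition pid : T := lam omega1 (fun a => a).

Lemma ap_pid a : a ∈ omega1 -> ap pid a = a.
Proof. intros Ha; unfold pid; rewrite ap_lam; trivial; dp. Qed.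

Lemma perm_pid : perm mem pid.
Proof. apply perm_lam; eauto; dp. Qed.

Lemma ap_pcomp pi sigma a : a ∈ omega1 -> ap (pcomp pi sigma) a = ap pi (ap sigma a).
Proof. intros Ha; unfold pcomp; rewrite ap_lam; trivial; dp. Qed.

Lemma perm_pcomp pi sigma : perm mem pi -> perm mem sigma -> perm mem (pcomp pi sigma).
Proof.
intros H K; apply perm_lam.
- dp.
- auto using perm_in.
- intros a b Ha Hb E; apply (perm_inj sigma), (perm_inj pi); auto using perm_in.
- intros b Hb; destruct (perm_surj pi b H Hb) as (c & Hc & <-).
  destruct (perm_surj sigma c K Hc) as (a & Ha & <-); eauto.
Qed.

Lemma ap_pinv_l pi a : perm mem pi -> a ∈ omega1 -> ap (pinv pi) (ap pi a) = a.
Proof.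
intros H Ha; unfold pinv; rewrite ap_lam; [|dp|now apply perm_in].
apply iota_eq; [auto|intros b [Hb E]; now apply (perm_inj pi)].
Qed.

Lemma pinv_in pi a : perm mem pi -> a ∈ omega1 -> ap (pinv pi) a ∈ omega1.
Proof. intros H Ha; destruct (perm_surj pi a H Ha) as (b & Hb & <-); now rewrite ap_pinv_l. Qed.

Lemma ap_pinv_r pi a : perm mem pi -> a ∈ omega1 -> ap pi (ap (pinv pi) a) = a.
Proof. intros H Ha; destruct (perm_surj pi a H Ha) as (b & Hb & <-); now rewrite ap_pinv_l. Qed.

Lemma perm_pinv pi : perm mem pi -> perm mem (pinv pi).
Proof.
intros H.
assert (K : forall b, b ∈ omega1 -> iota (fun a => a ∈ omega1 /\ ap pi a = b) = ap (pinv pi) b).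
{ intros b Hb; unfold pinv; rewrite ap_lam; trivial; dp. }
apply perm_lam.
- dp.
- intros a Ha; rewrite K by trivial; now apply pinv_in.
- intros a b Ha Hb; rewrite !K by trivial; intros E.
  rewrite <- (ap_pinv_r pi a), <- (ap_pinv_r pi b); congruence.
- intros b Hb; exists (ap pi b); split; [now apply perm_in|].
  rewrite K by now apply perm_in. now apply ap_pinv_l.
Qed.

Lemma pinvK pi : perm mem pi -> pinv (pinv pi) = pi.
Proof.
intros H; apply perm_ext; auto using perm_pinv; intros a Ha.
apply (perm_inj (pinv pi)); auto using perm_in, perm_pinv.
now rewrite ap_pinv_r, ap_pinv_l by auto using perm_pinv.
Qed.

Lemma pcomp_pinv_l pi : perm mem pi -> pcomp (pinv pi) pi = pid.
Proof.
intros H; apply perm_ext; auto using perm_pcomp, perm_pinv, perm_pid; intros a Ha.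
rewrite ap_pcomp, ap_pid by trivial; now apply ap_pinv_l.
Qed.

Lemma perm_involution h : F1 h -> (forall a, a ∈ omega1 -> h a ∈ omega1) ->
  (forall a, a ∈ omega1 -> h (h a) = a) -> perm mem (lam omega1 h).
Proof.
intros Dh H K; apply perm_lam; trivial.
- intros a b Ha Hb E; rewrite <- (K a Ha), <- (K b Hb); now f_equal.
- intros b Hb; exists (h b); auto.
Qed.

Definition perms : T := sep (power (prod omega1 omega1)) (perm mem).

Lemma in_perms pi : pi ∈ perms <-> perm mem pi.
Proof.
unfold perms; rewrite in_sep by dp; rewrite in_power; split; [tauto|].
intros H; split; [|trivial]; intros z Hz.
pose proof H as H'; apply permE in H' as (((Hf & _) & _) & _).
destruct (Hf z Hz) as (x & y & Exy); apply is_opairE in Exy; subst z.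
apply appE in Hz; apply perm_app in Hz as [Hx ->]; trivial.
apply opair_in_prod; auto using perm_in.
Qed.

Definition fixes (pi E : T) := forall a, a ∈ E -> ap pi a = a.
Lemma D2_fixes : D2 fixes. Proof. dpu fixes. Qed.

Lemma fixes_pinv pi E : perm mem pi -> E ⊆ omega1 -> fixes pi E -> fixes (pinv pi) E.
Proof. intros H HE K a Ha; rewrite <- (K a Ha) at 1; apply ap_pinv_l; auto. Qed.

Lemma fixes_sub pi E E' : E ⊆ E' -> fixes pi E' -> fixes pi E.
Proof. intros H K a Ha; auto. Qed.

End Permutations.
#[export] Hint Resolve D1_is_ord D1_is_omega1 D1_perm D2_fixes : dp.

(** * Conditions, their supports and the action on them *)

Section Conditions.
Context {T : Type} {St : struct T} {M : model T St} {Gr : ground T St M}.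

Definition entry (a n v : T) := opair (opair a n) v.
Lemma F3_entry : F3 entry. Proof. dpu entry. Qed.
#[local] Hint Resolve F3_entry : dp.

Lemma is_entryE z a n v : is_entry mem z a n v <-> z = entry a n v.
Proof.
split; [intros (x & Hx & Hz); apply is_opairE in Hx, Hz; now subst|].
intros ->; exists (opair a n); now rewrite !is_opairE.
Qed.

Lemma entry_inj a n v a' n' v' : entry a n v = entry a' n' v' -> a = a' /\ n = n' /\ v = v'.
Proof. intros H; apply opair_inj in H as [H ->]; apply opair_inj in H; tauto. Qed.

Definition two : T := pair empty (succ empty).

Lemma condE p : cond mem p <-> finite mem p /\
  (forall z, z ∈ p -> exists a n v, a ∈ omega1 /\ n ∈ omega /\ v ∈ two /\ z = entry a n v) /\
  (forall x v v', opair x v ∈ p -> opair x v' ∈ p -> v = v').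
Proof.
assert (B : forall v, (is_empty mem v \/ exists z, is_empty mem z /\ is_succ mem v z) <-> v ∈ two).
{ intros v; unfold two; rewrite in_pair, is_emptyE; apply or_iff_compat_l; split.
  - intros (z & Hz & Hv); apply is_emptyE in Hz; apply is_succE in Hv; now subst.
  - intros ->; exists empty; now rewrite is_emptyE, is_succE. }
split.
- intros (w & o & Hw & Ho & [Hf1 Hf2] & Hp & H); apply is_omegaE in Hw; apply is_omega1E in Ho; subst.
  split; [trivial|split].
  + intros z Hz; destruct (Hf1 z Hz) as (x & v & E); apply is_opairE in E; subst z.
    destruct (H x v) as ((a & n & Ha & Hn & E) & Hv); [now apply appE|].
    apply is_opairE in E; subst x; apply B in Hv; exists a, n, v; auto.
  + intros x v v' K L; apply (Hf2 x); now apply appE.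
- intros (Hp & H & Hf); exists omega, omega1.
  split; [now apply is_omegaE|split; [now apply is_omega1E|split; [split|split; [trivial|]]]].
  + intros z Hz; destruct (H z Hz) as (a & n & v & _ & _ & _ & ->).
    exists (opair a n), v; now apply is_opairE.
  + intros x v v' K L; apply (Hf x); now apply appE.
  + intros x v K; apply appE in K; destruct (H _ K) as (a & n & v' & Ha & Hn & Hv & E).
    apply opair_inj in E as [-> ->]; split; [|now apply B].
    exists a, n; now rewrite is_opairE.
Qed.

Lemma D1_cond : D1 (cond mem).
Proof.
intros t Ht; eapply DP_ext; [|intros e; apply condE]; dp.
Qed.
#[local] Hint Resolve D1_cond : dp.

Definition conds : T := sep (power (prod (prod omega1 omega) two)) (cond mem).

Lemma in_conds p : p ∈ conds <-> cond mem p.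
Proof.
unfold conds; rewrite in_sep by dp; rewrite in_power; split; [tauto|].
intros H; split; [|trivial]; intros z Hz; apply condE in H as (_ & H & _).
destruct (H z Hz) as (a & n & v & Ha & Hn & Hv & ->); unfold entry; now rewrite !opair_in_prod.
Qed.

Lemma cond_empty : cond mem empty.
Proof.
apply condE; split; [apply finite_empty|split].
- intros z Hz; now apply in_empty in Hz.
- intros x v v' H; now apply in_empty in H.
Qed.

Lemma cond_sub p q : cond mem q -> p ⊆ q -> cond mem p.
Proof.
rewrite !condE; intros (H1 & H2 & H3) H; split; [now apply (finite_sub p q)|split; auto].
intros x v v' K L; apply (H3 x); auto.
Qed.

Lemma cond_cup p q : cond mem p -> cond mem q ->
  (forall a n v v', entry a n v ∈ p -> entry a n v' ∈ q -> v = v') -> cond mem (cup p q).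
Proof.
rewrite !condE; intros (H1 & H2 & H3) (K1 & K2 & K3) H; split; [now apply finite_cup|split].
- intros z Hz; apply in_cup in Hz as [Hz|Hz]; auto.
- assert (L : forall x v v', opair x v ∈ p -> opair x v' ∈ q -> v = v').
  { intros x v v' Hv Hv'; destruct (H2 _ Hv) as (a & n & w & _ & _ & _ & E).
    apply opair_inj in E as [-> ->]; now apply (H a n). }
  intros x v v' Hv Hv'; apply in_cup in Hv, Hv'; destruct Hv as [Hv|Hv], Hv' as [Hv'|Hv'].
  + now apply (H3 x).
  + now apply (L x).
  + symmetry; now apply (L x).
  + now apply (K3 x).
Qed.

Lemma cond_entry p z : cond mem p -> z ∈ p -> exists a n v, a ∈ omega1 /\ z = entry a n v.
Proof.
intros H Hz; apply condE in H as (_ & H & _).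
destruct (H z Hz) as (a & n & v & Ha & Hn & Hv & ->); eauto.
Qed.

Lemma cond_fun p a n v v' : cond mem p -> entry a n v ∈ p -> entry a n v' ∈ p -> v = v'.
Proof. intros H; apply condE in H as (_ & _ & H); apply H. Qed.

Definition actc (pi p : T) : T :=
  rep p (fun z => entry (ap pi (fst (fst z))) (snd (fst z)) (snd z)).
Lemma F2_actc : F2 actc. Proof. dpu actc. Qed.
#[local] Hint Resolve F2_actc : dp.

Lemma in_actc pi p z : cond mem p ->
  z ∈ actc pi p <-> exists a n v, a ∈ omega1 /\ entry a n v ∈ p /\ z = entry (ap pi a) n v.
Proof.
intros H; unfold actc; rewrite in_rep by dp; split.
- intros (w & Hw & ->); destruct (cond_entry p w H Hw) as (a & n & v & Ha & ->).
  exists a, n, v; unfold entry; rewrite !fst_opair, !snd_opair; auto.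
- intros (a & n & v & Ha & Hw & ->); exists (entry a n v); split; [trivial|].
  unfold entry; now rewrite !fst_opair, !snd_opair.
Qed.

Lemma act_condE pi p q : perm mem pi -> cond mem p -> act_cond mem pi p q <-> q = actc pi p.
Proof.
intros Hpi Hp.
assert (K : forall z, (exists a a' n v z0, app mem pi a a' /\ is_entry mem z0 a n v /\ z0 ∈ p /\
    is_entry mem z a' n v) <-> z ∈ actc pi p).
{ intros z; rewrite in_actc by trivial; split.
  - intros (a & a' & n & v & z0 & Ha & Hz0 & H & Hz).
    apply is_entryE in Hz0, Hz; apply perm_app in Ha as [Ha ->]; trivial; subst; eauto 7.
  - intros (a & n & v & Ha & H & ->); exists a, (ap pi a), n, v, (entry a n v).
    rewrite perm_app by trivial; now rewrite !is_entryE. }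
split.
- intros H; apply ext; intros z; now rewrite (H z).
- intros -> z; symmetry; apply K.
Qed.

Lemma cond_actc pi p : perm mem pi -> cond mem p -> cond mem (actc pi p).
Proof.
intros Hpi Hp; apply condE; split; [|split].
- apply finite_image; [dp|]; now apply condE in Hp.
- intros z Hz; apply in_actc in Hz as (a & n & v & Ha & Hz & ->); trivial.
  pose proof Hp as Hp'; apply condE in Hp' as (_ & H & _).
  destruct (H _ Hz) as (a' & n' & v' & Ha' & Hn & Hv & E); apply entry_inj in E as (-> & -> & ->).
  exists (ap pi a'), n', v'; auto using perm_in.
- intros x v v' H K; apply in_actc in H as (a & n & w & Ha & H & E); trivial.
  apply in_actc in K as (a' & n' & w' & Ha' & K & E'); trivial.
  apply opair_inj in E as [-> ->], E' as [E' ->]; apply opair_inj in E' as [E' ->].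
  apply perm_inj in E'; trivial; subst a'; eapply cond_fun; eauto.
Qed.

Lemma actc_mono pi p q : p ⊆ q -> actc pi p ⊆ actc pi q.
Proof.
intros H z Hz; unfold actc in *; apply in_rep in Hz as (w & Hw & ->); [|dp].
apply in_rep; [dp|eauto].
Qed.

Lemma actc_pcomp pi sigma p : perm mem pi -> perm mem sigma -> cond mem p ->
  actc (pcomp pi sigma) p = actc pi (actc sigma p).
Proof.
intros Hpi Hs Hp; apply ext; intros z; rewrite !in_actc by auto using cond_actc; split.
- intros (a & n & v & Ha & H & ->); exists (ap sigma a), n, v; rewrite ap_pcomp by trivial.
  split; [now apply perm_in|split; [|trivial]]; apply in_actc; eauto 7.
- intros (a & n & v & Ha & H & ->); apply in_actc in H as (b & m & w & Hb & H & E); trivial.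
  apply entry_inj in E as (-> & -> & ->); exists b, m, w; now rewrite ap_pcomp.
Qed.

Definition supp (p : T) : T := rep p (fun z => fst (fst z)).

Lemma entry_supp a n v p : entry a n v ∈ p -> a ∈ supp p.
Proof.
intros H; apply in_rep; [dp|]; exists (entry a n v); split; [trivial|].
unfold entry; now rewrite !fst_opair.
Qed.

Lemma in_supp a p : cond mem p -> a ∈ supp p -> exists n v, entry a n v ∈ p.
Proof.
intros Hp H; apply in_rep in H as (z & Hz & ->); [|dp].
destruct (cond_entry p z Hp Hz) as (a & n & v & Ha & ->).
exists n, v; unfold entry; now rewrite !fst_opair.
Qed.

Lemma supp_omega1 p : cond mem p -> supp p ⊆ omega1.
Proof.
intros Hp a Ha; apply in_supp in Ha as (n & v & H); trivial.
destruct (cond_entry p _ Hp H) as (a' & n' & v' & Ha' & E); now apply entry_inj in E as (-> & _).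
Qed.

Lemma supp_countable p : cond mem p -> countable mem (supp p).
Proof.
intros Hp; apply countable_image; [dp|]; apply finite_countable; now apply condE in Hp.
Qed.

Lemma actc_fixes pi p : cond mem p -> fixes pi (supp p) -> actc pi p = p.
Proof.
intros Hp H; apply ext; intros z; rewrite in_actc by trivial; split.
- intros (a & n & v & Ha & K & ->); rewrite H; [trivial|eapply entry_supp; eauto].
- intros Hz; destruct (cond_entry p z Hp Hz) as (a & n & v & Ha & ->).
  exists a, n, v; rewrite H; [auto|eapply entry_supp; eauto].
Qed.

Lemma actc_pid p : cond mem p -> actc pid p = p.
Proof.
intros Hp; apply actc_fixes; trivial; intros a Ha; apply ap_pid; now apply (supp_omega1 p).
Qed.

Lemma actc_pinv_l pi p : perm mem pi -> cond mem p -> actc (pinv pi) (actc pi p) = p.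
Proof.
intros Hpi Hp; rewrite <- actc_pcomp by auto using perm_pinv.
rewrite pcomp_pinv_l by trivial; now apply actc_pid.
Qed.

Lemma actc_pinv_r pi p : perm mem pi -> cond mem p -> actc pi (actc (pinv pi) p) = p.
Proof.
intros Hpi Hp; rewrite <- (pinvK pi) at 1 by trivial; apply actc_pinv_l; auto using perm_pinv.
Qed.

Lemma actc_empty pi : actc pi empty = empty.
Proof.
apply ext; intros z; rewrite in_actc by exact cond_empty; split.
- intros (a & n & v & _ & H & _); now apply in_empty in H.
- intros H; now apply in_empty in H.
Qed.

Lemma supp_actc pi p : perm mem pi -> cond mem p -> supp (actc pi p) ⊆ rep (supp p) (ap pi).
Proof.
intros Hpi Hp a Ha; apply in_supp in Ha as (n & v & H); [|now apply cond_actc].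
apply in_actc in H as (b & m & w & Hb & H & E); trivial.
apply entry_inj in E as (-> & -> & ->); apply in_rep; [dp|].
exists b; split; [eapply entry_supp; eauto|trivial].
Qed.

End Conditions.
#[export] Hint Resolve F3_entry F2_actc : dp.
#[export] Hint Extern 1 (D1 (cond _)) => exact D1_cond : dp.
#[export] Hint Extern 2 (cond _ (actc _ _)) => apply cond_actc : core.
#[export] Hint Extern 2 (perm _ (pinv _)) => apply perm_pinv : core.
#[export] Hint Extern 2 (perm _ (pcomp _ _)) => apply perm_pcomp : core.

(** * Hereditarily symmetric names *)

Section Names.
Context {T : Type} {St : struct T} {M : model T St} {Gr : ground T St M}.
Local Notation is_name := (is_name mem).
Local Notation HS := (HS mem mem_wf).

Lemma name_elem x z : is_name x -> z ∈ x ->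
  exists y p, z = opair y p /\ is_name y /\ cond mem p.
Proof.
intros [H K] Hz; destruct (H z Hz) as (y & p & E & Hp); apply is_opairE in E; subst z.
exists y, p; split; [trivial|split; [|trivial]]; apply (K y p); now apply appE.
Qed.

Lemma name_opair x y p : is_name x -> opair y p ∈ x -> is_name y /\ cond mem p.
Proof.
intros H Hz; destruct (name_elem x _ H Hz) as (y' & p' & E & K); now apply opair_inj in E as [-> ->].
Qed.

Lemma name_make x : (forall z, z ∈ x -> exists y p, z = opair y p /\ is_name y /\ cond mem p) -> is_name x.
Proof.
intros H; split.
- intros z Hz; destruct (H z Hz) as (y & p & -> & _ & Hp); exists y, p; now rewrite is_opairE.
- intros y p Hz; apply appE in Hz; destruct (H _ Hz) as (y' & p' & E & K & _).
  now apply opair_inj in E as [-> _].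
Qed.

Lemma name_ind (Q : T -> Prop) :
  (forall x, is_name x -> (forall y p, opair y p ∈ x -> Q y) -> Q x) ->
  forall x, is_name x -> Q x.
Proof.
intros H x Hx; induction Hx as [x H1 H2 IH]; apply H; [now split|].
intros y p Hy; apply (IH y p); now apply appE.
Qed.

Lemma opair_tc y p x : opair y p ∈ x -> y ∈ tc x.
Proof.
intros H; apply sub_tc in H.
apply (tc_transitive x (pair y y)); [|apply in_pair; auto].
apply (tc_transitive x (opair y p)); [trivial|apply in_pair; auto].
Qed.

Definition act_step (pi x g : T) : T := rep x (fun z => opair (ap g (fst z)) (actc pi (snd z))).
Lemma F3_act_step : F3 act_step. Proof. dpu act_step. Qed.

Definition act (pi x : T) : T := rec act_step pi x.
Lemma F2_act : F2 act. Proof. apply F2_rec, F3_act_step. Qed.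
#[local] Hint Resolve F2_act : dp.

Lemma in_act pi x z : is_name x ->
  z ∈ act pi x <-> exists y p, opair y p ∈ x /\ z = opair (act pi y) (actc pi p).
Proof.
intros Hx; unfold act at 1; rewrite rec_eq by apply F3_act_step.
unfold act_step at 1; rewrite in_rep by dp; split.
- intros (w & Hw & ->); destruct (name_elem x w Hx Hw) as (y & p & -> & _).
  exists y, p; split; [trivial|].
  rewrite fst_opair, snd_opair, ap_rec; [trivial|apply F3_act_step|eapply opair_tc; eauto].
- intros (y & p & H & ->); exists (opair y p); split; [trivial|].
  rewrite fst_opair, snd_opair, ap_rec; [trivial|apply F3_act_step|eapply opair_tc; eauto].
Qed.

Lemma opair_in_act pi x y p : is_name x -> opair y p ∈ x -> opair (act pi y) (actc pi p) ∈ act pi x.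
Proof. intros Hx H; apply in_act; eauto. Qed.

Lemma is_name_act pi x : perm mem pi -> is_name x -> is_name (act pi x).
Proof.
intros Hpi; revert x; refine (name_ind _ _); intros x Hx IH; apply name_make.
intros z Hz; apply in_act in Hz as (y & p & H & ->); trivial.
exists (act pi y), (actc pi p); split; [trivial|split; [eauto|]].
apply cond_actc; [trivial|]; now apply (name_opair x y).
Qed.

Lemma act_pcomp pi sigma x : perm mem pi -> perm mem sigma -> is_name x ->
  act (pcomp pi sigma) x = act pi (act sigma x).
Proof.
intros Hpi Hs; revert x; refine (name_ind _ _); intros x Hx IH; apply ext; intros z.
rewrite !in_act by auto using is_name_act; split.
- intros (y & p & H & ->); exists (act sigma y), (actc sigma p); split.
  + now apply opair_in_act.
  + rewrite (IH y p H), actc_pcomp; trivial; now apply (name_opair x y).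
- intros (y & p & H & ->); apply in_act in H as (y' & p' & H & E); trivial.
  apply opair_inj in E as [-> ->]; exists y', p'; split; [trivial|].
  rewrite (IH y' p' H), actc_pcomp; trivial; now apply (name_opair x y').
Qed.

Lemma act_pid x : is_name x -> act pid x = x.
Proof.
revert x; refine (name_ind _ _); intros x Hx IH; apply ext; intros z; rewrite in_act by trivial; split.
- intros (y & p & H & ->); rewrite (IH y p H), actc_pid; trivial; now apply (name_opair x y).
- intros H; destruct (name_elem x z Hx H) as (y & p & -> & Hy & Hp); exists y, p; split; [trivial|].
  rewrite (IH y p H), actc_pid; trivial.
Qed.

Lemma act_pinv_l pi x : perm mem pi -> is_name x -> act (pinv pi) (act pi x) = x.
Proof.
intros Hpi Hx; rewrite <- act_pcomp by auto using perm_pinv.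
rewrite pcomp_pinv_l by trivial; now apply act_pid.
Qed.

Lemma act_pinv_r pi x : perm mem pi -> is_name x -> act pi (act (pinv pi) x) = x.
Proof.
intros Hpi Hx; rewrite <- (pinvK pi) at 1 by trivial; apply act_pinv_l; auto using perm_pinv.
Qed.

(** This identifies the action defined outside the model by well-founded recursion with the class
    function [act], which is definable. *)
Lemma act_name_act pi x : perm mem pi -> is_name x ->
  forall x', act_name mem mem_wf pi x x' <-> x' = act pi x.
Proof.
intros Hpi; revert x; refine (name_ind _ _); intros x Hx IH x'; rewrite act_nameE.
assert (K : forall z, (exists y p y' p', app mem x y p /\ act_name mem mem_wf pi y y' /\
  act_cond mem pi p p' /\ is_opair mem z y' p') <-> z ∈ act pi x).
{ intros z; rewrite in_act by trivial; split.
  - intros (y & p & y' & p' & H & Hy & Hp & Hz).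
    apply appE in H; apply (IH y p H) in Hy; apply is_opairE in Hz; subst.
    apply act_condE in Hp; trivial; [subst; eauto|]; now apply (name_opair x y).
  - intros (y & p & H & ->); exists y, p, (act pi y), (actc pi p).
    rewrite appE, (IH y p H), is_opairE, act_condE; trivial; [auto|]; now apply (name_opair x y). }
split.
- intros H; apply ext; intros z; now rewrite (H z).
- intros -> z; symmetry; apply K.
Qed.

Definition supports (E x : T) := E ⊆ omega1 /\ countable mem E /\
  forall pi, perm mem pi -> fixes pi E -> act pi x = x.
Lemma D2_supports : D2 supports. Proof. dpu supports. Qed.
#[local] Hint Resolve D2_supports : dp.

Lemma is_comp_pcomp h f g : perm mem f -> perm mem g -> is_comp mem h f g -> h = pcomp f g.
Proof.
intros Hf Hg H; apply ext; intros z; rewrite (H z); unfold pcomp; rewrite in_lam by dp; split.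
- intros (a & b & c & H1 & H2 & H3); apply is_opairE in H3.
  apply perm_app in H1 as [Ha ->]; trivial; apply perm_app in H2 as [Hb ->]; trivial; eauto.
- intros (a & Ha & ->); exists a, (ap g a), (ap f (ap g a)).
  rewrite !perm_app, is_opairE by trivial; auto using perm_in.
Qed.

Lemma is_inverse_pinv h f : perm mem f -> is_inverse mem h f -> h = pinv f.
Proof.
intros Hf H.
assert (K : forall b, b ∈ omega1 -> iota (fun a => a ∈ omega1 /\ ap f a = b) = ap (pinv f) b).
{ intros b Hb; unfold pinv; rewrite ap_lam; trivial; dp. }
apply ext; intros z; rewrite (H z); unfold pinv; rewrite in_lam by dp; split.
- intros (a & b & H1 & H2); apply is_opairE in H2; apply perm_app in H1 as [Ha ->]; trivial.
  exists (ap f a); split; [now apply perm_in|]; rewrite K by now apply perm_in.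
  now rewrite ap_pinv_l.
- intros (b & Hb & ->); rewrite K by trivial; exists (ap (pinv f) b), b.
  rewrite perm_app, is_opairE by trivial; rewrite ap_pinv_r by trivial; auto using pinv_in.
Qed.

(** Containing some Fix(E) is preserved by every clause generating the filter: for intersections the
    sets E are united, and conjugation by π turns E into its image π[E]. *)
Lemma inF_contains_Fix H : inF mem H -> exists E, E ⊆ omega1 /\ countable mem E /\
  forall pi, perm mem pi -> fixes pi E -> pi ∈ H.
Proof.
induction 1 as [o E H Ho HE HC HF|H K _ (E & H1 & H2 & H3) _ HK|H K L _ (E & H1 & H2 & H3) _ (E' & K1 & K2 & K3) HL
  |H pi K _ (E & H1 & H2 & H3) Hpi HK].
- apply is_omega1E in Ho; subst o; exists E; split; [trivial|split; [trivial|]].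
  intros pi Hpi Hf; apply HF; split; [trivial|]; intros a Ha; apply perm_app; trivial.
  split; [now apply HE|symmetry; now apply Hf].
- exists E; split; [trivial|split; [trivial|]]; intros pi Hpi Hf; now apply HK, H3.
- exists (cup E E'); split; [|split; [now apply countable_cup|]].
  + intros a Ha; apply in_cup in Ha as [Ha|Ha]; auto.
  + intros pi Hpi Hf; apply HL; split; [apply H3|apply K3]; trivial; intros a Ha; apply Hf, in_cup; auto.
- assert (A : forall b, b ∈ rep E (ap pi) <-> exists a, a ∈ E /\ b = ap pi a) by (intros b; now rewrite in_rep by dp).
  exists (rep E (ap pi)); split; [|split; [apply countable_image; [dp|trivial]|]].
  + intros b Hb; apply A in Hb as (a & Ha & ->); apply perm_in; auto.
  (* [t] is the conjugate under π of π⁻¹tπ, and the latter fixes [E] because [t] fixes the image of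
     [E]. *)
  + intros t Ht Hf; apply HK; exists (pcomp (pinv pi) (pcomp t pi)).
    assert (Hs : perm mem (pcomp (pinv pi) (pcomp t pi))) by auto using perm_pcomp, perm_pinv.
    split.
    * apply H3; [trivial|]; intros a Ha; rewrite !ap_pcomp by auto.
      rewrite Hf; [apply ap_pinv_l; auto|]; apply A; eauto.
    * intros z; split.
      -- intros Hz; pose proof Ht as Ht'; apply permE in Ht' as (((Hz' & _) & _) & _).
         destruct (Hz' z Hz) as (x & y & Exy); apply is_opairE in Exy; subst z.
         apply appE, perm_app in Hz as [Hx ->]; trivial.
         exists (ap (pinv pi) x), (ap (pinv pi) (ap t x)), x, (ap t x).
         rewrite !perm_app, is_opairE by trivial.
         rewrite !ap_pcomp, !ap_pinv_r by auto using perm_in, pinv_in.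
         repeat split; auto using perm_in, pinv_in.
      -- intros (a & b & a' & b' & Hab & Ha & Hb & Hz); apply is_opairE in Hz; subst z.
         apply perm_app in Hab as [Hao ->], Ha as [_ ->], Hb as [_ ->]; trivial.
         rewrite !ap_pcomp, ap_pinv_r by auto using perm_in.
         apply appE, perm_app; auto using perm_in.
Qed.

(** From here on symmetry is handled through countable supports. Conversely to the previous lemma,
    the stabilizer is a set by separation from [perms], a subgroup, and contains Fix(E). *)
Lemma symmetricE x : is_name x -> symmetric mem mem_wf x <-> exists E, supports E x.
Proof.
intros Hx.
assert (K : forall pi, in_stab mem mem_wf x pi <-> perm mem pi /\ act pi x = x).
{ intros pi; split; intros [Hpi H]; (split; [trivial|]); [symmetry|]; now apply act_name_act. }
split.
- intros (H & HF & HS); destruct (inF_contains_Fix H HF) as (E & H1 & H2 & H3).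
  exists E; split; [trivial|split; [trivial|]]; intros pi Hpi Hf; now apply K, HS, H3.
- intros (E & H1 & H2 & H3).
  assert (L : forall pi, pi ∈ sep perms (fun pi => act pi x = x) <-> perm mem pi /\ act pi x = x).
  { intros pi; rewrite in_sep by dp; now rewrite in_perms. }
  exists (sep perms (fun pi => act pi x = x)); split; [|intros pi; now rewrite L, K].
  assert (N : forall pi, pi ∈ sep perms (fun pi => fixes pi E) <-> perm mem pi /\ fixes pi E).
  { intros pi; rewrite in_sep by dp; now rewrite in_perms. }
  apply (inF_up mem (sep perms (fun pi => fixes pi E))).
  + apply (inF_Fix mem omega1 E); trivial; [now apply is_omega1E|].
    intros pi; rewrite N; split; intros [Hpi Hf]; (split; [trivial|]); intros a Ha.
    * apply perm_app; trivial; split; [auto|symmetry; auto].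
    * specialize (Hf a Ha); apply perm_app in Hf; intuition.
  + split; [|split; [|split]].
    * intros f Hf; now apply L in Hf.
    * exists pid; apply L; split; [apply perm_pid|now apply act_pid].
    * intros f g h Hf Hg Hh; apply L in Hf as [Hf Ef], Hg as [Hg Eg].
      apply is_comp_pcomp in Hh; trivial; subst h; apply L; split; [now apply perm_pcomp|].
      now rewrite act_pcomp, Eg, Ef.
    * intros f h Hf Hh; apply L in Hf as [Hf Ef].
      apply is_inverse_pinv in Hh; trivial; subst h; apply L; split; [now apply perm_pinv|].
      rewrite <- Ef at 1; now apply act_pinv_l.
  + intros pi Hpi; apply N in Hpi as [Hpi Hf]; apply L; auto.
Qed.

Lemma HS_name x : HS x -> is_name x.
Proof. now destruct 1. Qed.

Lemma HS_supports x : HS x -> exists E, supports E x.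
Proof. destruct 1 as [H1 H2 _]; now apply symmetricE. Qed.

Lemma HS_opair x y p : HS x -> opair y p ∈ x -> HS y /\ cond mem p.
Proof.
intros [H1 _ H2] H; split; [apply (H2 y p); now apply appE|now apply (name_opair x y)].
Qed.

Lemma HS_elem x z : HS x -> z ∈ x -> exists y p, z = opair y p /\ HS y /\ cond mem p.
Proof.
intros H Hz; destruct (name_elem x z (HS_name x H) Hz) as (y & p & -> & _).
exists y, p; split; [trivial|]; eapply HS_opair; eauto.
Qed.

Lemma HS_make x : (forall z, z ∈ x -> exists y p, z = opair y p /\ HS y /\ cond mem p) ->
  (exists E, supports E x) -> HS x.
Proof.
intros H HE.
assert (N : is_name x).
{ apply name_make; intros z Hz; destruct (H z Hz) as (y & p & -> & Hy & Hp).
  exists y, p; auto using HS_name. }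
split; [trivial|now apply symmetricE|].
intros y p Hz; apply appE in Hz; destruct (H _ Hz) as (y' & p' & E & K & _).
now apply opair_inj in E as [-> _].
Qed.

Lemma HS_ind' (Q : T -> Prop) :
  (forall x, HS x -> (forall y p, opair y p ∈ x -> Q y) -> Q x) -> forall x, HS x -> Q x.
Proof.
intros H x Hx; induction Hx as [x H1 H2 H3 IH]; apply H; [now split|].
intros y p Hy; apply (IH y p); now apply appE.
Qed.

Definition HS_closed (t : T) := forall x, x ∈ t -> (exists E, supports E x) /\
  forall z, z ∈ x -> exists y p, z = opair y p /\ y ∈ t /\ cond mem p.

(** Makes the inductive predicate [HS] definable: a set of symmetric names closed under constituents
    witnesses it, and induction along [tc] shows that such a witness suffices. *)
Lemma HSE x : HS x <-> exists t, x ∈ t /\ HS_closed t.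
Proof.
assert (D : D1 HS_closed) by dpu HS_closed.
split.
- revert x; apply HS_ind'; intros x Hx IH.
  (* Instead of collecting one witness for each name in [x], all members of [tc x] that lie in some
     closed set are taken. *)
  set (P := fun u => exists t, u ∈ t /\ HS_closed t).
  assert (K : forall u, u ∈ sep (tc x) P <-> u ∈ tc x /\ P u) by (intros u; unfold P; now rewrite in_sep by dp).
  exists (cup (sep (tc x) P) (pair x x)); split; [apply in_cup; right; apply in_pair; auto|].
  intros u Hu; apply in_cup in Hu as [Hu|Hu].
  + apply K in Hu as [Hu (t & Ht & Ct)]; split; [now apply (Ct u)|].
    intros z Hz; destruct (proj2 (Ct u Ht) z Hz) as (y & p & -> & Hy & Hp).
    exists y, p; split; [trivial|split; [|trivial]]; apply in_cup; left; apply K; split; [|now exists t].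
    apply (tc_sub x u Hu); eapply opair_tc; eauto.
  + apply in_pair in Hu; assert (u = x) as -> by tauto; split; [now apply HS_supports|].
    intros z Hz; destruct (HS_elem x z Hx Hz) as (y & p & -> & _ & Hp).
    exists y, p; split; [trivial|split; [|trivial]]; apply in_cup; left; apply K; split; [eapply opair_tc; eauto|].
    exact (IH y p Hz).
- intros (t & Hx & Ct); revert Hx; induction x as [x IH] using tc_ind; intros Hx.
  apply HS_make; [|now apply (Ct x)].
  intros z Hz; destruct (proj2 (Ct x Hx) z Hz) as (y & p & -> & Hy & Hp).
  exists y, p; split; [trivial|split; [|trivial]]; apply IH; trivial; eapply opair_tc; eauto.
Qed.

Lemma D1_HS : D1 HS.
Proof.
intros t Ht; eapply DP_ext; [|intros e; apply HSE]; unfold HS_closed; dp.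
Qed.
#[local] Hint Resolve D1_HS : dp.

Lemma fixes_conj pi sigma E : perm mem pi -> E ⊆ omega1 -> perm mem sigma ->
  fixes sigma (rep E (ap pi)) -> fixes (pcomp (pinv pi) (pcomp sigma pi)) E.
Proof.
intros Hpi HE Hs Hf a Ha; rewrite !ap_pcomp by auto; rewrite Hf; [apply ap_pinv_l; auto|].
apply in_rep; [dp|eauto].
Qed.

Lemma supports_act pi E x : perm mem pi -> is_name x -> supports E x -> supports (rep E (ap pi)) (act pi x).
Proof.
intros Hpi Hx (H1 & H2 & H3); split; [|split; [apply countable_image; [dp|trivial]|]].
- intros b Hb; apply in_rep in Hb as (a & Ha & ->); [apply perm_in; auto|dp].
- intros sigma Hs Hf; pose proof (fixes_conj pi sigma E Hpi H1 Hs Hf) as K.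
  apply H3 in K; [|auto using perm_pcomp, perm_pinv].
  rewrite !act_pcomp in K by auto using perm_pcomp, perm_pinv, is_name_act.
  rewrite <- K at 2; now rewrite act_pinv_r by auto using is_name_act.
Qed.

Lemma HS_act pi x : perm mem pi -> HS x -> HS (act pi x).
Proof.
intros Hpi; revert x; apply HS_ind'; intros x Hx IH; apply HS_make.
- intros z Hz; apply in_act in Hz as (y & p & H & ->); [|now apply HS_name].
  exists (act pi y), (actc pi p); split; [trivial|split; [eauto|]].
  apply cond_actc; [trivial|]; now apply (HS_opair x y).
- destruct (HS_supports x Hx) as [E HE]; exists (rep E (ap pi)); apply supports_act; auto using HS_name.
Qed.

Lemma supports_sub E E' x : E ⊆ E' -> E' ⊆ omega1 -> countable mem E' -> supports E x -> supports E' x.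
Proof.
intros H H1 H2 (_ & _ & H3); split; [trivial|split; [trivial|]].
intros pi Hpi Hf; apply H3; [trivial|]; now apply (fixes_sub pi E E').
Qed.

(** Closure under Fix(E) yields one inclusion between [act pi b] and [b]; the other comes from the
    inverse permutation, which also lies in Fix(E). *)
Lemma supports_make E b : is_name b -> E ⊆ omega1 -> countable mem E ->
  (forall pi, perm mem pi -> fixes pi E -> forall y p, opair y p ∈ b ->
    opair (act pi y) (actc pi p) ∈ b) -> supports E b.
Proof.
intros Hb H1 H2 H; split; [trivial|split; [trivial|]]; intros pi Hpi Hf.
apply ext; intros z; split.
- intros Hz; apply in_act in Hz as (y & p & K & ->); auto.
- intros Hz; destruct (name_elem b z Hb Hz) as (y & p & -> & Hy & Hp).
  rewrite <- (act_pinv_r pi y), <- (actc_pinv_r pi p) by trivial.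
  apply opair_in_act; [trivial|]; apply H; [now apply perm_pinv|now apply fixes_pinv|trivial].
Qed.

End Names.
#[export] Hint Resolve F2_act D2_supports : dp.
#[export] Hint Extern 1 (D1 (HS _ _)) => exact D1_HS : dp.
#[export] Hint Extern 3 (is_name _ _) => apply HS_name : core.
#[export] Hint Extern 2 (is_name _ (act _ _)) => apply is_name_act : core.
#[export] Hint Extern 2 (HS _ _ (act _ _)) => apply HS_act : core.

(** * Forcing *)

Section Forcing.
Context {T : Type} {St : struct T} {M : model T St} {Gr : ground T St M}.
Local Notation is_name := (is_name mem).
Local Notation HS := (HS mem mem_wf).
Local Notation cond := (cond mem).

Definition densely (p : T) (D : T -> Prop) :=
  forall q, cond q -> p ⊆ q -> exists r, cond r /\ q ⊆ r /\ D r.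

(** With forcing of equality for [E], this says that [p] forces [x] to be a subset of [y]. *)
Definition covered (E : T -> T -> T -> Prop) (p x y : T) :=
  forall z r, opair z r ∈ x -> forall q, cond q -> p ⊆ q -> r ⊆ q ->
  exists q', cond q' /\ q ⊆ q' /\ exists w s, opair w s ∈ y /\ s ⊆ q' /\ E q' z w.

Definition bisimulation (R : T) := forall p x y, opair p (opair x y) ∈ R ->
  covered (fun q z w => opair q (opair z w) ∈ R) p x y /\
  covered (fun q w z => opair q (opair z w) ∈ R) p y x.

(** The recursive definition of forcing for equality is replaced by its
    greatest fixed point, so that no recursion inside the model is needed; as
    names are well-founded the fixed point is unique. *)
Definition force_eq (p x y : T) := exists R, opair p (opair x y) ∈ R /\ bisimulation R.

Lemma D3_force_eq : D3 force_eq.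
Proof. dpu force_eq; unfold bisimulation, covered; dp. Qed.
#[local] Hint Resolve D3_force_eq : dp.

Lemma covered_imp (E E' : T -> T -> T -> Prop) p x y :
  (forall q z r w s, cond q -> opair z r ∈ x -> opair w s ∈ y -> E q z w -> E' q z w) ->
  covered E p x y -> covered E' p x y.
Proof.
intros H K z r Hz q Hq Hp Hr; destruct (K z r Hz q Hq Hp Hr) as (q' & Hq' & L & w & s & Hw & Hs & HE).
exists q'; split; [trivial|split; [trivial|]]; exists w, s; eauto 7.
Qed.

Lemma force_eq_unfold p x y : force_eq p x y ->
  covered force_eq p x y /\ covered (fun q w z => force_eq q z w) p y x.
Proof.
intros (R & H & HR); destruct (HR p x y H) as [H1 H2]; split.
- revert H1; apply covered_imp; intros; now exists R.
- revert H2; apply covered_imp; intros; now exists R.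
Qed.

(** Coinduction: the forced triples together with the new one form a bisimulation. To be a set it is
    cut down to names in [t], which contains [x] and [y] and is closed under constituents. *)
Lemma force_eq_fold p x y : cond p ->
  covered force_eq p x y -> covered (fun q w z => force_eq q z w) p y x -> force_eq p x y.
Proof.
intros Hp H1 H2.
set (t := cup (pair x y) (tc (pair x y))).
set (Q := fun u => (exists q z w, u = opair q (opair z w) /\ force_eq q z w) \/ u = opair p (opair x y)).
set (R := sep (prod conds (prod t t)) Q).
assert (Tx : x ∈ t /\ y ∈ t) by (unfold t; rewrite !in_cup, !in_pair; auto).
assert (Tt : forall u z r, u ∈ t -> opair z r ∈ u -> z ∈ t).
{ intros u z r Hu Hz; apply in_cup; right; apply in_cup in Hu.
  assert (u ∈ tc (pair x y)) by (destruct Hu; [now apply sub_tc|trivial]).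
  apply (tc_sub _ u); [trivial|eapply opair_tc; eauto]. }
assert (KR : forall q z w, opair q (opair z w) ∈ R <->
  cond q /\ z ∈ t /\ w ∈ t /\ (force_eq q z w \/ (q = p /\ z = x /\ w = y))).
{ intros q z w; unfold R; rewrite in_sep by (unfold Q; dp); unfold Q; rewrite !opair_in_prod, in_conds.
  split.
  - intros [(Hq & Hz & Hw) [(q' & z' & w' & E & H)|E]]; apply opair_inj in E as [-> E];
      apply opair_inj in E as [-> ->]; tauto.
  - intros (Hq & Hz & Hw & [H|(-> & -> & ->)]); split; auto.
    left; exists q, z, w; auto. }
exists R; split; [apply KR; tauto|].
intros q u v H; apply KR in H as (Hq & Hu & Hv & H).
assert (C : covered force_eq q u v /\ covered (fun q w z => force_eq q z w) q v u).
{ destruct H as [H|(-> & -> & ->)]; [now apply force_eq_unfold|auto]. }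
destruct C as [C1 C2]; split.
- revert C1; apply covered_imp; intros; apply KR; eauto 7.
- revert C2; apply covered_imp; intros; apply KR; eauto 7.
Qed.

Lemma subset_trans x y z : x ⊆ y -> y ⊆ z -> x ⊆ z.
Proof. intros H K u Hu; auto. Qed.

Lemma subset_refl x : x ⊆ x.
Proof. now intros u Hu. Qed.

Lemma covered_mono E p q x y : p ⊆ q -> covered E p x y -> covered E q x y.
Proof. intros H K z r Hz q' Hq' L; apply (K z r Hz q' Hq'); eapply subset_trans; eauto. Qed.

Lemma force_eq_mono p q x y : cond q -> p ⊆ q -> force_eq p x y -> force_eq q x y.
Proof.
intros Hq H K; apply force_eq_unfold in K as [K1 K2].
apply force_eq_fold; [trivial|..]; eapply covered_mono; eauto.
Qed.

Lemma covered_densely E p x y : densely p (fun q => covered E q x y) -> covered E p x y.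
Proof.
intros H z r Hz q Hq L Lr; destruct (H q Hq L) as (q1 & Hq1 & L1 & C).
destruct (C z r Hz q1 Hq1) as (q' & Hq' & L' & K); [apply subset_refl|eapply subset_trans; eauto|].
exists q'; split; [trivial|split; [eapply subset_trans; eauto|trivial]].
Qed.

Lemma densely_imp p (D D' : T -> Prop) : (forall q, cond q -> D q -> D' q) -> densely p D -> densely p D'.
Proof. intros H K q Hq L; destruct (K q Hq L) as (r & Hr & L' & HD); eauto. Qed.

Lemma force_eq_densely p x y : cond p -> densely p (fun q => force_eq q x y) -> force_eq p x y.
Proof.
intros Hp H; apply force_eq_fold; trivial; apply covered_densely; revert H; apply densely_imp;
  intros q Hq K; now apply force_eq_unfold.
Qed.

Definition force_mem (p x y : T) :=
  densely p (fun q => exists w s, opair w s ∈ y /\ s ⊆ q /\ force_eq q x w).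

Lemma D3_force_mem : D3 force_mem.
Proof. dpu force_mem; unfold densely; dp. Qed.
#[local] Hint Resolve D3_force_mem : dp.

Lemma densely_mono p q D : p ⊆ q -> densely p D -> densely q D.
Proof. intros H K r Hr L; apply K; [trivial|]; eapply subset_trans; eauto. Qed.

Lemma densely_idem p D : densely p (fun q => densely q D) -> densely p D.
Proof.
intros H q Hq L; destruct (H q Hq L) as (r & Hr & L1 & K).
destruct (K r Hr (subset_refl r)) as (r' & Hr' & L2 & HD).
exists r'; split; [trivial|split; [eapply subset_trans; eauto|trivial]].
Qed.

(** Quantifiers range over hereditarily symmetric names, so this is the forcing relation of the
    symmetric extension and not that of the full generic one. *)
Fixpoint force (phi : formula) (p : T) (e : nat -> T) : Prop :=
  match phi with
  | fmem i j => force_mem p (e i) (e j)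
  | feq i j => force_eq p (e i) (e j)
  | fbot => False
  | fimp phi psi => forall q, cond q -> p ⊆ q -> force phi q e -> force psi q e
  | fall phi => forall x, HS x -> force phi p (scons x e)
  end.

Lemma force_mono phi p q e : cond q -> p ⊆ q -> force phi p e -> force phi q e.
Proof.
revert p q e; induction phi as [i j|i j| |phi IH1 psi IH2|phi IH]; intros p q e Hq H; simpl.
- now apply densely_mono.
- now apply force_eq_mono.
- trivial.
- intros K r Hr L; apply K; [trivial|eapply subset_trans; eauto].
- intros K x Hx; apply (IH p); auto.
Qed.

(** Forcing of atomic formulas has this property already and the other clauses preserve it. It makes
    the implication clause, which looks like that of Kripke semantics, agree with classical
    logic. *)
Lemma force_densely phi p e : cond p -> densely p (fun q => force phi q e) -> force phi p e.
Proof.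
revert p e; induction phi as [i j|i j| |phi IH1 psi IH2|phi IH]; intros p e Hp H; simpl in *.
- now apply densely_idem.
- now apply force_eq_densely.
- destruct (H p Hp (subset_refl p)) as (r & _ & _ & K); exact K.
- intros q Hq L K; apply IH2; [trivial|]; intros r Hr L'.
  destruct (H r Hr) as (r' & Hr' & L2 & K'); [eapply subset_trans; eauto|].
  exists r'; split; [trivial|split; [trivial|]]; apply K'; [trivial|apply subset_refl|].
  apply (force_mono _ q); trivial; eapply subset_trans; eauto.
- intros x Hx; apply IH; [trivial|]; revert H; apply densely_imp; auto.
Qed.

Lemma not_force phi p e : cond p -> ~ force phi p e ->
  exists q, cond q /\ p ⊆ q /\ forall r, cond r -> q ⊆ r -> ~ force phi r e.
Proof.
intros Hp H; apply NNPP; intros K; apply H, force_densely; [trivial|].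
intros q Hq L; apply NNPP; intros K'; apply K; exists q; split; [trivial|split; [trivial|]].
intros r Hr Lr F; apply K'; eauto.
Qed.

(** The names assigned to the variables are arbitrary definable terms, so that the bound variable of
    a quantifier can be prepended to the assignment in the induction. *)
Lemma DP_force phi : forall t u, DF t -> (forall n, DF (u n)) ->
  DP (fun e => force phi (t e) (fun n => u n e)).
Proof.
induction phi as [i j|i j| |phi IH1 psi IH2|phi IH]; intros t u Ht Hu; simpl.
- apply (D3_force_mem t (u i) (u j)); auto.
- apply (D3_force_eq t (u i) (u j)); auto.
- apply DP_bot.
- dp_step; repeat (apply DP_imp; [solve [dp]|]).
  apply DP_imp.
  + apply (IH1 (fun e => e 0) (fun n e => u n (fun m => e (S m)))); [dp|].
    intros n; apply DF_ren, Hu.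
  + apply (IH2 (fun e => e 0) (fun n e => u n (fun m => e (S m)))); [dp|].
    intros n; apply DF_ren, Hu.
- dp_step; apply DP_imp; [solve [dp]|].
  apply (IH (fun e => t (fun m => e (S m))) (fun n e => scons (e 0) (fun k => u k (fun m => e (S m))) n)).
  + apply (DF_ren t S Ht).
  + intros [|n]; [apply DF_var|apply (DF_ren (u n) S), Hu].
Qed.

(** An assignment is a sequence in Rocq, possibly unknown to the model, so the supports of all its
    entries could not be united there. Dependence on finitely many entries leaves a finite union. *)
Lemma force_bound phi : exists k, forall p e e', (forall n, n < k -> e n = e' n) ->
  force phi p e -> force phi p e'.
Proof.
induction phi as [i j|i j| |phi (k1 & IH1) psi (k2 & IH2)|phi (k & IH)]; simpl.
- exists (S (i + j)); intros p e e' H; rewrite (H i), (H j) by lia; trivial.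
- exists (S (i + j)); intros p e e' H; rewrite (H i), (H j) by lia; trivial.
- now exists 0.
- exists (k1 + k2); intros p e e' H K q Hq L F.
  apply (IH2 q e); [intros n Hn; apply H; lia|]; apply K; trivial.
  apply (IH1 q e'); [intros n Hn; symmetry; apply H; lia|trivial].
- exists k; intros p e e' H K x Hx; apply (IH p (scons x e)); auto.
  intros [|n] Hn; [trivial|apply H; lia].
Qed.

Lemma covered_act E E' pi p x y : perm mem pi -> cond p -> is_name x -> is_name y ->
  (forall q z r w s, cond q -> opair z r ∈ x -> opair w s ∈ y -> E q z w ->
    E' (actc pi q) (act pi z) (act pi w)) ->
  covered E p x y -> covered E' (actc pi p) (act pi x) (act pi y).
Proof.
intros Hpi Hp Hx Hy H K z' r' Hz q Hq L Lr.
apply in_act in Hz as (z & r & Hz & Eq); trivial; apply opair_inj in Eq as [-> ->].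
assert (Hr : cond r) by now apply (name_opair x z).
destruct (K z r Hz (actc (pinv pi) q)) as (q' & Hq' & L' & w & s & Hw & Hs & HE).
- auto.
- rewrite <- (actc_pinv_l pi p) by trivial; now apply actc_mono.
- rewrite <- (actc_pinv_l pi r) by trivial; now apply actc_mono.
- exists (actc pi q'); split; [now apply cond_actc|split].
  + rewrite <- (actc_pinv_r pi q) by trivial; now apply actc_mono.
  + exists (act pi w), (actc pi s); split; [now apply opair_in_act|split; [now apply actc_mono|eauto]].
Qed.

Lemma force_eq_act pi p x y : perm mem pi -> cond p -> is_name x -> is_name y ->
  force_eq p x y -> force_eq (actc pi p) (act pi x) (act pi y).
Proof.
intros Hpi Hp Hx; revert x Hx p y Hp; refine (name_ind _ _); intros x Hx IH p y Hp Hy H.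
apply force_eq_unfold in H as [H1 H2]; apply force_eq_fold; [now apply cond_actc|..].
- revert H1; apply covered_act; trivial; intros q z r w s Hq Hz Hw.
  apply (IH z r Hz); trivial; now apply (name_opair y w s).
- revert H2; apply covered_act; trivial; intros q w s z r Hq Hw Hz.
  apply (IH z r Hz); trivial; now apply (name_opair y w s).
Qed.

Lemma densely_act pi p (D D' : T -> Prop) : perm mem pi -> cond p ->
  (forall q, cond q -> D q -> D' (actc pi q)) -> densely p D -> densely (actc pi p) D'.
Proof.
intros Hpi Hp H K q Hq L; destruct (K (actc (pinv pi) q)) as (r & Hr & L' & HD).
- auto.
- rewrite <- (actc_pinv_l pi p) by trivial; now apply actc_mono.
- exists (actc pi r); split; [now apply cond_actc|split; [|auto]].
  rewrite <- (actc_pinv_r pi q) by trivial; now apply actc_mono.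
Qed.

Lemma force_mem_act pi p x y : perm mem pi -> cond p -> is_name x -> is_name y ->
  force_mem p x y -> force_mem (actc pi p) (act pi x) (act pi y).
Proof.
intros Hpi Hp Hx Hy; apply densely_act; trivial; intros q Hq (w & s & Hw & Hs & H).
exists (act pi w), (actc pi s); split; [now apply opair_in_act|split; [now apply actc_mono|]].
apply force_eq_act; trivial; now apply (name_opair y w s).
Qed.

(** The symmetry lemma. For implications and quantifiers the inverse permutation pulls the given
    condition or name back; this uses that [HS] is closed under permutations. *)
Lemma force_act phi : forall pi p e, perm mem pi -> cond p -> (forall n, HS (e n)) ->
  force phi p e -> force phi (actc pi p) (fun n => act pi (e n)).
Proof.
induction phi as [i j|i j| |phi IH1 psi IH2|phi IH]; intros pi p e Hpi Hp He; simpl.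
- apply force_mem_act; auto.
- apply force_eq_act; auto.
- trivial.
- intros H q Hq L F.
  assert (F' : force phi (actc (pinv pi) q) e).
  { replace e with (fun n => act (pinv pi) (act pi (e n))).
    - apply (IH1 (pinv pi) q (fun n => act pi (e n))); auto.
    - extensionality n; apply act_pinv_l; auto. }
  rewrite <- (actc_pinv_r pi q) by trivial; apply IH2; auto.
  apply H; auto.
  rewrite <- (actc_pinv_l pi p) by trivial; now apply actc_mono.
- intros H x Hx.
  replace (scons x (fun n => act pi (e n))) with (fun n => act pi (scons (act (pinv pi) x) e n)).
  + apply IH; trivial.
    * intros [|n]; simpl; auto.
    * apply H; auto.
  + extensionality n; destruct n as [|n]; simpl; [|trivial]; apply act_pinv_r; auto.
Qed.

End Forcing.
#[export] Hint Resolve D3_force_eq D3_force_mem : dp.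

(** * The truth lemma *)

Section Truth.
Context {T : Type} {St : struct T} {M : model T St} {Gr : ground T St M}.
Local Notation is_name := (is_name mem).
Local Notation HS := (HS mem mem_wf).
Local Notation cond := (cond mem).
Variable G : T -> Prop.
Hypothesis HG : generic mem G.

(** The filter is only assumed to meet sets dense everywhere, so the conditions incompatible with
    [p0] are added to [D]; no element of the filter is among them. *)
Lemma generic_meets p0 (D : T -> Prop) : D1 D -> G p0 -> densely p0 D -> exists p, G p /\ D p.
Proof.
intros HD Gp0 H.
set (Q := fun p => D p \/ forall r, cond r -> p ⊆ r -> p0 ⊆ r -> False).
assert (K : forall p, p ∈ sep conds Q <-> cond p /\ Q p).
{ intros p; rewrite in_sep by (unfold Q; dp); now rewrite in_conds. }
destruct (gen_dense _ _ HG (sep conds Q)) as (p & Gp & Hp).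
- split; [intros p Hp; now apply K in Hp|]; intros p Hp.
  destruct (classic (exists r, cond r /\ p ⊆ r /\ p0 ⊆ r)) as [(r & Hr & L & L0)|N].
  + destruct (H r Hr L0) as (q & Hq & L' & HDq); exists q; split; [apply K; split; [trivial|now left]|].
    now apply (subset_trans p r q).
  + exists p; split; [apply K; split; [trivial|right; intros r Hr L L0; apply N; eauto]|apply subset_refl].
- apply K in Hp as [Hp [HDp|N]]; [eauto|].
  destruct (gen_dir _ _ HG p p0 Gp Gp0) as (r & Gr' & L & L0).
  destruct (N r); trivial; now apply (gen_cond _ _ HG).
Qed.

Lemma generic_cond p : G p -> cond p.
Proof. apply (gen_cond _ _ HG). Qed.

Lemma generic_up p q : G q -> cond p -> p ⊆ q -> G p.
Proof. intros; now apply (gen_up _ _ HG p q). Qed.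

Lemma generic_dir p q : G p -> G q -> exists r, G r /\ p ⊆ r /\ q ⊆ r.
Proof. apply (gen_dir _ _ HG). Qed.

Lemma generic_empty : G empty.
Proof.
destruct (gen_nonempty _ _ HG) as [p Gp]; apply (generic_up _ p); trivial; [apply cond_empty|].
intros z Hz; now apply in_empty in Hz.
Qed.

Local Notation val := (value mem_wf G).

Lemma in_val s x : set_mem s (val x) <-> exists y p, opair y p ∈ x /\ G p /\ s = val y.
Proof.
rewrite valueE; split; intros (y & p & H & K); exists y, p; (split; [|exact K]); now apply appE.
Qed.

Lemma opair_val y p x : opair y p ∈ x -> G p -> set_mem (val y) (val x).
Proof. intros H K; apply in_val; eauto. Qed.

Lemma covered_sound (E : T -> T -> T -> Prop) p x y : D3 E -> is_name x -> is_name y -> G p ->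
  (forall q z r w s, G q -> opair z r ∈ x -> opair w s ∈ y -> E q z w -> val z = val w) ->
  covered E p x y -> forall s, set_mem s (val x) -> set_mem s (val y).
Proof.
intros DE Hx Hy Gp IH H u Hu; apply in_val in Hu as (z & r & Hz & Gr' & ->).
destruct (generic_dir p r Gp Gr') as (q0 & Gq0 & L & Lr).
destruct (generic_meets q0 (fun q => exists w s, opair w s ∈ y /\ s ⊆ q /\ E q z w)) as (q & Gq & w & s & Hw & Ls & HE);
  [dp|trivial| |].
- intros q Hq Lq; apply (H z r Hz q Hq); eapply subset_trans; eauto.
- destruct (name_opair y w s Hy Hw) as [Nw Hs].
  rewrite (IH q z r w s); trivial; apply (opair_val w s); trivial; now apply (generic_up s q).
Qed.

Lemma force_eq_sound x : is_name x -> forall p y, is_name y -> G p -> force_eq p x y -> val x = val y.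
Proof.
revert x; refine (name_ind _ _); intros x Hx IH p y Hy Gp H.
apply force_eq_unfold in H as [H1 H2]; apply set_ext; intros s; split.
- apply (covered_sound force_eq p x y); trivial; [apply D3_force_eq|].
  intros q z r w s' Gq Hz Hw HE; apply (IH z r Hz q); trivial; now apply (name_opair y w s').
- apply (covered_sound (fun q w z => force_eq q z w) p y x); trivial.
  + intros t1 t2 t3 H1' H2' H3'; now apply D3_force_eq.
  + intros q w s' z r Gq Hw Hz HE; symmetry; apply (IH z r Hz q); trivial; now apply (name_opair y w s').
Qed.

(** Where equality is not forced, some extension lies in [A] or [B]: it puts a constituent of one
    name into its value and excludes equality with every member of the other. By induction such a
    condition in [G] contradicts the equality of the values. *)
Lemma force_eq_complete x : is_name x -> forall y, is_name y -> val x = val y -> exists p, G p /\ force_eq p x y.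
Proof.
revert x; refine (name_ind _ _); intros x Hx IH y Hy Exy.
set (A := fun p => exists z r, opair z r ∈ x /\ r ⊆ p /\
  forall q, cond q -> p ⊆ q -> forall w s, opair w s ∈ y -> s ⊆ q -> ~ force_eq q z w).
set (B := fun p => exists w s, opair w s ∈ y /\ s ⊆ p /\
  forall q, cond q -> p ⊆ q -> forall z r, opair z r ∈ x -> r ⊆ q -> ~ force_eq q z w).
destruct (generic_meets empty (fun p => force_eq p x y \/ A p \/ B p)) as (p & Gp & [H|[H|H]]).
- unfold A, B; dp.
- exact generic_empty.
- intros p Hp _; apply NNPP; intros N; apply N; exists p; split; [trivial|split; [apply subset_refl|left]].
  apply force_eq_fold; trivial.
  + intros z r Hz q Hq L Lr; apply NNPP; intros K; apply N; exists q; split; [trivial|split; [trivial|]].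
    right; left; exists z, r; split; [trivial|split; [trivial|]].
    intros q' Hq' L' w s Hw Ls HE; apply K; exists q'; split; [trivial|split; [trivial|eauto]].
  + intros w s Hw q Hq L Ls; apply NNPP; intros K; apply N; exists q; split; [trivial|split; [trivial|]].
    right; right; exists w, s; split; [trivial|split; [trivial|]].
    intros q' Hq' L' z r Hz Lr HE; apply K; exists q'; split; [trivial|split; [trivial|eauto]].
- eauto.
- exfalso; destruct H as (z & r & Hz & Lr & N).
  assert (Gr' : G r) by (apply (generic_up r p); trivial; now apply (name_opair x z)).
  pose proof (opair_val z r x Hz Gr') as K; rewrite Exy in K.
  apply in_val in K as (w & s & Hw & Gs & E).
  destruct (IH z r Hz w) as (p' & Gp' & F); [now apply (name_opair y w s)|trivial|].
  destruct (generic_dir p p' Gp Gp') as (q1 & Gq1 & L1 & L2).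
  destruct (generic_dir q1 s Gq1 Gs) as (q & Gq & L3 & L4).
  apply (N q (generic_cond q Gq)) with w s; trivial; [eapply subset_trans; eauto|].
  apply (force_eq_mono p'); trivial; [now apply generic_cond|eapply subset_trans; eauto].
- exfalso; destruct H as (w & s & Hw & Ls & N).
  assert (Gs : G s) by (apply (generic_up s p); trivial; now apply (name_opair y w)).
  pose proof (opair_val w s y Hw Gs) as K; rewrite <- Exy in K.
  apply in_val in K as (z & r & Hz & Gr' & E).
  destruct (IH z r Hz w) as (p' & Gp' & F); [now apply (name_opair y w s)|congruence|].
  destruct (generic_dir p p' Gp Gp') as (q1 & Gq1 & L1 & L2).
  destruct (generic_dir q1 r Gq1 Gr') as (q & Gq & L3 & L4).
  apply (N q (generic_cond q Gq)) with z r; trivial; [eapply subset_trans; eauto|].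
  apply (force_eq_mono p'); trivial; [now apply generic_cond|eapply subset_trans; eauto].
Qed.

Lemma force_mem_truth x y : is_name x -> is_name y ->
  set_mem (val x) (val y) <-> exists p, G p /\ force_mem p x y.
Proof.
intros Hx Hy; split.
- intros H; apply in_val in H as (w & s & Hw & Gs & E).
  destruct (force_eq_complete x Hx w) as (p & Gp & H); [now apply (name_opair y w s)|trivial|].
  destruct (generic_dir p s Gp Gs) as (q & Gq & L & Ls); exists q; split; [trivial|].
  intros r Hr Lr; exists r; split; [trivial|split; [apply subset_refl|]].
  exists w, s; split; [trivial|split; [eapply subset_trans; eauto|]].
  apply (force_eq_mono p); trivial; eapply subset_trans; eauto.
- intros (p & Gp & H).
  destruct (generic_meets p (fun q => exists w s, opair w s ∈ y /\ s ⊆ q /\ force_eq q x w)) as (q & Gq & w & s & Hw & Ls & HE);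
    [dp|trivial|exact H|].
  destruct (name_opair y w s Hy Hw) as [Nw Hs].
  rewrite (force_eq_sound x Hx q w); trivial; apply (opair_val w s); trivial; now apply (generic_up s q).
Qed.

Local Notation N := (sym_ext (mem:=mem) mem_wf G).

Lemma sym_ext_eq (a b : N) : proj1_sig a = proj1_sig b -> a = b.
Proof. apply eq_sig_hprop; intros; apply proof_irrelevance. Qed.

Definition point (x : T) (H : HS x) : N := exist _ (val x) (ex_intro _ x (conj H eq_refl)).

Lemma has_name (a : N) : exists x, HS x /\ proj1_sig a = val x.
Proof. destruct a as [s Hs]; exact Hs. Qed.

(** For implications and quantifiers genericity is applied to [A] or [B]: conditions forcing the
    formula, and conditions with a counterexample that persists under all extensions. *)
Lemma truth phi : forall (e : nat -> T) (e' : nat -> N), (forall n, HS (e n)) ->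
  (forall n, proj1_sig (e' n) = val (e n)) ->
  sat (sym_ext_mem mem_wf G) phi e' <-> exists p, G p /\ force phi p e.
Proof.
induction phi as [i j|i j| |phi IH1 psi IH2|phi IH]; intros e e' He Ee; simpl.
- unfold sym_ext_mem; rewrite !Ee; apply force_mem_truth; now apply HS_name.
- split.
  + intros E; apply force_eq_complete; try now apply HS_name.
    now rewrite <- !Ee, E.
  + intros (p & Gp & H); apply sym_ext_eq; rewrite !Ee.
    apply (force_eq_sound _ (HS_name _ (He i)) p); trivial; now apply HS_name.
- split; [easy|intros (p & _ & H); exact H].
- rewrite (IH1 e e' He Ee), (IH2 e e' He Ee); split.
  + intros H.
    set (A := fun p => forall q, cond q -> p ⊆ q -> force phi q e -> force psi q e).
    set (B := fun p => force phi p e /\ forall q, cond q -> p ⊆ q -> ~ force psi q e).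
    assert (DF1 : forall phi, D1 (fun p => force phi p e)).
    { intros ph t Ht; apply (DP_force ph t (fun n _ => e n)); [trivial|intros n; apply DF_const]. }
    assert (DA : D1 A).
    { intros t Ht; unfold A; dp_step; repeat (apply DP_imp; [solve [dp]|]).
      apply DP_imp; [apply (DF1 phi)|apply (DF1 psi)]; dp. }
    assert (DB : D1 B).
    { intros t Ht; unfold B; apply DP_and; [now apply (DF1 phi)|].
      dp_step; repeat (apply DP_imp; [solve [dp]|]); apply DP_not, (DF1 psi); dp. }
    destruct (generic_meets empty (fun p => A p \/ B p)) as (p & Gp & [HA|[H1 H2]]).
    * dp.
    * exact generic_empty.
    * intros p Hp _; destruct (classic (A p)) as [Ap|Ap]; [exists p; split; [trivial|split; [apply subset_refl|auto]]|].
      apply not_all_ex_not in Ap as [q Ap]; apply imply_to_and in Ap as [Hq Ap].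
      apply imply_to_and in Ap as [L Ap]; apply imply_to_and in Ap as [F Ap].
      destruct (not_force psi q e Hq Ap) as (r & Hr & L' & K).
      exists r; split; [trivial|split; [eapply subset_trans; eauto|right; split; [|trivial]]].
      now apply (force_mono _ q).
    * exists p; auto.
    * exfalso; destruct H as (q & Gq & F); [eauto|].
      destruct (generic_dir p q Gp Gq) as (r & Gr' & L & L').
      apply (H2 r); trivial; [now apply generic_cond|].
      apply (force_mono _ q); trivial; now apply generic_cond.
  + intros (p & Gp & H) (q & Gq & K).
    destruct (generic_dir p q Gp Gq) as (r & Gr' & L & L').
    exists r; split; [trivial|]; apply H; trivial; [now apply generic_cond|].
    apply (force_mono _ q); trivial; now apply generic_cond.
- assert (Hs : forall x, HS x -> forall n, HS (scons x e n)) by (intros x Hx [|n]; simpl; auto).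
  assert (Es : forall a x, proj1_sig a = val x -> forall n, proj1_sig (scons a e' n) = val (scons x e n)).
  { intros a x E [|n]; simpl; auto. }
  split.
  + intros H.
    set (A := fun p => forall x, HS x -> force phi p (scons x e)).
    set (B := fun p => exists x, HS x /\ forall q, cond q -> p ⊆ q -> ~ force phi q (scons x e)).
    assert (DF2 : D2 (fun p x => force phi p (scons x e))).
    { intros t s Ht Hss.
      apply (DP_force phi t (fun n env => scons (s env) e n)); [trivial|].
      intros [|n]; [exact Hss|exact (DF_const (e n))]. }
    assert (DA : D1 A).
    { intros t Ht; unfold A; dp_step; apply DP_imp; [solve [dp]|].
      apply (DF2 (fun e => t (fun n => e (S n))) (fun e => e 0)); dp. }
    assert (DB : D1 B).
    { intros t Ht; unfold B; dp_step; apply DP_and; [solve [dp]|].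
      dp_step; repeat (apply DP_imp; [solve [dp]|]).
      apply DP_not, (DF2 (fun e => e 0) (fun e => e 1)); dp. }
    destruct (generic_meets empty (fun p => A p \/ B p)) as (p & Gp & [HA|(x & Hx & H2)]).
    * dp.
    * exact generic_empty.
    * intros p Hp _; destruct (classic (A p)) as [Ap|Ap]; [exists p; split; [trivial|split; [apply subset_refl|auto]]|].
      apply not_all_ex_not in Ap as [x Ap]; apply imply_to_and in Ap as [Hx Ap].
      destruct (not_force phi p _ Hp Ap) as (r & Hr & L' & K).
      exists r; split; [trivial|split; [trivial|right; exists x; auto]].
    * exists p; auto.
    * exfalso; destruct (proj1 (IH (scons x e) (scons (point x Hx) e') (Hs x Hx) (Es (point x Hx) x eq_refl)) (H _))
        as (q & Gq & F).
      destruct (generic_dir p q Gp Gq) as (r & Gr' & L & L').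
      apply (H2 r); trivial; [now apply generic_cond|].
      apply (force_mono _ q); trivial; now apply generic_cond.
  + intros (p & Gp & H) a; destruct (has_name a) as (x & Hx & E).
    apply (IH (scons x e)); auto; exists p; split; [trivial|now apply H].
Qed.

End Truth.

(** * The axioms of ZF in the extension *)

Section CheckNames.
Context {T : Type} {St : struct T} {M : model T St} {Gr : ground T St M}.
Local Notation HS := (HS mem mem_wf).

Definition check_step (_ x g : T) : T := rep x (fun u => opair (ap g u) empty).
Lemma F3_check_step : F3 check_step. Proof. dpu check_step. Qed.
Definition check (x : T) : T := rec check_step empty x.
Lemma F1_check : F1 check. Proof. apply F1_rec, F3_check_step. Qed.
#[local] Hint Resolve F1_check : dp.

Lemma in_check z x : z ∈ check x <-> exists u, u ∈ x /\ z = opair (check u) empty.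
Proof.
unfold check at 1; rewrite rec_eq by apply F3_check_step.
unfold check_step at 1; rewrite in_rep by dp; split; intros (u & Hu & ->); exists u; (split; [trivial|]);
  (rewrite ap_rec; [trivial|apply F3_check_step|now apply sub_tc]).
Qed.

Definition dom (x : T) : T := rep x fst.
Lemma F1_dom : F1 dom. Proof. dpu dom. Qed.
#[local] Hint Resolve F1_dom : dp.

Lemma in_dom z x : HS x -> z ∈ dom x <-> exists p, opair z p ∈ x.
Proof.
intros Hx; unfold dom; rewrite in_rep by dp; split.
- intros (u & Hu & ->); destruct (HS_elem x u Hx Hu) as (y & p & -> & _); rewrite fst_opair; eauto.
- intros (p & Hp); exists (opair z p); now rewrite fst_opair.
Qed.

Lemma HS_dom z x : HS x -> z ∈ dom x -> HS z.
Proof. intros Hx Hz; apply in_dom in Hz as [p Hz]; [|trivial]; now apply (HS_opair x z p). Qed.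

Definition invariant (E A : T) := forall pi, perm mem pi -> fixes pi E ->
  forall z, z ∈ A -> act pi z ∈ A.

Lemma dom_invariant E x : HS x -> supports E x -> invariant E (dom x).
Proof.
intros Hx (_ & _ & HE) pi Hpi Hf z Hz; apply in_dom in Hz as [p Hz]; trivial.
apply in_dom; [trivial|]; exists (actc pi p); rewrite <- (HE pi Hpi Hf); now apply opair_in_act; [apply HS_name|].
Qed.

Lemma countable_empty : countable mem empty.
Proof. apply finite_countable, finite_empty. Qed.

Lemma empty_sub x : empty ⊆ x.
Proof. intros z Hz; now apply in_empty in Hz. Qed.

Lemma supports_countable E x : supports E x -> E ⊆ omega1 /\ countable mem E.
Proof. intros (? & ? & _); auto. Qed.

Lemma common_support (e : nat -> T) k : (forall n, HS (e n)) ->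
  exists E, E ⊆ omega1 /\ countable mem E /\ forall n, n < k -> supports E (e n).
Proof.
intros He; induction k as [|k (E & H1 & H2 & H3)].
- exists empty; split; [apply empty_sub|split; [apply countable_empty|lia]].
- destruct (HS_supports (e k) (He k)) as [E' HE'].
  destruct (supports_countable _ _ HE') as [K1 K2].
  assert (S1 : cup E E' ⊆ omega1) by (intros a Ha; apply in_cup in Ha as [Ha|Ha]; auto).
  assert (S2 : countable mem (cup E E')) by now apply countable_cup.
  exists (cup E E'); split; [trivial|split; [trivial|]]; intros n Hn.
  destruct (Nat.eq_dec n k) as [->|Ne].
  + apply (supports_sub E'); trivial; intros a Ha; apply in_cup; auto.
  + apply (supports_sub E); [intros a Ha; apply in_cup; auto|trivial|trivial|apply H3; lia].
Qed.

Definition sep_name (A : T) (Q : T -> T -> Prop) : T := sep (prod A conds) (fun u => Q (snd u) (fst u)).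

Lemma opair_in_sep_name A Q z p : D2 Q -> opair z p ∈ sep_name A Q <-> z ∈ A /\ cond mem p /\ Q p z.
Proof.
intros DQ; unfold sep_name; rewrite in_sep by dp.
rewrite opair_in_prod, in_conds, fst_opair, snd_opair; tauto.
Qed.

Lemma HS_sep_name A Q E : D2 Q -> (forall z, z ∈ A -> HS z) -> E ⊆ omega1 -> countable mem E ->
  invariant E A ->
  (forall pi p z, perm mem pi -> fixes pi E -> cond mem p -> z ∈ A -> Q p z -> Q (actc pi p) (act pi z)) ->
  HS (sep_name A Q).
Proof.
intros DQ HA H1 H2 IA IQ.
assert (K : forall u, u ∈ sep_name A Q -> exists y p, u = opair y p /\ HS y /\ cond mem p).
{ intros u Hu; unfold sep_name in Hu; apply in_sep in Hu as [Hu _]; [|dp].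
  apply in_prod in Hu as (y & p & Hy & Hp & ->); apply in_conds in Hp; eauto 6. }
apply HS_make; [trivial|]; exists E; apply supports_make; trivial.
- apply name_make; intros z Hz; destruct (K z Hz) as (y & p & -> & Hy & Hp); exists y, p; auto.
- intros pi Hpi Hf y p Hy; apply opair_in_sep_name in Hy as (Hy & Hp & HQ); [|trivial].
  apply opair_in_sep_name; auto.
Qed.

Lemma is_name_check x : is_name mem (check x).
Proof.
induction (mem_wf x) as [x _ IH]; apply name_make; intros z Hz.
apply in_check in Hz as (u & Hu & ->); exists (check u), empty.
split; [trivial|split; [auto|apply cond_empty]].
Qed.

(** Only the empty condition occurs in a canonical name, and every permutation fixes it. *)
Lemma act_check pi x : act pi (check x) = check x.
Proof.
induction (mem_wf x) as [x _ IH].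
apply ext; intros z; rewrite in_act by apply is_name_check; split.
- intros (y & p & H & ->); apply in_check in H as (u & Hu & E); apply opair_inj in E as [-> ->].
  rewrite actc_empty, IH by trivial; apply in_check; eauto.
- intros H; apply in_check in H as (u & Hu & ->); exists (check u), empty.
  rewrite actc_empty, IH by trivial; split; [apply in_check; eauto|trivial].
Qed.

Lemma HS_check x : HS (check x).
Proof.
induction (mem_wf x) as [x _ IH]; apply HS_make.
- intros z Hz; apply in_check in Hz as (u & Hu & ->); exists (check u), empty; split; [trivial|split; [auto|apply cond_empty]].
- exists empty; split; [apply empty_sub|split; [apply countable_empty|]]; intros; apply act_check.
Qed.

End CheckNames.
#[export] Hint Resolve F1_check F1_dom : dp.

(** * Verification of the axioms of ZF *)

Section Extension.
Context {T : Type} {St : struct T} {M : model T St} {Gr : ground T St M}.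
Local Notation HS := (HS mem mem_wf).
Local Notation cond := (cond mem).
Variable G : T -> Prop.
Hypothesis HG : generic mem G.
Local Notation val := (value mem_wf G).
Local Notation N := (sym_ext (mem:=mem) mem_wf G).
#[local] Instance ext_struct : struct N := sym_ext_mem mem_wf G.
Local Notation nmem := (sym_ext_mem mem_wf G).
Local Notation point := (point G).

Lemma below (s : Defs.set) x : HS x -> set_mem s (val x) ->
  exists z r (Hz : HS z), opair z r ∈ x /\ G r /\ s = proj1_sig (point z Hz).
Proof.
intros Hx H; apply in_val in H as (z & r & Hz & Gr' & ->).
exists z, r, (proj1 (HS_opair x z r Hx Hz)); auto.
Qed.

Lemma ext_extensionality (x y : N) : (forall z : N, nmem z x <-> nmem z y) -> x = y.
Proof.
intros H; apply sym_ext_eq, set_ext; intros s.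
destruct (has_name G x) as (x' & Hx & Ex), (has_name G y) as (y' & Hy & Ey).
split; intros K.
- rewrite Ex in K; destruct (below s x' Hx K) as (z & r & Hz & _ & _ & E).
  rewrite <- Ex in K; rewrite E in *; now apply (H (point z Hz)).
- rewrite Ey in K; destruct (below s y' Hy K) as (z & r & Hz & _ & _ & E).
  rewrite <- Ey in K; rewrite E in *; now apply (H (point z Hz)).
Qed.

Lemma ext_wf : well_founded nmem.
Proof.
intros [s Hs]; revert Hs; induction (set_mem_wf s) as [s _ IH]; intros Hs; constructor.
intros [t Ht] H; now apply IH.
Qed.

Lemma ext_sep_name A Q E : D2 Q -> (forall z, z ∈ A -> HS z) -> E ⊆ omega1 -> countable mem E ->
  invariant E A ->
  (forall pi p z, perm mem pi -> fixes pi E -> cond p -> z ∈ A -> Q p z -> Q (actc pi p) (act pi z)) ->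
  exists b : N, forall s : N, nmem s b <-> exists z p, z ∈ A /\ G p /\ Q p z /\ proj1_sig s = val z.
Proof.
intros DQ HA H1 H2 IA IQ.
exists (point _ (HS_sep_name A Q E DQ HA H1 H2 IA IQ)); intros s.
unfold sym_ext_mem; simpl; rewrite in_val; split.
- intros (z & p & H & Gp & Es); apply opair_in_sep_name in H as (Hz & _ & HQ); eauto 7.
- intros (z & p & Hz & Gp & HQ & Es); exists z, p; split; [|auto].
  apply opair_in_sep_name; auto; split; [trivial|split; [now apply (generic_cond G HG)|trivial]].
Qed.

Lemma ext_collect A E : (forall z, z ∈ A -> HS z) -> E ⊆ omega1 -> countable mem E ->
  invariant E A -> exists b : N, forall s : N, nmem s b <-> exists z, z ∈ A /\ proj1_sig s = val z.
Proof.
intros HA H1 H2 IA.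
destruct (ext_sep_name A (fun _ _ => True) E) as [b Hb]; trivial; [dp|].
exists b; intros s; rewrite Hb; split.
- intros (z & p & Hz & _ & _ & Es); eauto.
- intros (z & Hz & Es); exists z, empty; split; [trivial|split; [exact (generic_empty G HG)|auto]].
Qed.

(** The names are chosen in Rocq; the resulting sequence need not belong to [V]. *)
Lemma env_names (e' : nat -> N) : exists e : nat -> T, (forall n, HS (e n)) /\ forall n, proj1_sig (e' n) = val (e n).
Proof.
exists (fun n => proj1_sig (constructive_indefinite_description _ (has_name G (e' n)))).
split; intros n; now destruct (constructive_indefinite_description _ (has_name G (e' n))).
Qed.

Lemma scons_HS x e : HS x -> (forall n, HS (e n)) -> forall n, HS (scons x e n).
Proof. intros Hx He [|n]; simpl; auto. Qed.

Lemma scons_val (a : N) x (e' : nat -> N) e : proj1_sig a = val x -> (forall n, proj1_sig (e' n) = val (e n)) ->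
  forall n, proj1_sig (scons a e' n) = val (scons x e n).
Proof. intros Hx He [|n]; simpl; auto. Qed.

(** Only finitely many of the parameters matter, so that they have a common
    support. *)
Lemma finite_environment phi (e : nat -> T) x : (forall n, HS (e n)) -> HS x ->
  exists e2 E, (forall n, HS (e2 n)) /\ E ⊆ omega1 /\ countable mem E /\
    (forall n, supports E (e2 n)) /\ supports E x /\
    forall z y p, (force phi p (scons z e) <-> force phi p (scons z e2)) /\
      (force phi p (scons z (scons y e)) <-> force phi p (scons z (scons y e2))).
Proof.
intros He Hx; destruct (force_bound phi) as [k Hk].
destruct (common_support (scons x e) (S k)) as (E & H1 & H2 & H3); [now apply scons_HS|].
(* Entries beyond the bound are reset to [x], so that [E] supports all of them. *)
exists (fun n => if n <? k then e n else x), E.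
split; [intros n; destruct (n <? k); auto|].
split; [trivial|split; [trivial|split; [|split]]].
- intros n; destruct (Nat.ltb_spec n k); [apply (H3 (S n)); lia|apply (H3 0); lia].
- apply (H3 0); lia.
- intros z y p; split; split; apply Hk; intros [|[|n]] Hn; simpl; trivial;
    match goal with |- context [?a <? ?b] => destruct (Nat.ltb_spec a b); [trivial|lia] end.
Qed.

Lemma force_fixes phi pi p E z e : perm mem pi -> fixes pi E -> cond p -> HS z ->
  (forall n, HS (e n)) -> (forall n, supports E (e n)) ->
  force phi p (scons z e) -> force phi (actc pi p) (scons (act pi z) e).
Proof.
intros Hpi Hf Hp Hz He HE H.
replace (scons (act pi z) e) with (fun n => act pi (scons z e n)).
- apply force_act; trivial; now apply scons_HS.
- extensionality n; destruct n as [|n]; simpl; [trivial|]; now apply (HE n).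
Qed.

Lemma ext_separation phi (e' : nat -> N) (a : N) :
  exists b : N, forall x : N, nmem x b <-> nmem x a /\ sat nmem phi (scons x e').
Proof.
destruct (env_names e') as (e & He & Ee), (has_name G a) as (x & Hx & Ex).
destruct (finite_environment phi e x He Hx) as (e2 & E & He2 & H1 & H2 & H3 & HEx & H4).
(* Membership in the given set is forced along with the formula, since a name in [dom x] names a
   member only if a suitable condition is in [G]. *)
destruct (ext_sep_name (dom x) (fun p z => force phi p (scons z e2) /\ force_mem p z x) E) as [b Hb]; trivial.
- intros t s Ht Hs; apply DP_and; [|apply (D3_force_mem t s (fun _ => x)); dp].
  apply (DP_force phi t (fun n env => scons (s env) e2 n)); [trivial|].
  intros [|n]; [exact Hs|exact (DF_const (e2 n))].
- intros z; now apply HS_dom.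
- now apply dom_invariant.
- intros pi p z Hpi Hf Hp Hz [K1 K2]; pose proof (HS_dom z x Hx Hz) as Nz; split.
  + now apply (force_fixes phi pi p E z e2).
  + rewrite <- (proj2 (proj2 HEx) pi Hpi Hf) at 1; apply force_mem_act; auto.
- exists b; intros s; rewrite Hb; split.
  + intros (z & p & Hz & Gp & [F1 F2] & Es); pose proof (HS_dom z x Hx Hz) as Nz; split.
    * unfold sym_ext_mem; rewrite Es, Ex; apply (force_mem_truth G HG); auto; now exists p.
    * apply (truth G HG phi (scons z e)); [now apply scons_HS|now apply scons_val|].
      exists p; split; [trivial|]; now apply (H4 z x p).
  + intros [K1 K2]; unfold sym_ext_mem in K1; rewrite Ex in K1.
    destruct (below _ x Hx K1) as (z & r & Hz & Hzx & Gr' & Es); simpl in Es; rewrite Es in K1.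
    apply (force_mem_truth G HG) in K1 as (p & Gp & F1); auto.
    apply (truth G HG phi (scons z e)) in K2 as (q & Gq & F2);
      [|now apply scons_HS|now apply scons_val].
    destruct (generic_dir G HG p q Gp Gq) as (u & Gu & L & L').
    exists z, u; split; [apply in_dom; eauto|split; [trivial|split; [split|trivial]]].
    * apply (H4 z x u); apply (force_mono phi q); trivial; now apply (generic_cond G HG).
    * now apply (densely_mono p).
Qed.

(** The general [separation] is stated for models of ZF, which the extension is not yet known to
    be. *)
Lemma ext_separation_class (P : N -> Prop) : D1 P -> forall a, exists b : N, forall x, nmem x b <-> nmem x a /\ P x.
Proof.
intros H a; destruct (DP_peel _ (H _ (DF_var 0))) as (phi & f & K).
destruct (ext_separation phi (fun n => place (fun _ => a) (f n)) a) as [b Hb].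
exists b; intros x; rewrite Hb; now rewrite <- (K x (fun _ => a)).
Qed.

Lemma ext_pairing (x y : N) : exists z, is_upair nmem z x y.
Proof.
destruct (has_name G x) as (x' & Hx & Ex), (has_name G y) as (y' & Hy & Ey).
destruct (common_support (scons x' (fun _ => y')) 2) as (E & H1 & H2 & H3); [now apply scons_HS|].
destruct (ext_collect (pair x' y') E) as [b Hb]; trivial.
- intros z Hz; apply in_pair in Hz as [-> | ->]; trivial.
- intros pi Hpi Hf z Hz; apply in_pair in Hz; apply in_pair.
  destruct Hz as [-> | ->]; [left; apply (H3 0)|right; apply (H3 1)]; trivial; lia.
- exists b; intros s; rewrite Hb; split.
  + intros (z & Hz & Es); apply in_pair in Hz as [-> | ->]; [left|right]; apply sym_ext_eq; congruence.
  + intros [-> | ->]; [exists x'|exists y']; rewrite in_pair; auto.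
Qed.

Lemma ext_union (x : N) : exists u : N, forall z : N, nmem z u <-> exists y, nmem z y /\ nmem y x.
Proof.
destruct (has_name G x) as (x' & Hx & Ex).
destruct (HS_supports x' Hx) as [E HE]; destruct (supports_countable _ _ HE) as [H1 H2].
assert (K : forall z, z ∈ union (rep (dom x') dom) <-> exists y, y ∈ dom x' /\ z ∈ dom y).
{ intros z; rewrite in_union; split.
  - intros (w & Hz & Hw); apply in_rep in Hw as (y & Hy & ->); [eauto|dp].
  - intros (y & Hy & Hz); exists (dom y); split; [trivial|]; apply in_rep; [dp|eauto]. }
destruct (ext_collect (union (rep (dom x') dom)) E) as [c Hc]; trivial.
- intros z Hz; apply K in Hz as (y & Hy & Hz); apply (HS_dom z y); [now apply (HS_dom y x')|trivial].
- intros pi Hpi Hf z Hz; apply K in Hz as (y & Hy & Hz); apply K; exists (act pi y).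
  pose proof (HS_dom y x' Hx Hy) as Ny; split; [now apply (dom_invariant E x')|].
  apply in_dom in Hz as [p Hz]; trivial; apply in_dom; [now apply HS_act|].
  exists (actc pi p); apply opair_in_act; auto.
- destruct (ext_separation_class (fun z => exists y, z ∈ y /\ y ∈ x) ltac:(dp) c) as [b Hb].
  exists b; intros z; rewrite (Hb z); split; [intros [_ H]; exact H|intros (y & Hz & Hy); split; [|eauto]].
  apply Hc; change (set_mem (proj1_sig z) (proj1_sig y)) in Hz.
  change (set_mem (proj1_sig y) (proj1_sig x)) in Hy; rewrite Ex in Hy.
  destruct (below _ x' Hx Hy) as (y' & r & Hy' & Hyx & _ & Ey); simpl in Ey; rewrite Ey in Hz.
  destruct (below _ y' Hy' Hz) as (z' & r' & Hz' & Hzy & _ & Ez); simpl in Ez.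
  exists z'; split; [|trivial]; apply K; exists y'; split; apply in_dom; eauto.
Qed.

Lemma ext_power (x : N) : exists p : N, forall z : N, nmem z p <-> subset nmem z x.
Proof.
destruct (has_name G x) as (x' & Hx & Ex); destruct (HS_supports x' Hx) as [E HE].
destruct (supports_countable _ _ HE) as [H1 H2].
assert (K : forall b, b ∈ sep (power (prod (dom x') conds)) HS <-> b ⊆ prod (dom x') conds /\ HS b).
{ intros b; rewrite in_sep by dp; now rewrite in_power. }
destruct (ext_collect (sep (power (prod (dom x') conds)) HS) E) as [c Hc]; trivial.
- intros z Hz; now apply K in Hz.
- intros pi Hpi Hf z Hz; apply K in Hz as [Hz Nz]; apply K; split; [|now apply HS_act].
  intros u Hu; apply in_act in Hu as (y & p & Hu & ->); auto.
  apply Hz in Hu; apply opair_in_prod in Hu as [Hy Hp]; apply opair_in_prod.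
  split; [now apply (dom_invariant E x')|]; apply in_conds in Hp; apply in_conds; auto.
- destruct (ext_separation_class (fun z => subset mem z x) ltac:(dp) c) as [b Hb].
  exists b; intros y; rewrite (Hb y); split; [intros [_ H]; exact H|intros Hy; split; [|exact Hy]].
  destruct (has_name G y) as (y' & Ny & Ey); destruct (HS_supports y' Ny) as [E' HE'].
  destruct (supports_countable _ _ HE') as [K1 K2].
  assert (H3 : cup E E' ⊆ omega1) by (intros a Ha; apply in_cup in Ha as [Ha|Ha]; auto).
  assert (H4 : countable mem (cup E E')) by now apply countable_cup.
  assert (SE : supports (cup E E') x') by (apply (supports_sub E); trivial; intros a Ha; apply in_cup; auto).
  assert (SE' : supports (cup E E') y') by (apply (supports_sub E'); trivial; intros a Ha; apply in_cup; auto).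
  assert (DQ : D2 (fun p z => force_mem p z y')) by (intros t s Ht Hs; apply (D3_force_mem t s (fun _ => y')); dp).
  assert (HB : HS (sep_name (dom x') (fun p z => force_mem p z y'))).
  { apply (HS_sep_name _ _ (cup E E')); trivial.
    - intros z Hz; now apply (HS_dom z x').
    - now apply dom_invariant.
    - intros pi p z Hpi Hf Hp Hz F; rewrite <- (proj2 (proj2 SE') pi Hpi Hf).
      apply force_mem_act; auto; apply HS_name; now apply (HS_dom z x'). }
  (* The name [y'] may have constituents outside [dom x']. This one has the same value, because [y]
     is a subset of [x], and it belongs to the set of names fixed above. *)
  apply Hc; exists (sep_name (dom x') (fun p z => force_mem p z y')); split.
  + apply K; split; [|trivial]; intros u Hu; unfold sep_name in Hu; apply in_sep in Hu; [tauto|dp].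
  + apply set_ext; intros s; split.
    * intros Hs; assert (Hs' := Hs); rewrite Ey in Hs'.
      destruct (below s y' Ny Hs') as (z & r & Nz & Hz & Gr' & ->).
      specialize (Hy (point z Nz) Hs); change (set_mem (val z) (proj1_sig x)) in Hy; rewrite Ex in Hy.
      destruct (below _ x' Hx Hy) as (w & r' & Nw & Hw & _ & Ew).
      change (proj1_sig (point z Nz)) with (val z) in *; change (proj1_sig (point w Nw)) with (val w) in *.
      rewrite Ew in *.
      apply (force_mem_truth G HG) in Hs' as (p & Gp & F); auto.
      apply in_val; exists w, p; split; [|auto]; apply opair_in_sep_name; [trivial|].
      split; [apply in_dom; eauto|split; [now apply (generic_cond G HG)|trivial]].
    * intros Hs; apply in_val in Hs as (z & p & Hz & Gp & ->).
      apply opair_in_sep_name in Hz as (Hz & Hp & F); [|trivial].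
      rewrite Ey; apply (force_mem_truth G HG); auto; [apply HS_name; now apply (HS_dom z x')|eauto].
Qed.

Lemma in_val_check s x : set_mem s (val (check x)) <-> exists u, u ∈ x /\ s = val (check u).
Proof.
rewrite in_val; split.
- intros (y & p & H & _ & ->); apply in_check in H as (u & Hu & E); apply opair_inj in E as [-> _]; eauto.
- intros (u & Hu & ->); exists (check u), empty; split; [apply in_check; eauto|split; [exact (generic_empty G HG)|trivial]].
Qed.

Lemma ext_infinity : exists w, inductive nmem w.
Proof.
exists (point (check omega) (HS_check omega)); split.
- exists (point (check empty) (HS_check empty)); split.
  + intros z H; apply in_val_check in H as (u & Hu & _); now apply in_empty in Hu.
  + apply in_val_check; exists empty; split; [apply omega_0|trivial].
- intros x H; apply in_val_check in H as (u & Hu & E).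
  exists (point (check (succ u)) (HS_check (succ u))); split.
  + intros w; unfold sym_ext_mem; simpl; rewrite E, !in_val_check; split.
    * intros (v & Hv & Ew); apply in_succ in Hv as [Hv| ->]; [left; eauto|right; apply sym_ext_eq; congruence].
    * intros [(v & Hv & Ew)| ->]; [exists v|exists u]; rewrite in_succ; auto.
  + apply in_val_check; exists (succ u); split; [now apply omega_succ|trivial].
Qed.

Lemma ext_foundation (x : N) : (exists y, nmem y x) -> exists y, nmem y x /\ forall z, nmem z y -> ~ nmem z x.
Proof.
intros [y Hy]; induction (ext_wf y) as [y _ IH].
destruct (classic (exists z, nmem z y /\ nmem z x)) as [(z & Hz & K)|H]; [eauto|].
exists y; split; [trivial|]; intros z Hz K; eauto.
Qed.

Lemma ext_replacement phi (e' : nat -> N) (a : N) :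
  (forall x y y', nmem x a -> sat nmem phi (scons x (scons y e')) ->
     sat nmem phi (scons x (scons y' e')) -> y = y') ->
  exists b : N, forall y, nmem y b <-> exists x, nmem x a /\ sat nmem phi (scons x (scons y e')).
Proof.
intros Hfun.
destruct (env_names e') as (e & He & Ee), (has_name G a) as (x & Hx & Ex).
(* Collection is indexed by pairs [u] of a name and a condition, since the model can search for a
   result only under a condition forcing it. *)
set (Q := fun u y => HS y /\ force phi (snd u) (scons (fst u) (scons y e))).
assert (DQ : D2 Q).
{ intros t s Ht Hs; unfold Q; apply DP_and; [dp|].
  apply (DP_force phi (fun e => snd (t e)) (fun n env => scons (fst (t env)) (scons (s env) e) n)); [dp|].
  intros [|[|n]]; [cbn; dp|exact Hs|exact (DF_const (e n))]. }
(* The second alternative makes the relation total, as [collection] requires. *)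
destruct (collection (fun u y => Q u y \/ forall y, ~ Q u y) (prod (dom x) conds)) as [B HB].
{ dp. }
{ intros u _; destruct (classic (exists y, Q u y)) as [[y Hy]|H]; [eauto|].
  exists x; right; intros y Hy; eauto. }
(* The collected names may have unrelated supports; closing under all permutations makes the set
   invariant with empty support. *)
assert (K : forall y, y ∈ rep (prod perms (sep B HS)) (fun u => act (fst u) (snd u)) <->
  exists pi y0, perm mem pi /\ y0 ∈ B /\ HS y0 /\ y = act pi y0).
{ intros y; rewrite in_rep by dp; split.
  - intros (u & Hu & ->); apply in_prod in Hu as (pi & y0 & Hpi & Hy0 & ->).
    apply in_perms in Hpi; apply in_sep in Hy0; [|dp]; rewrite fst_opair, snd_opair.
    exists pi, y0; tauto.
  - intros (pi & y0 & Hpi & Hy0 & Ny & ->); exists (opair pi y0); rewrite opair_in_prod, in_perms, in_sep by dp.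
    now rewrite fst_opair, snd_opair. }
destruct (ext_collect (rep (prod perms (sep B HS)) (fun u => act (fst u) (snd u))) empty) as [c Hc].
- intros z Hz; apply K in Hz as (pi & y0 & Hpi & _ & Ny & ->); auto.
- apply empty_sub.
- apply countable_empty.
- intros pi Hpi _ z Hz; apply K in Hz as (sigma & y0 & Hs & Hy0 & Ny & ->); apply K.
  exists (pcomp pi sigma), y0; split; [auto|split; [trivial|split; [trivial|]]]; symmetry; apply act_pcomp; auto.
- assert (DS : D1 (fun y => exists x, x ∈ a /\ sat mem phi (scons x (scons y e')))).
  { apply D1_intro; dp_step; apply DP_and; [dp|].
    refine (DP_ext _ _ (DP_sub (sat mem phi) (fun n => match n with 0 => inl 0 | 1 => inl 1 | S (S n) => inr (e' n) end)
      (DP_sat phi)) _).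
    intros env; apply sat_ext; now intros [|[|n]]. }
  destruct (ext_separation_class _ DS c) as [b Hb].
  exists b; intros y; rewrite (Hb y); split; [intros [_ H]; exact H|intros (s & Hs & H); split; [|exists s; auto]].
  assert (Hs' := Hs); unfold sym_ext_mem in Hs'; rewrite Ex in Hs'.
  destruct (below _ x Hx Hs') as (z & r & Nz & Hz & _ & Es); simpl in Es.
  destruct (has_name G y) as (y' & Ny & Ey).
  assert (H' := H).
  apply (truth G HG phi (scons z (scons y' e))) in H' as (p & Gp & F);
    [|now repeat apply scons_HS|now repeat apply scons_val].
  destruct (HB (opair z p)) as (y0 & Hy0 & [[Ny0 HQ]|HQ]).
  + apply opair_in_prod; split; [apply in_dom; eauto|]; now apply in_conds, (generic_cond G HG).
  + rewrite fst_opair, snd_opair in HQ.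
    (* The collected name need not be the given [y'], but both are results for [s], so functionality
       identifies their values. *)
    assert (y = point y0 Ny0) as ->.
    { apply (Hfun s); trivial; apply (truth G HG phi (scons z (scons y0 e)));
        [now repeat apply scons_HS|now repeat apply scons_val|eauto]. }
    apply Hc; exists y0; split; [|trivial]; apply K; exists pid, y0; rewrite act_pid by auto.
    split; [apply perm_pid|auto].
  + destruct (HQ y'); split; [trivial|]; now rewrite fst_opair, snd_opair.
Qed.

Lemma ext_ZF : ZF nmem.
Proof.
split.
- exact ext_extensionality.
- exact ext_foundation.
- exact ext_pairing.
- exact ext_union.
- exact ext_power.
- exact ext_infinity.
- exact ext_separation.
- exact ext_replacement.
Qed.

End Extension.

(** * Dependent choice in the extension *)

(** To be applied inside the extension. [W] attaches indices linearly ordered by membership to some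
    elements of [A]; least indices exist since membership is well-founded, and iterating the
    successor of least index defines the sequence. *)
Lemma wellordered_DC {T : Type} {St : struct T} {M : model T St} (A R W a0 : T) :
  (forall l y l' y', opair l y ∈ W -> opair l' y' ∈ W -> l ∈ l' \/ l = l' \/ l' ∈ l) ->
  (forall l y y', opair l y ∈ W -> opair l y' ∈ W -> y = y') ->
  a0 ∈ A -> (exists l, opair l a0 ∈ W) ->
  (forall x, x ∈ A -> (exists l, opair l x ∈ W) ->
    exists y, y ∈ A /\ (exists l, opair l y ∈ W) /\ opair x y ∈ R) ->
  exists w f, is_omega mem w /\ maps mem f w A /\
    forall n m x y, n ∈ w -> is_succ mem m n -> app mem f n x -> app mem f m y -> app mem R x y.
Proof.
intros Hlin Hfun HA HW Hstep.
set (good := fun x l y => opair l y ∈ W /\ y ∈ A /\ opair x y ∈ R).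
set (best := fun x y => exists l, good x l y /\ forall l' y', good x l' y' -> l' ∉ l).
set (next := fun x => iota (best x)).
assert (Dn : F1 next) by (unfold next, best, good; dp).
assert (Hn : forall x, x ∈ A -> (exists l, opair l x ∈ W) -> best x (next x)).
{ intros x Hx Hl; unfold next; apply (iota_P (best x)).
  - destruct (Hstep x Hx Hl) as (y & Hy & (l & Hly) & HR).
    destruct (minimal (fun l => exists y, good x l y)) as (l1 & (y1 & Hg) & ml).
    { exists l, y; split; auto. }
    exists y1, l1; split; [trivial|]; intros l' y' Hg' Hl'; apply (ml l' Hl'); eauto.
  - intros y y' (l & Hg & ml) (l' & Hg' & ml'); pose proof Hg as (K & _); pose proof Hg' as (K' & _).
    destruct (Hlin l y l' y' K K') as [C|[C|C]].
    + now apply ml' in Hg.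
    + subst l'; now apply (Hfun l).
    + now apply ml in Hg'. }
set (F := nrec next a0).
assert (DF' : F1 F) by (intros t Ht; apply F2_nrec; [trivial|apply DF_const|trivial]).
assert (HF : forall n, n ∈ omega -> F n ∈ A /\ exists l, opair l (F n) ∈ W).
{ intros n Hn'; omega_induction n Hn'.
  - unfold F; rewrite nrec_0 by trivial; auto.
  - intros n Hn' [H1 H2]; unfold F; rewrite nrec_succ by trivial.
    destruct (Hn _ H1 H2) as (l & (K1 & K2 & _) & _); eauto. }
exists omega, (lam omega F); split; [now apply is_omegaE|split].
- apply maps_lam; [trivial|]; intros n Hn'; now apply HF.
- intros n m x y Hn' Hm Hx Hy; apply is_succE in Hm; subst m.
  apply appE, opair_in_lam in Hx as [_ ->]; trivial.
  apply appE, opair_in_lam in Hy as [_ ->]; trivial.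
  destruct (HF n Hn') as [H1 H2]; apply appE; unfold F at 2; rewrite nrec_succ by trivial.
  now destruct (Hn _ H1 H2) as (l & (_ & _ & K) & _).
Qed.

(** * Towers of countable supports and permutations moving into them *)

Section Towers.
Context {T : Type} {St : struct T} {M : model T St} {Gr : ground T St M}.

(** Exchanges [s] and [j s] for [s ∈ A], for an injection [j] of [A] into [B]. *)
Lemma swap A K B i : A ⊆ omega1 -> K ⊆ omega1 -> B ⊆ omega1 -> countable mem A ->
  (forall a, a ∈ A -> a ∉ K) -> (forall a, a ∈ A -> a ∉ B) -> (forall a, a ∈ B -> a ∉ K) ->
  F1 i -> (forall n, n ∈ omega -> i n ∈ B) ->
  (forall n m, n ∈ omega -> m ∈ omega -> i n = i m -> n = m) ->
  exists pi, perm mem pi /\ fixes pi K /\ forall a, a ∈ A -> ap pi a ∈ B.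
Proof.
intros HA HK HB CA AK AB BK Di Hi Inj.
apply countableE in CA as (F & DF & HF & IF).
set (j := fun a => i (F a)).
assert (Dj : F1 j) by (unfold j; dp).
assert (Hj : forall a, a ∈ A -> j a ∈ B) by (unfold j; auto).
assert (Ij : forall a b, a ∈ A -> b ∈ A -> j a = j b -> a = b) by (unfold j; auto).
set (h := fun x => ite (x ∈ A) (j x)
  (ite (exists s, s ∈ A /\ j s = x) (iota (fun s => s ∈ A /\ j s = x)) x)).
assert (Dh : F1 h) by (unfold h; dp).
assert (h1 : forall x, x ∈ A -> h x = j x) by (intros x Hx; unfold h; now rewrite ite_true).
assert (h2 : forall s, s ∈ A -> h (j s) = s).
{ intros s Hs; unfold h; rewrite ite_false by (intros C; apply (AB (j s)); auto).
  rewrite ite_true by eauto; apply iota_eq; [auto|]; intros t [Ht E]; auto. }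
assert (h3 : forall x, x ∉ A -> ~ (exists s, s ∈ A /\ j s = x) -> h x = x).
{ intros x N1 N2; unfold h; rewrite ite_false by trivial; now rewrite ite_false. }
assert (cases : forall x, x ∈ A \/ (exists s, s ∈ A /\ j s = x) \/
  (x ∉ A /\ ~ exists s, s ∈ A /\ j s = x)) by (intros x; tauto).
assert (P : perm mem (lam omega1 h)).
{ apply perm_involution; trivial; intros x Hx; destruct (cases x) as [C|[(s & Hs & <-)|[N1 N2]]].
  - rewrite h1; auto.
  - rewrite h2; auto.
  - rewrite h3; auto.
  - rewrite (h1 x), h2; auto.
  - rewrite (h2 s), h1; auto.
  - now rewrite !(h3 x). }
exists (lam omega1 h); split; [trivial|split].
- intros a Ha; rewrite ap_lam by auto; apply h3.
  + intros C; now apply (AK a).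
  + intros (s & Hs & <-); apply (BK (j s)); auto.
- intros a Ha; rewrite ap_lam, h1 by auto; auto.
Qed.

Lemma uncountable_diff C : countable mem C -> ~ countable mem (diff omega1 C).
Proof.
intros HC H; apply omega1_uncountable; apply (countable_sub _ (cup C (diff omega1 C))).
- intros a Ha; apply in_cup; destruct (classic (a ∈ C)); [auto|right; now apply in_diff].
- now apply countable_cup.
Qed.

(** [E] is a class function, evaluated at natural numbers and at [omega], where it is the union of
    the finite stages. The injection in [tower_step] provides infinitely many new points at each
    stage. *)
Record tower (E0 : T) (E : T -> T) : Prop := {
  tower_F1 : F1 E;
  tower_base : forall m, E0 ⊆ E m;
  tower_mono : forall m m', m ⊆ m' -> E m ⊆ E m';
  tower_omega1 : E omega ⊆ omega1;
  tower_countable : countable mem (E omega);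
  tower_limit : forall a, a ∈ E omega -> exists m, m ∈ omega /\ a ∈ E m;
  tower_step : forall m, m ∈ omega -> exists i, F1 i /\
    (forall n, n ∈ omega -> i n ∈ E (succ m) /\ i n ∉ E m) /\
    forall n n', n ∈ omega -> n' ∈ omega -> i n = i n' -> n = n'
}.

Lemma nat_sub_omega m : m ∈ omega -> m ⊆ omega.
Proof. intros Hm n Hn; eapply omega_trans; eauto. Qed.

Lemma sub_succ m : m ⊆ succ m.
Proof. intros n Hn; apply in_succ; auto. Qed.

(** Infinitely many points [d n] outside [E0] are split into infinitely many infinite columns by
    [cantor]; stage [m] adds the columns below [m] to [E0]. *)
Lemma tower_exists E0 : E0 ⊆ omega1 -> countable mem E0 -> exists E, tower E0 E.
Proof.
intros H0 C0.
destruct (uncountable_injection ground_ac _ (uncountable_diff E0 C0)) as (d & Dd & Hd & Id).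
exists (fun m => cup E0 (rep (prod m omega) (fun u => d (cantor (fst u) (snd u))))).
assert (K : forall m a, a ∈ cup E0 (rep (prod m omega) (fun u => d (cantor (fst u) (snd u)))) <->
  a ∈ E0 \/ exists k i, k ∈ m /\ i ∈ omega /\ a = d (cantor k i)).
{ intros m a; rewrite in_cup, in_rep by dp; apply or_iff_compat_l; split.
  - intros (u & Hu & ->); apply in_prod in Hu as (k & i & Hk & Hi & ->).
    rewrite fst_opair, snd_opair; eauto.
  - intros (k & i & Hk & Hi & ->); exists (opair k i); now rewrite opair_in_prod, fst_opair, snd_opair. }
split.
- dp.
- intros m a Ha; apply K; auto.
- intros m m' H a Ha; apply K; apply K in Ha as [Ha|(k & i & Hk & Hi & ->)]; [auto|right; eauto 6].
- intros a Ha; apply K in Ha as [Ha|(k & i & Hk & Hi & ->)]; [auto|].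
  specialize (Hd _ (cantor_omega k i Hk Hi)); now apply in_diff in Hd.
- apply (countable_sub _ (cup E0 (rep omega d))).
  + intros a Ha; apply K in Ha as [Ha|(k & i & Hk & Hi & ->)]; apply in_cup; [auto|right].
    apply in_rep; [trivial|]; exists (cantor k i); auto using cantor_omega.
  + apply countable_cup; [trivial|]; apply countable_image; [trivial|apply countable_omega].
- intros a Ha; apply K in Ha as [Ha|(k & i & Hk & Hi & ->)].
  + exists empty; split; [apply omega_0|apply K; auto].
  + exists (succ k); split; [now apply omega_succ|apply K; right; exists k, i; split; [apply in_succ; auto|auto]].
- intros m Hm; exists (fun i => d (cantor m i)); split; [dp|split].
  + intros n Hn; split; [apply K; right; exists m, n; split; [apply in_succ; auto|auto]|].
    intros C; apply K in C as [C|(k & i & Hk & Hi & C)].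
    * specialize (Hd _ (cantor_omega m n Hm Hn)); apply in_diff in Hd; tauto.
    * assert (Hk' : k ∈ omega) by now apply (nat_sub_omega m).
      apply Id in C; auto using cantor_omega; apply cantor_inj in C as [-> _]; trivial.
      now apply mem_irrefl in Hk.
  + intros n n' Hn Hn' E; apply Id in E; auto using cantor_omega; now apply cantor_inj in E.
Qed.

Lemma nat_sub_total m n : m ∈ omega -> n ∈ omega -> m ⊆ n \/ n ⊆ m.
Proof.
intros Hm Hn; destruct (omega_total m n Hm Hn) as [C|[->|C]].
- left; intros k Hk; eapply nat_trans; eauto.
- left; apply subset_refl.
- right; intros k Hk; eapply nat_trans; eauto.
Qed.

(** The finiteness of conditions enters here: finitely many points of the union already lie in one
    stage. *)
Lemma tower_finite E0 E p : tower E0 E -> cond mem p ->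
  exists m, m ∈ omega /\ forall a, a ∈ supp p -> a ∈ E omega -> a ∈ E m.
Proof.
intros HE Hp; assert (Fp : finite mem p) by now apply condE in Hp.
clear Hp; revert p Fp; apply finite_ind.
- exists empty; split; [apply omega_0|]; intros a Ha; apply in_rep in Ha as (z & Hz & _); [|dp].
  now apply in_empty in Hz.
- intros p x _ (m & Hm & IH).
  assert (K : exists n, n ∈ omega /\ (fst (fst x) ∈ E omega -> fst (fst x) ∈ E n)).
  { destruct (classic (fst (fst x) ∈ E omega)) as [C|C]; [|exists empty; split; [apply omega_0|easy]].
    destruct (tower_limit _ _ HE _ C) as (n & Hn & C'); eauto. }
  destruct K as (n & Hn & K).
  assert (L : exists k, k ∈ omega /\ m ⊆ k /\ n ⊆ k).
  { destruct (nat_sub_total m n Hm Hn); [exists n|exists m]; auto using subset_refl. }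
  destruct L as (k & Hk & Lm & Ln); exists k; split; [trivial|]; intros a Ha Ca.
  apply in_rep in Ha as (z & Hz & ->); [|dp]; apply in_cup in Hz as [Hz|Hz].
  + apply (tower_mono _ _ HE m k Lm), IH; [|trivial]; apply in_rep; [dp|eauto].
  + apply in_pair in Hz; assert (z = x) as -> by tauto; apply (tower_mono _ _ HE n k Ln); auto.
Qed.

(** Moving [A] first away from the tower makes the target disjoint from what
    is moved into it. *)
Lemma tower_shift E0 E m A : tower E0 E -> m ∈ omega -> A ⊆ omega1 -> countable mem A ->
  exists pi, perm mem pi /\ fixes pi (E m) /\ forall a, a ∈ A -> ap pi a ∈ E (succ m).
Proof.
intros HE Hm HA CA.
assert (Em : E m ⊆ E omega) by (apply (tower_mono _ _ HE), nat_sub_omega; trivial).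
assert (Es : E (succ m) ⊆ E omega) by (apply (tower_mono _ _ HE), nat_sub_omega, omega_succ; trivial).
pose proof (tower_omega1 _ _ HE) as E1; pose proof (tower_countable _ _ HE) as CE.
assert (Em1 : E m ⊆ omega1) by (intros a Ha; auto).
set (C := cup (E omega) A).
assert (CC : countable mem C) by now apply countable_cup.
destruct (uncountable_injection ground_ac _ (uncountable_diff C CC)) as (i1 & Di1 & Hi1 & Ii1).
set (A1 := diff A (E m)).
assert (K1 : forall a, a ∈ A1 <-> a ∈ A /\ a ∉ E m) by (intros a; apply in_diff).
assert (KB : forall a, a ∈ diff omega1 C <-> a ∈ omega1 /\ a ∉ C) by (intros a; apply in_diff).
destruct (swap A1 (E m) (diff omega1 C) i1) as (pi1 & P1 & F1' & T1); trivial.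
{ intros a Ha; apply K1 in Ha; apply HA; tauto. }
{ intros a Ha; now apply KB in Ha. }
{ apply (countable_sub _ A); [|trivial]; intros a Ha; now apply K1 in Ha. }
{ intros a Ha; now apply K1 in Ha. }
{ intros a Ha Hb; apply KB in Hb as [_ Hb]; apply Hb, in_cup; right; now apply K1 in Ha. }
{ intros a Ha Hb; apply KB in Ha as [_ Ha]; apply Ha, in_cup; auto. }
destruct (tower_step _ _ HE m Hm) as (i2 & Di2 & Hi2 & Ii2).
assert (K2 : forall b, b ∈ rep A1 (ap pi1) -> b ∈ omega1 /\ b ∉ C).
{ intros b Hb; apply in_rep in Hb as (a & Ha & ->); [|dp]; now apply KB, T1. }
destruct (swap (rep A1 (ap pi1)) (E m) (diff (E (succ m)) (E m)) i2) as (pi2 & P2 & F2' & T2); trivial.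
{ intros b Hb; now apply K2. }
{ intros a Ha; apply in_diff in Ha as [Ha _]; auto. }
{ apply countable_image; [dp|]; apply (countable_sub _ A); [|trivial]; intros a Ha; now apply K1 in Ha. }
{ intros b Hb Hc; apply K2 in Hb as [_ Hb]; apply Hb, in_cup; auto. }
{ intros b Hb Hc; apply K2 in Hb as [_ Hb]; apply in_diff in Hc as [Hc _]; apply Hb, in_cup; auto. }
{ intros a Ha; now apply in_diff in Ha. }
{ intros n Hn; apply in_diff; now apply Hi2. }
exists (pcomp pi2 pi1); split; [auto|split].
- intros a Ha; rewrite ap_pcomp by auto; now rewrite F1', F2'.
- intros a Ha; rewrite ap_pcomp by auto; destruct (classic (a ∈ E m)) as [D|D].
  + rewrite F1', F2' by trivial; apply (tower_mono _ _ HE m); [apply sub_succ|trivial].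
  + assert (L : ap pi2 (ap pi1 a) ∈ diff (E (succ m)) (E m)); [|now apply in_diff in L].
    apply T2, in_rep; [dp|]; exists a; split; [now apply K1|trivial].
Qed.

End Towers.

(** * Names for pairs *)

Section PairNames.
Context {T : Type} {St : struct T} {M : model T St} {Gr : ground T St M}.
Local Notation HS := (HS mem mem_wf).

Definition upair_name (x y : T) : T := pair (opair x empty) (opair y empty).
Definition opair_name (x y : T) : T := upair_name (upair_name x x) (upair_name x y).
Lemma F2_upair_name : F2 upair_name. Proof. dpu upair_name. Qed.
#[local] Hint Resolve F2_upair_name : dp.
Lemma F2_opair_name : F2 opair_name. Proof. dpu opair_name. Qed.

Lemma name_upair x y : is_name mem x -> is_name mem y -> is_name mem (upair_name x y).
Proof.
intros Hx Hy; apply name_make; intros z Hz; apply in_pair in Hz as [-> | ->];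
  [exists x, empty|exists y, empty]; auto using cond_empty.
Qed.

Lemma act_upair_name pi x y : is_name mem x -> is_name mem y ->
  act pi (upair_name x y) = upair_name (act pi x) (act pi y).
Proof.
intros Hx Hy; apply ext; intros z; rewrite in_act by now apply name_upair.
unfold upair_name at 2; rewrite in_pair; split.
- intros (u & p & H & ->); unfold upair_name in H; apply in_pair in H as [E|E];
    apply opair_inj in E as [-> ->]; rewrite actc_empty; auto.
- intros [-> | ->]; [exists x, empty|exists y, empty]; rewrite actc_empty; unfold upair_name;
    rewrite in_pair; auto.
Qed.

Lemma HS_upair_name x y : HS x -> HS y -> HS (upair_name x y).
Proof.
intros Hx Hy; apply HS_make.
- intros z Hz; apply in_pair in Hz as [-> | ->]; [exists x, empty|exists y, empty];
    (split; [trivial|split; [trivial|apply cond_empty]]).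
- destruct (common_support (scons x (fun _ => y)) 2) as (E & H1 & H2 & H3); [intros [|n]; trivial|].
  exists E; split; [trivial|split; [trivial|]]; intros pi Hpi Hf; rewrite act_upair_name by auto.
  f_equal; [apply (H3 0)|apply (H3 1)]; trivial; lia.
Qed.

Lemma HS_opair_name x y : HS x -> HS y -> HS (opair_name x y).
Proof. intros Hx Hy; now repeat apply HS_upair_name. Qed.

Lemma act_opair_name pi x y : is_name mem x -> is_name mem y ->
  act pi (opair_name x y) = opair_name (act pi x) (act pi y).
Proof. intros Hx Hy; unfold opair_name; rewrite !act_upair_name; auto using name_upair. Qed.

End PairNames.
#[export] Hint Resolve F2_upair_name F2_opair_name : dp.

(** * Density of successors within the tower *)

Section Density.
Context {T : Type} {St : struct T} {M : model T St} {Gr : ground T St M}.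
Local Notation HS := (HS mem mem_wf).
Local Notation cond := (cond mem).
Variables (A E1 : T) (phi : formula) (e : nat -> T).
Hypothesis HA : HS A.
Hypothesis He : forall n, HS (e n).
Hypothesis HE1 : forall n, supports E1 (e n).
Hypothesis HE1A : supports E1 A.

Local Notation forces p x y := (force phi p (scons x (scons y e))).

(** A witness [y] for [x] can be moved by a permutation fixing everything
    relevant about [x], so it can be found one step further in the tower; the
    condition forcing this is compatible with [p], which only meets the tower
    in [E m]. *)
Lemma tower_dense E0 E p0 x : tower E0 E -> E1 ⊆ E0 -> supp p0 ⊆ E0 -> cond p0 ->
  (forall x, x ∈ dom A -> densely p0 (fun q => exists y, y ∈ dom A /\ forces q x y)) ->
  x ∈ dom A -> (exists m, m ∈ omega /\ supports (E m) x) ->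
  densely p0 (fun q => exists y, (y ∈ dom A /\ exists m, m ∈ omega /\ supports (E m) y) /\ forces q x y).
Proof.
intros HE S1 S0 Hp0 Hd Hx (k & Hk & Sx) p Hp Lp.
pose proof (HS_dom x A HA Hx) as Nx.
destruct (tower_finite E0 E p HE Hp) as (l & Hl & Bl).
assert (L : exists m, m ∈ omega /\ k ⊆ m /\ l ⊆ m).
{ destruct (nat_sub_total k l Hk Hl); [exists l|exists k]; auto using subset_refl. }
destruct L as (m & Hm & Lk & Ll); pose proof (omega_succ m Hm) as Hsm.
assert (Om : forall m, m ∈ omega -> E m ⊆ E omega) by (intros n Hn; apply (tower_mono _ _ HE), nat_sub_omega; trivial).
pose proof (tower_omega1 _ _ HE) as O1; pose proof (tower_countable _ _ HE) as OC.
(* The witness is sought below the part of [p] supported by [E m], which the permutation will fix.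
   This part still extends [p0], whose support lies in [E0]. *)
set (p' := sep p (fun z => fst (fst z) ∈ E m)).
assert (Kp : forall z, z ∈ p' <-> z ∈ p /\ fst (fst z) ∈ E m).
{ pose proof (tower_F1 _ _ HE); intros z; unfold p'; now rewrite in_sep by dp. }
assert (Lp' : p' ⊆ p) by (intros z Hz; now apply Kp in Hz).
assert (Hp' : cond p') by now apply (cond_sub p' p).
assert (Sp' : supp p' ⊆ E m).
{ intros a Ha; apply in_rep in Ha as (z & Hz & ->); [|dp]; now apply Kp in Hz. }
destruct (Hd x Hx p' Hp') as (q & Hq & Lq & y & Hy & F).
{ intros z Hz; apply Kp; split; [auto|]; apply (tower_base _ _ HE m), S0, in_rep; [dp|eauto]. }
pose proof (HS_dom y A HA Hy) as Ny.
destruct (HS_supports y Ny) as [Ey Sy]; destruct (supports_countable _ _ Sy) as [Sy1 Sy2].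
destruct (tower_shift E0 E m (cup (supp q) Ey) HE Hm) as (pi & Hpi & Hfix & Hmove).
{ intros a Ha; apply in_cup in Ha as [Ha|Ha]; [now apply (supp_omega1 q)|auto]. }
{ apply countable_cup; [now apply supp_countable|trivial]. }
assert (Fix1 : fixes pi E1) by (intros a Ha; apply Hfix, (tower_base _ _ HE); auto).
assert (Fixk : fixes pi (E k)) by (intros a Ha; apply Hfix, (tower_mono _ _ HE k); auto).
(* The permutation fixes the supports of [x] and of the parameters, so only the condition and the
   witness are moved. *)
assert (F' : forces (actc pi q) x (act pi y)).
{ replace (scons x (scons (act pi y) e)) with (fun n => act pi (scons x (scons y e) n)).
  - apply force_act; trivial; repeat apply scons_HS; trivial.
  - extensionality n; destruct n as [|[|n]]; simpl; [now apply Sx|trivial|now apply (HE1 n)]. }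
assert (Hq2 : cond (actc pi q)) by auto.
assert (Lq2 : p' ⊆ actc pi q).
{ rewrite <- (actc_fixes pi p'); [now apply actc_mono|trivial|]; intros a Ha; auto. }
assert (Sq2 : supp (actc pi q) ⊆ E (succ m)).
{ intros a Ha; apply supp_actc in Ha; trivial; apply in_rep in Ha as (b & Hb & ->); [|dp].
  apply Hmove, in_cup; auto. }
(* A coordinate shared by both conditions lies in [E (succ m)], hence in the tower, and so in [E m]
   by the choice of [m]. There [p] coincides with [p'], which the moved condition extends. *)
assert (Hr : cond (cup p (actc pi q))).
{ apply cond_cup; trivial; intros a n v v' H H'.
  assert (Ca : a ∈ E m).
  { apply (tower_mono _ _ HE l m Ll), Bl; [eapply entry_supp; eauto|].
    apply (Om (succ m) Hsm), Sq2; eapply entry_supp; eauto. }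
  apply (cond_fun (actc pi q) a n); trivial; apply Lq2, Kp; split; [trivial|].
  unfold entry; now rewrite !fst_opair. }
exists (cup p (actc pi q)); split; [trivial|split; [intros z Hz; apply in_cup; auto|]].
exists (act pi y); split; [split|].
- now apply (dom_invariant E1 A).
- exists (succ m); split; [trivial|]; apply (supports_sub (rep Ey (ap pi))).
  + intros a Ha; apply in_rep in Ha as (b & Hb & ->); [|dp]; apply Hmove, in_cup; auto.
  + intros a Ha; apply O1, (Om (succ m)); trivial.
  + apply (countable_sub _ (E omega)); [now apply Om|trivial].
  + apply supports_act; auto.
- apply (force_mono phi (actc pi q)); trivial; intros z Hz; apply in_cup; auto.
Qed.

End Density.

(** * Construction of the sequence in the extension *)

Section DependentChoice.
Context {T : Type} {St : struct T} {M : model T St} {Gr : ground T St M}.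
Local Notation HS := (HS mem mem_wf).
Local Notation cond := (cond mem).
Variable G : T -> Prop.
Hypothesis HG : generic mem G.
Local Notation val := (value mem_wf G).
Local Notation N := (sym_ext (mem:=mem) mem_wf G).
Local Notation nmem := (sym_ext_mem mem_wf G).
Local Notation point := (point G).
#[local] Instance ext_struct' : struct N := nmem.
(** Class terms such as [opair] and the lemmas on models now apply inside the extension as well. *)
#[local] Instance ext_model : model N nmem := Build_model N nmem (ext_wf G) (ext_ZF G HG).

Lemma point_opair_name (x y : T) (Hx : HS x) (Hy : HS y) :
  point (opair_name x y) (HS_opair_name x y Hx Hy) = opair (point x Hx) (point y Hy).
Proof.
assert (K : forall (x y : T) (Hx : HS x) (Hy : HS y) (H : HS (upair_name x y)),
  point (upair_name x y) H = pair (point x Hx) (point y Hy)).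
{ clear x y Hx Hy; intros x y Hx Hy H; apply is_upairE; intros w.
  change (set_mem (proj1_sig w) (val (upair_name x y)) <-> w = point x Hx \/ w = point y Hy).
  rewrite in_val; split.
  - intros (z & p & Hz & _ & E); unfold upair_name in Hz; apply in_pair in Hz as [E'|E'];
      apply opair_inj in E' as [-> _]; [left|right]; now apply sym_ext_eq.
  - intros [-> | ->]; [exists x, empty|exists y, empty]; (split; [apply in_pair; auto|]);
      (split; [exact (generic_empty G HG)|trivial]). }
unfold opair_name, opair.
rewrite (K _ _ (HS_upair_name x x Hx Hx) (HS_upair_name x y Hx Hy)); f_equal; apply K.
Qed.

(** Distinct levels are comparable by membership, canonical names preserve it, and no set is a
    member of itself. *)
Lemma val_check_inj (u v : T) : val (check (level u)) = val (check (level v)) -> level u = level v.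
Proof.
intros E.
assert (I : forall s : Defs.set, ~ set_mem s s).
{ intros s; induction (set_mem_wf s) as [s _ IH]; intros H; exact (IH s H H). }
destruct (level_total u v) as [C|[C|C]]; [|trivial|]; exfalso; apply (I (val (check (level u)))).
- rewrite E at 2; apply (in_val_check G HG); eauto.
- rewrite E at 1; apply (in_val_check G HG); eauto.
Qed.

Theorem ext_DC : DC nmem.
Proof.
intros A R [a0 Ha0] Htotal.
(* The implication gives every name in the domain of [A] a successor in the sense of this formula,
   including names whose value is not in [A]. *)
destruct (DP_peel2 (fun e : nat -> N => e 0 ∈ A -> e 1 ∈ A /\ app mem R (e 0) (e 1)) ltac:(dp)) as (phi & f & Hphi).
set (e' := fun n => place (fun _ : nat => A) (f n)).
destruct (env_names G e') as (e & He & Ee), (has_name G A) as (A' & HA & EA).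
destruct (finite_environment phi e A' He HA) as (e2 & E1 & He2 & S1 & C1 & Se2 & SA & Hbound).
set (forces := fun p x y : T => force phi p (scons x (scons y e2))).
assert (Df : D3 forces).
{ intros t s u Ht Hs Hu.
  apply (DP_force phi t (fun n env => scons (s env) (scons (u env) e2) n)); [trivial|].
  intros [|[|n]]; [exact Hs|exact Hu|exact (DF_const (e2 n))]. }
assert (forces_iff : forall (x y : T) (Hx : HS x) (Hy : HS y),
  (exists p, G p /\ forces p x y) <->
  (point x Hx ∈ A -> point y Hy ∈ A /\ app mem R (point x Hx) (point y Hy))).
{ intros x y Hx Hy.
  pose proof (Hphi (point x Hx) (point y Hy) (fun _ => A)) as K; simpl in K; rewrite K; clear K.
  fold e'; symmetry.
  assert (F2 : (exists p, G p /\ forces p x y) <-> exists p, G p /\ force phi p (scons x (scons y e))).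
  { split; intros (p & Gp & F); exists p; (split; [trivial|]); now apply (Hbound x y p). }
  rewrite F2; apply (truth G HG); [now repeat apply scons_HS|now repeat apply scons_val]. }
assert (Hz0 : exists z0 (Nz0 : HS z0), z0 ∈ dom A' /\ a0 = point z0 Nz0).
{ change (set_mem (proj1_sig a0) (proj1_sig A)) in Ha0; rewrite EA in Ha0.
  destruct (below G _ A' HA Ha0) as (z & r & Nz & Hz & _ & E).
  exists z, Nz; split; [apply in_dom; eauto|now apply sym_ext_eq]. }
destruct Hz0 as (z0 & Nz0 & Hz0 & Ea0).
assert (witness : forall (x : T), x ∈ dom A' -> exists p y, G p /\ y ∈ dom A' /\ forces p x y).
{ intros x Hx; pose proof (HS_dom x A' HA Hx) as Nx.
  destruct (classic (point x Nx ∈ A)) as [Ax|Ax].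
  - destruct (Htotal _ Ax) as (b & Hb & HR); assert (Hb' := Hb).
    change (set_mem (proj1_sig b) (proj1_sig A)) in Hb'; rewrite EA in Hb'.
    destruct (below G _ A' HA Hb') as (y & r & Ny & Hy & _ & E).
    apply (sym_ext_eq G) in E; subst b.
    destruct (proj2 (forces_iff x y Nx Ny)) as (p & Gp & F); [auto|].
    exists p, y; split; [trivial|split; [apply in_dom; eauto|trivial]].
  (* For a name outside [A] the premise fails, so any name will do, and [z0] is at hand. *)
  - destruct (proj2 (forces_iff x z0 Nx Nz0)) as (p & Gp & F); [easy|eauto 6]. }
assert (Hp0 : exists p0, G p0 /\ forall x, x ∈ dom A' -> densely p0 (fun q => exists y, y ∈ dom A' /\ forces q x y)).
(* Densely, a condition either leaves successors dense for every name in [dom A'] or excludes all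
   successors of one of them; by [witness] the latter does not happen in [G]. *)
{ destruct (generic_meets G HG empty (fun p => (forall x, x ∈ dom A' -> densely p (fun q => exists y, y ∈ dom A' /\ forces q x y)) \/
    exists x, x ∈ dom A' /\ forall q, cond q -> p ⊆ q -> ~ exists y, y ∈ dom A' /\ forces q x y)) as (p & Gp & [H|(x & Hx & H)]).
  - unfold densely; dp.
  - exact (generic_empty G HG).
  - intros p Hp _; apply NNPP; intros K; apply K; exists p; split; [trivial|split; [apply subset_refl|left]].
    intros x Hx q Hq Lq; apply NNPP; intros K'; apply K; exists q; split; [trivial|split; [trivial|right]].
    exists x; split; [trivial|]; intros r Hr Lr F; apply K'; exists r; auto.
  - eauto.
  - exfalso; destruct (witness x Hx) as (q & y & Gq & Hy & F).
    destruct (generic_dir G HG p q Gp Gq) as (r & Gr' & L & L').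
    pose proof (generic_cond G HG r Gr') as Hr.
    apply (H r Hr L); exists y; split; [trivial|]; now apply (force_mono phi q). }
destruct Hp0 as (p0 & Gp0 & Hp0); pose proof (generic_cond G HG p0 Gp0) as Cp0.
destruct (HS_supports z0 Nz0) as [E2 SE2]; destruct (supports_countable _ _ SE2) as [S2 C2].
(* The support [E2] of the starting name is included in order that [z0] belongs to [X]. *)
set (E0 := cup (cup E1 E2) (supp p0)).
assert (I1 : E1 ⊆ E0) by (intros a Ha; apply in_cup; left; apply in_cup; auto).
assert (I2 : E2 ⊆ E0) by (intros a Ha; apply in_cup; left; apply in_cup; auto).
assert (I3 : supp p0 ⊆ E0) by (intros a Ha; apply in_cup; auto).
destruct (tower_exists E0) as [E HE].
{ intros a Ha; apply in_cup in Ha as [Ha|Ha]; [apply in_cup in Ha as [Ha|Ha]; auto|now apply (supp_omega1 p0)]. }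
{ apply countable_cup; [now apply countable_cup|now apply supp_countable]. }
pose proof (tower_F1 _ _ HE) as DE.
set (X := sep (dom A') (fun y => exists m, m ∈ omega /\ supports (E m) y)).
assert (KX : forall y, y ∈ X <-> y ∈ dom A' /\ exists m, m ∈ omega /\ supports (E m) y).
{ intros y; unfold X; now rewrite in_sep by dp. }
assert (NX : forall y, y ∈ X -> HS y) by (intros y Hy; apply KX in Hy as [Hy _]; now apply (HS_dom y A')).
assert (Xz0 : z0 ∈ X).
{ apply KX; split; [trivial|]; exists empty; split; [apply omega_0|].
  apply (supports_sub E2); trivial.
  - intros a Ha; apply (tower_base _ _ HE); auto.
  - intros a Ha; apply (tower_omega1 _ _ HE), (tower_mono _ _ HE empty); [apply empty_sub|trivial].
  - apply (countable_sub _ (E omega)); [apply (tower_mono _ _ HE), empty_sub|apply (tower_countable _ _ HE)]. }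
assert (Xstep : forall x, x ∈ X -> exists p y, G p /\ y ∈ X /\ forces p x y).
{ intros x Hx; pose proof Hx as Hx'; apply KX in Hx' as [Hx1 Hx2].
  destruct (generic_meets G HG p0 (fun q => exists y, y ∈ X /\ forces q x y)) as (q & Gq & y & Hy & F); [dp|trivial| |eauto 6].
  pose proof (tower_dense A' E1 phi e2 HA He2 Se2 SA E0 E p0 x HE I1 I3 Cp0 Hp0 Hx1 Hx2) as K.
  revert K; apply densely_imp; intros q Hq (y & Hy & F); exists y; split; [now apply KX|exact F]. }
destruct (level_wellorder ground_ac X) as (W & W1 & W2 & W3).
(* Canonical names of levels are fixed by all permutations and names in [X] by those fixing
   [E omega], hence so are these pairs. Distinct names in [X] may have the same value, so the
   relation obtained is functional only from indices to values, as [wellordered_DC] asks. *)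
set (names := rep W (fun u => opair_name (check (fst u)) (snd u))).
assert (Kn : forall z, z ∈ names <-> exists u x, opair (level u) x ∈ W /\ x ∈ X /\ z = opair_name (check (level u)) x).
{ intros z; unfold names; rewrite in_rep by dp; split.
  - intros (w & Hw & ->); destruct (W1 w Hw) as (u & x & Hx & ->); exists u, x; now rewrite fst_opair, snd_opair.
  - intros (u & x & Hw & Hx & ->); exists (opair (level u) x); now rewrite fst_opair, snd_opair. }
destruct (ext_collect G HG names (E omega)) as [WN HWN].
{ intros z Hz; apply Kn in Hz as (u & x & _ & Hx & ->); apply HS_opair_name; auto using HS_check. }
{ apply (tower_omega1 _ _ HE). }
{ apply (tower_countable _ _ HE). }
{ intros pi Hpi Hf z Hz; apply Kn in Hz as (u & x & Hw & Hx & ->); apply Kn; exists u, x.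
  split; [trivial|split; [trivial|]]; rewrite act_opair_name by auto using is_name_check; f_equal; [apply act_check|].
  apply KX in Hx as (_ & m & Hm & _ & _ & Sx); apply Sx; trivial.
  apply (fixes_sub pi (E m) (E omega)); [|trivial]; now apply (tower_mono _ _ HE), nat_sub_omega. }
assert (KW : forall l y : N, opair l y ∈ WN <-> exists (u x : T) (Nx : HS x), opair (level u) x ∈ W /\ x ∈ X /\
  l = point (check (level u)) (HS_check _) /\ y = point x Nx).
{ intros l y; split.
  - intros H; apply HWN in H as (z & Hz & Ez); apply Kn in Hz as (u & x & Hw & Hx & ->).
    exists u, x, (NX x Hx); split; [trivial|split; [trivial|]].
    apply opair_inj; rewrite <- (point_opair_name _ _ (HS_check (level u)) (NX x Hx)); now apply sym_ext_eq.
  - intros (u & x & Nx & Hw & Hx & -> & ->); rewrite <- point_opair_name; apply HWN.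
    exists (opair_name (check (level u)) x); split; [|trivial]; apply Kn; eauto 6. }
apply (wellordered_DC A R WN a0).
- intros l y l' y' H H'; apply KW in H as (u & x & Nx & _ & _ & -> & _), H' as (u' & x' & Nx' & _ & _ & -> & _).
  destruct (level_total u u') as [C|[C|C]].
  + left; apply (in_val_check G HG); eauto.
  + right; left; apply sym_ext_eq; simpl; now rewrite C.
  + right; right; apply (in_val_check G HG); eauto.
- intros l y y' H H'; apply KW in H as (u & x & Nx & Hw & _ & El & ->), H' as (u' & x' & Nx' & Hw' & _ & El' & ->).
  assert (E' : level u = level u') by (apply val_check_inj; rewrite El in El'; now apply (f_equal (@proj1_sig _ _)) in El').
  rewrite E' in Hw; apply sym_ext_eq; simpl; now rewrite (W2 _ _ _ Hw Hw').
- exact Ha0.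
- destruct (W3 z0 Xz0) as [l Hl]; destruct (W1 _ Hl) as (u & x & _ & E'); apply opair_inj in E' as [-> <-].
  exists (point (check (level u)) (HS_check _)); apply KW; eauto 8.
- intros x Hx [l Hl]; apply KW in Hl as (u & x' & Nx & _ & Xx & _ & ->).
  destruct (Xstep x' Xx) as (p & y & Gp & Hy & F).
  destruct (proj1 (forces_iff x' y Nx (NX y Hy)) (ex_intro _ p (conj Gp F)) Hx) as [Ay HR].
  exists (point y (NX y Hy)); split; [trivial|split; [|now apply appE]].
  destruct (W3 y Hy) as [l' Hl']; destruct (W1 _ Hl') as (u' & x2 & _ & E'); apply opair_inj in E' as [-> <-].
  exists (point (check (level u')) (HS_check _)); apply KW; eauto 8.
Qed.

End DependentChoice.

Theorem theorem3p11 :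
  forall (V : Type) (mem : V -> V -> Prop) (mem_wf : well_founded mem),
  ZFC mem ->
  forall G0 : V -> Prop, generic mem G0 ->
  ZF (sym_ext_mem mem_wf G0) /\ DC (sym_ext_mem mem_wf G0).
Proof.
intros V mem mem_wf [Hzf Hac] G0 HG.
assert (Ho : exists o, is_omega1 mem o).
(* A condition of the filter carries ω₁ as one of its witnesses. *)
{ destruct (gen_nonempty _ _ HG) as [p Gp]; destruct (gen_cond _ _ HG p Gp) as (w & o & _ & Ho & _); eauto. }
pose (M := Build_model V mem mem_wf Hzf : model V mem).
pose (Gr := Build_ground V mem M Hac Ho : ground V mem M).
split.
- exact (ext_ZF (Gr := Gr) G0 HG).
- exact (ext_DC (Gr := Gr) G0 HG).
Qed.
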